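(* Let $T>0$ and $D:=\mathbb{R}^4\times[0,T]$. There is an absolute constant $C>0$ with the following property. Let $\{u_k\}_{k\in\mathbb{N}}\subset L_t^\infty L_x^2\cap L_t^2H_x^1(D)$ be a bounded sequence and let $u$ be its limit in the sense that $u_k\to u$ weakly in $L_t^2H_x^1$ and weakly-$*$ in $L_t^\infty L_x^2$. Suppose $u_k$ converges to $u$ in $L^1_{\mathrm{loc}}(D)$. Assume that $\mu_k=|\nabla u_k|^2dxdt\to\mu$ and $\nu_k=|u_k|^3dxdt\to\nu$ weakly in the sense of measures, where $\mu$ and $\nu$ are bounded nonnegative measures on $\mathbb{R}^4\times[0,T]$. Then there exist nonnegative finite measures $\omega$ and $\lambda$ on $\mathbb{R}^4\times[0,T]$ such that for any $\varphi\in C_c^\infty(D)$, $$\iint\varphi\,d\mu=\iint\varphi|\nabla u|^2\,dxdt+\iint\varphi\,d\lambda,\qquad \iint\varphi\,d\nu=\iint\varphi|u|^3\,dxdt+\iint\varphi\,d\omega.$$ Moreover, $\omega\ll\lambda$, and for any open subdomain $Q$ of $D$, $$\iint_Qd\omega\le C\liminf_{k\to\infty}\|u_k-u\|_{L_t^\infty L_x^2(Q)}\iint_Qd\lambda.$$ In particular, the Radon–Nikodym derivative satisfies (at $\lambda$-almost every $(x_0,t_0)$) $$\frac{d\omega}{d\lambda}(x_0,t_0)\le C\lim_{r\to0}\liminf_{k\to\infty}\|u_k-u\|_{L_t^\infty L_x^2(Q_r^*(x_0,t_0))},$$ where $Q_r^*(x_0,t_0):=B_r(x_0)\times(t_0-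\frac{r^2}{2},t_0+\frac{r^2}{2})$.
   Context: Weak convergence in the sense of measures is understood against bounded continuous functions (in particular weakly convergent sequences of measures are tight). $C_c^\infty(D)$ denotes smooth functions on $D$ with compact support in $D$. *)

(* Defs.v *)
From HB Require Import structures.
From mathcomp Require Import all_boot all_order all_algebra.
From mathcomp Require Import all_classical all_reals all_analysis.
Set Implicit Arguments.
Unset Strict Implicit.
Unset Printing Implicit Defensive.
Import Order.TTheory GRing.Theory Num.Theory.
Import numFieldNormedType.Exports.

Local Open Scope classical_set_scope.
Local Open Scope ring_scope.

(* The factors are [measurableTypeR R], the domain of [lebesgue_measure]: with
   plain [R] the product sigma-algebra would be inferred with another display. *)
Definition space4 (R : realType) : measurableType _ :=
  (measurableTypeR R * measurableTypeR R * measurableTypeR R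
   * measurableTypeR R)%type.

Definition spacetime (R : realType) : measurableType _ :=
  (space4 R * measurableTypeR R)%type.

Definition leb4 (R : realType) : {measure set (space4 R) -> \bar R} :=
  (lebesgue_measure \x lebesgue_measure \x lebesgue_measure
   \x lebesgue_measure)%E.
Arguments leb4 {R}.

Definition leb5 (R : realType) : {measure set (spacetime R) -> \bar R} :=
  (leb4 \x lebesgue_measure)%E.
Arguments leb5 {R}.

(* The library norm of a product is the sup norm; balls of R^4 are Euclidean. *)
Definition norm4 (R : realType) (x : space4 R) : R :=
  Num.sqrt (x.1.1.1 ^+ 2 + x.1.1.2 ^+ 2 + x.1.2 ^+ 2 + x.2 ^+ 2).

Definition basis4 (R : realType) (j : 'I_4) : space4 R :=
  ((j == 0 :> nat)%:R, (j == 1 :> nat)%:R,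
   (j == 2 :> nat)%:R, (j == 3 :> nat)%:R).

Definition slab (R : realType) (T : R) : set (spacetime R) :=
  [set z | 0 <= z.2 <= T].

Definition cylinder (R : realType) (r : R) (z0 : spacetime R) :
    set (spacetime R) :=
  [set z | norm4 (z.1 - z0.1) < r /\
           z0.2 - r ^+ 2 / 2 < z.2 < z0.2 + r ^+ 2 / 2].

Definition open_in (X : topologicalType) (D Q : set X) : Prop :=
  exists2 O : set X, open O & Q = O `&` D.

(* C^n in the sense of iterated directional derivatives. *)
Fixpoint Cn (R : realType) (V : normedModType R) (n : nat) (f : V -> R) :
    Prop :=
  match n with
  | 0 => continuous f
  | n'.+1 => (forall x, differentiable f x) /\
             (forall v : V, Cn n' (fun x => 'D_v f x))
  end.

(* A test function on the closed slab R^4 x [0, T] is the restriction of a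
   [test_function] on R^4 x R; it need not vanish at t = 0 or t = T. *)
Definition test_function (R : realType) (V : normedModType R) (f : V -> R) :
    Prop :=
  (forall n, Cn n f) /\ compact (closure [set x | f x != 0]).

(* Values of u are in 'cV_m and those of its spatial gradient in 'M_(m, 4),
   with (Du z) i j = d_j u_i. On column vectors [frob] is the Euclidean norm. *)
Definition frobdot (R : realType) (m n : nat) (A B : 'M[R]_(m, n)) : R :=
  \sum_i \sum_j A i j * B i j.

Definition frob (R : realType) (m n : nat) (A : 'M[R]_(m, n)) : R :=
  Num.sqrt (frobdot A A).

Definition mx_measurable (R : realType) (m n : nat) (D : set (spacetime R))
    (f : spacetime R -> 'M[R]_(m, n)) : Prop :=
  forall i j, measurable_fun D (fun z => f z i j).

(* The norm of L_t^p L_x^q(Q):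
   the L^p norm in t of the L^q norm of f(., t) over the slice Q_t. *)
Definition mixed_norm (R : realType) (m n : nat) (p q : \bar R)
    (Q : set (spacetime R)) (f : spacetime R -> 'M[R]_(m, n)) : \bar R :=
  Lnorm (@lebesgue_measure R) p (fun t : measurableTypeR R =>
    Lnorm leb4 q (fun x => (frob (f (x, t)) * \1_Q (x, t))%:E)).

Definition weak_grad (R : realType) (m : nat) (v : space4 R -> 'cV[R]_m)
    (Dv : space4 R -> 'M[R]_(m, 4)) : Prop :=
  forall phi : space4 R -> R, test_function phi -> forall i j,
    \int[leb4]_x (v x i ord0 * 'D_(basis4 R j) phi x)
    = - \int[leb4]_x (Dv x i j * phi x).

Definition LinfL2 (R : realType) (m : nat) (T : R)
    (u : spacetime R -> 'cV[R]_m) : Prop :=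
  mx_measurable (slab T) u /\ (mixed_norm +oo 2%:E (slab T) u < +oo)%E.

(* The predual of L_t^oo L_x^2(R^4 x [0, T]), for weak-* convergence. *)
Definition L1L2 (R : realType) (m : nat) (T : R)
    (u : spacetime R -> 'cV[R]_m) : Prop :=
  mx_measurable (slab T) u /\ (mixed_norm 1%:E 2%:E (slab T) u < +oo)%E.

(* Membership in L_t^2 H_x^1(R^4 x [0, T]); the spatial gradient Du, determined
   by u almost everywhere, is carried along as an explicit function. *)
Definition L2H1 (R : realType) (m : nat) (T : R)
    (u : spacetime R -> 'cV[R]_m) (Du : spacetime R -> 'M[R]_(m, 4)) : Prop :=
  [/\ mx_measurable (slab T) u, mx_measurable (slab T) Du,
      (mixed_norm 2%:E 2%:E (slab T) u < +oo)%E,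
      (mixed_norm 2%:E 2%:E (slab T) Du < +oo)%E &
      {ae @lebesgue_measure R, forall t, 0 <= t <= T ->
         weak_grad (fun x => u (x, t)) (fun x => Du (x, t))}].

(* L_t^2 H_x^1 is a Hilbert space: test against its elements through the inner
   product of H^1. *)
Definition weak_cvg_L2H1 (R : realType) (m : nat) (T : R)
    (uk : nat -> spacetime R -> 'cV[R]_m)
    (Duk : nat -> spacetime R -> 'M[R]_(m, 4))
    (u : spacetime R -> 'cV[R]_m) (Du : spacetime R -> 'M[R]_(m, 4)) : Prop :=
  forall v Dv, L2H1 T v Dv ->
    \int[leb5]_(z in slab T)
      (frobdot (uk k z) (v z) + frobdot (Duk k z) (Dv z)) @[k --> \oo]
    --> \int[leb5]_(z in slab T)
          (frobdot (u z) (v z) + frobdot (Du z) (Dv z)).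

Definition weak_star_cvg_LinfL2 (R : realType) (m : nat) (T : R)
    (uk : nat -> spacetime R -> 'cV[R]_m)
    (u : spacetime R -> 'cV[R]_m) : Prop :=
  forall v, L1L2 T v ->
    \int[leb5]_(z in slab T) frobdot (uk k z) (v z) @[k --> \oo]
    --> \int[leb5]_(z in slab T) frobdot (u z) (v z).

Definition cvg_L1loc (R : realType) (m : nat) (D : set (spacetime R))
    (uk : nat -> spacetime R -> 'cV[R]_m)
    (u : spacetime R -> 'cV[R]_m) : Prop :=
  forall K, compact K -> K `<=` D ->
    (\int[leb5]_(z in K) (frob (uk k z - u z))%:E)%E @[k --> \oo] --> 0%E.

(* A measure on D is a measure on R^4 x R that vanishes off D. *)
Definition carried_by (R : realType) (D : set (spacetime R))
    (mu : set (spacetime R) -> \bar R) : Prop := mu (~` D) = 0%E.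

(* g k is the density of the k-th measure with respect to dx dt on D. *)
Definition weak_cvg_measure (R : realType) (D : set (spacetime R))
    (g : nat -> spacetime R -> R)
    (mu : {finite_measure set (spacetime R) -> \bar R}) : Prop :=
  forall f : spacetime R -> R,
    {within D, continuous f} ->
    (exists M : R, forall z, D z -> `|f z| <= M) ->
    \int[leb5]_(z in D) (f z * g k z) @[k --> \oo]
    --> \int[mu]_(z in D) f z.

(* Main.v *)
Require Import Defs.
From HB Require Import structures.
From mathcomp Require Import all_boot all_order all_algebra.
From mathcomp Require Import all_classical all_reals all_analysis.
From mathcomp Require Import measurable_realfun ess_sup_inf ring lra.
Set Implicit Arguments.
Unset Strict Implicit.
Unset Printing Implicit Defensive.
Import Order.TTheory GRing.Theory Num.Theory.
Import numFieldNormedType.Exports.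

Local Open Scope classical_set_scope.
Local Open Scope ring_scope.
Local Open Scope charge_scope.


(* Extend all fields by 0 outside the slab and put v_k = u_k - u.  On R^4 the
   Gagliardo-Nirenberg inequality |v|_3^3 <= C |v|_2 |grad v|_2^2 (from the
   Loomis-Whitney inequality and, on almost every line, |v|^3 <= 3 int v^2 |v'|)
   applied to phi v_k at almost every time and integrated in t gives, for
   0 <= phi <= 1,
     int phi^3 |v_k|^3 <= C |phi v_k|_{L^oo_t L^2_x}
                          (int phi^2 |grad v_k|^2 + int_{supp phi} |v_k|^2).
   As v_k -> 0 in L^1_loc and v_k is bounded in L^3, the last integral tends to
   0, the mixed terms of |u_k|^3 = |v_k + u|^3 vanish (Brezis-Lieb), and
   integration by parts shows that grad v_k -> 0 weakly in L^2.  Hence the left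
   side tends to int phi^3 d(nu - |u|^3) and the right side to
   int phi^2 d(mu - |grad u|^2); letting phi tend to the indicator of an open
   set bounds omega by lambda there, first on open sets, then by outer regularity
   on Borel sets.  The bound on the density follows by applying this to a
   countable base of open boxes. *)

(** * Boxes, open sets and outer regularity *)

(** Weak derivatives are only ever tested against bumps, a family stable under translation: testing
    with a shifted bump and integrating over the shift gives the increments of the field along
    almost every line, so no mollification or density argument is needed. Truncating |v| at a level
    N makes its fourth power integrable, which permits dividing by that integral before N tends to
    infinity. The constant 18 is 9 times 2. The factor 3 on each of four lines gives int |v|^4 <=
    3^4 (int |grad v|^2)^2, whose square root enters through Cauchy-Schwarz between L^2 and L^4; the
    2 comes from splitting the square of the gradient of phi v. The lower limit in k costs nothing:
    both sides of the localized inequality converge, so it need only hold for infinitely many k. The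
    powers phi^3 and phi^2 differ, but both tend to the same indicator. No time derivative enters,
    so the extension by 0 across t = 0 and t = T preserves spatial weak gradients, and relatively
    open subsets of the slab can be treated as traces of open sets. *)

Definition box4 (R : realType) (a b : space4 R) : set (space4 R) :=
  `]a.1.1.1, b.1.1.1[ `*` `]a.1.1.2, b.1.1.2[ `*` `]a.1.2, b.1.2[
  `*` `]a.2, b.2[.

Definition box5 (R : realType) (a b : spacetime R) : set (spacetime R) :=
  box4 a.1 b.1 `*` `]a.2, b.2[.

Definition boxes4 (R : realType) : set (set (space4 R)) :=
  [set A | exists a b, A = box4 a b].

Definition boxes5 (R : realType) : set (set (spacetime R)) :=
  [set A | exists a b, A = box5 a b].

Lemma measurable_box4 (R : realType) (a b : space4 R) : measurable (box4 a b).
Proof. by do 3 apply: measurableX => //. Qed.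

Lemma measurable_box5 (R : realType) (a b : spacetime R) : measurable (box5 a b).
Proof. by apply: measurableX => //; exact: measurable_box4. Qed.

Lemma itv_ooI (R : realType) (a b c d : R) :
  `]a, b[ `&` `]c, d[ = `]Num.max a c, Num.min b d[%classic.
Proof.
apply/seteqP; split => x /=; rewrite !in_itv/= gt_max lt_min.
  by move=> [/andP[-> ->] /andP[-> ->]].
by move=> /andP[/andP[-> ->] /andP[-> ->]].
Qed.

Lemma box4I (R : realType) (a b c d : space4 R) :
  exists e f, box4 a b `&` box4 c d = box4 e f.
Proof.
exists (Num.max a.1.1.1 c.1.1.1, Num.max a.1.1.2 c.1.1.2, Num.max a.1.2 c.1.2, Num.max a.2 c.2).
exists (Num.min b.1.1.1 d.1.1.1, Num.min b.1.1.2 d.1.1.2, Num.min b.1.2 d.1.2, Num.min b.2 d.2).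
by rewrite /box4/= -!setXI !itv_ooI.
Qed.

Lemma setI_closed_boxes4 (R : realType) : setI_closed (@boxes4 R).
Proof. by move=> _ _ [a [b ->]] [c [d ->]]; exact: box4I. Qed.

Lemma setI_closed_boxes5 (R : realType) : setI_closed (@boxes5 R).
Proof.
move=> _ _ [a [b ->]] [c [d ->]]; have [e [f ef]] := box4I a.1 b.1 c.1 d.1.
exists (e, Num.max a.2 c.2), (f, Num.min b.2 d.2).
by rewrite /box5 -setXI ef itv_ooI.
Qed.

Lemma itv_oo_cover (R : realType) :
  \bigcup_n `](- n%:R)%R, (n%:R)%R[%classic = [set: R].
Proof.
apply/seteqP; split => // x _.
exists (Num.truncn `|x|).+1 => //=; rewrite in_itv/= -ltr_norml.
exact: truncnS_gt.
Qed.

Definition cst4 (R : realType) (c : R) : space4 R := (c, c, c, c).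
Definition cst5 (R : realType) (c : R) : spacetime R := (cst4 c, c).

Lemma itv_oo_mono (R : realType) (m n : nat) : (m <= n)%N ->
  `](- m%:R)%R, (m%:R)%R[%classic `<=` (`](- n%:R)%R, (n%:R)%R[%classic : set R).
Proof.
move=> mn x /=; rewrite !in_itv/= -!ltr_norml => /lt_le_trans; apply.
by rewrite ler_nat.
Qed.

Lemma box4_cover (R : realType) :
  \bigcup_n box4 (cst4 (- n%:R)) (cst4 n%:R) = [set: space4 R].
Proof.
apply/seteqP; split => // -[[[x y] z] t] _.
have c (u : R) : (\bigcup_n `](- n%:R)%R, (n%:R)%R[%classic) u by rewrite itv_oo_cover.
have [[a _ ax] [b _ bx] [c' _ cx] [d _ dx]] := And4 (c x) (c y) (c z) (c t).
exists (maxn (maxn a b) (maxn c' d)) => //; do ! split => /=.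
- by move: ax; apply: itv_oo_mono; rewrite !leq_max leqnn.
- by move: bx; apply: itv_oo_mono; rewrite !leq_max leqnn ?orbT.
- by move: cx; apply: itv_oo_mono; rewrite !leq_max leqnn ?orbT.
- by move: dx; apply: itv_oo_mono; rewrite !leq_max leqnn ?orbT.
Qed.

Lemma setX_bigcupr T1 T2 (A : set T1) (F : (set T2)^nat) :
  A `*` \bigcup_n F n = \bigcup_n (A `*` F n).
Proof.
apply/seteqP; split => [[x y] [Ax [n _ Fn]]|[x y] [n _ [Ax Fn]]].
  by exists n.
by split => //; exists n.
Qed.

Lemma setX_bigcupl T1 T2 (A : set T2) (F : (set T1)^nat) :
  (\bigcup_n F n) `*` A = \bigcup_n (F n `*` A).
Proof.
apply/seteqP; split => [[x y] [[n _ Fn] Ay]|[x y] [n _ [Fn Ay]]].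
  by exists n.
by split => //; exists n.
Qed.

(** For a fixed second factor, the sets whose product with it lies in [<<s G >>] form a
    sigma-algebra; the argument is run once per factor. The exhausting sequences [g1] and [g2] make
    the full strip over a generator available, without which complements would leave the class:
    generators such as bounded intervals do not contain the whole space. *)
Lemma measurable_prod_gen d1 d2 (T1 : measurableType d1) (T2 : measurableType d2)
    (G1 : set (set T1)) (G2 : set (set T2)) (g1 : (set T1)^nat) (g2 : (set T2)^nat) :
  measurable = <<s G1 >> -> measurable = <<s G2 >> ->
  (forall n, G1 (g1 n)) -> (forall n, G2 (g2 n)) ->
  \bigcup_n g1 n = setT -> \bigcup_n g2 n = setT ->
  @measurable _ (T1 * T2)%type = <<s [set A `*` B | A in G1 & B in G2] >>.
Proof.
move=> m1 m2 Gg1 Gg2 c1 c2.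
set G := (X in <<s X >>).
have sG : sigma_algebra setT <<s G >> by exact: smallest_sigma_algebra.
have sC A : <<s G >> A -> <<s G >> (~` A).
  by move=> GA; rewrite -setTD; exact: sigma_algebraCD.
have sU F : (forall n : nat, <<s G >> (F n)) -> <<s G >> (\bigcup_n F n).
  by move=> GF; exact: sigma_algebra_bigcup.
have sD A B : <<s G >> A -> <<s G >> B -> <<s G >> (A `\` B).
  move=> GA GB; rewrite setDE -[X in <<s G >> X]setCK setCI setCK -bigcup2E.
  by apply: (sC); apply: sU => -[|[|n]] /=; [exact: sC| |case: sG].
have H1 A B : measurable A -> G2 B -> <<s G >> (A `*` B).
  rewrite m1 => mA GB; move: A mA.
  suff : <<s G1 >> `<=` [set A | <<s G >> (A `*` B)] by [].
  apply: smallest_sub; last first.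
    by move=> A GA; apply: sub_sigma_algebra; exists A => //; exists B.
  have sT : <<s G >> (setT `*` B).
    rewrite -c1 setX_bigcupl; apply: sU => n; apply: sub_sigma_algebra.
    by exists (g1 n) => //; exists B.
  split=> /=.
  - by rewrite set0X; case: sG.
  - move=> A GA; rewrite setTD.
    rewrite (_ : ~` A `*` B = (setT `*` B) `\` (A `*` B)).
      exact: sD.
    apply/seteqP; split => [[x y] [/= nA By]|[x y] [/= [_ By] nAB]]; split => //=.
      by case.
    by move=> Ax; apply: nAB.
  - by move=> F GF; rewrite setX_bigcupl; exact: sU.
have H2 A B : measurable A -> measurable B -> <<s G >> (A `*` B).
  move=> mA; rewrite m2; move: B.
  suff : <<s G2 >> `<=` [set B | <<s G >> (A `*` B)] by [].
  apply: smallest_sub; last by move=> B GB; exact: H1.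
  have sT : <<s G >> (A `*` setT).
    by rewrite -c2 setX_bigcupr; apply: sU => n; apply: H1.
  split=> /=.
  - by rewrite setX0; case: sG.
  - move=> B GB; rewrite setTD.
    rewrite (_ : A `*` ~` B = (A `*` setT) `\` (A `*` B)).
      exact: sD.
    apply/seteqP; split => [[x y] [/= Ax nB]|[x y] [/= [Ax _] nAB]]; split => //=.
      by case.
    by move=> By; apply: nAB.
  - by move=> F GF; rewrite setX_bigcupr; exact: sU.
rewrite measurable_prod_measurableType; apply/seteqP; split.
  apply: smallest_sub => // _ [A mA [B mB <-]]; exact: H2.
apply: smallest_sub; first exact: smallest_sigma_algebra.
move=> _ [A GA [B GB <-]]; apply: sub_sigma_algebra; exists A.
  by rewrite m1; exact: sub_sigma_algebra.
by exists B => //; rewrite m2; exact: sub_sigma_algebra.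
Qed.

Lemma bigcup_setX_T T1 T2 (F1 : (set T1)^nat)
  (F2 : (set T2)^nat) : \bigcup_n F1 n = setT -> \bigcup_n F2 n = setT ->
  (forall m n, (m <= n)%N -> F1 m `<=` F1 n) -> (forall m n, (m <= n)%N -> F2 m `<=` F2 n) ->
  \bigcup_n (F1 n `*` F2 n) = setT.
Proof.
move=> c1 c2 m1 m2; apply/seteqP; split => // -[x y] _.
have [a _ ax] : (\bigcup_n F1 n) x by rewrite c1.
have [b _ bx] : (\bigcup_n F2 n) y by rewrite c2.
exists (maxn a b) => //; split => /=.
  by apply: m1 ax; exact: leq_maxl.
by apply: m2 bx; exact: leq_maxr.
Qed.

Lemma measurable_box4E (R : realType) :
  @measurable _ (space4 R) = <<s @boxes4 R >>.
Proof.
pose I := [set A : set (measurableTypeR R) | exists a b : R, A = `]a, b[%classic].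
have mI : @measurable _ (measurableTypeR R) = <<s I >> by exact: RGenOpens.measurableE.
pose g n : set (measurableTypeR R) := `](- n%:R)%R, (n%:R)%R[%classic.
have Ig n : I (g n) by exists (- n%:R), n%:R.
have cg : \bigcup_n g n = setT by exact: itv_oo_cover.
have mg m n : (m <= n)%N -> g m `<=` g n by exact: itv_oo_mono.
pose g2 n := g n `*` g n; pose g3 n := g2 n `*` g n.
have cg2 : \bigcup_n g2 n = setT by exact: bigcup_setX_T.
have mg2 m n : (m <= n)%N -> g2 m `<=` g2 n.
  by move=> mn [x y] [/= ? ?]; split; apply: (mg m n).
have cg3 : \bigcup_n g3 n = setT by exact: bigcup_setX_T.
have H2 := measurable_prod_gen mI mI Ig Ig cg cg.
have H3 := measurable_prod_gen H2 mI (g1 := g2) (fun n => ex_intro2 _ _ _ (Ig n) (ex_intro2 _ _ _ (Ig n) erefl)) Ig cg2 cg.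
have H4 := measurable_prod_gen H3 mI (g1 := g3) (fun n => ex_intro2 _ _ _ ((ex_intro2 _ _ _ (Ig n) (ex_intro2 _ _ _ (Ig n) erefl))) (ex_intro2 _ _ _ (Ig n) erefl)) Ig cg3 cg.
rewrite [LHS]H4; congr (<<s _ >>); apply/seteqP; split.
  move=> _ [_ [_ [_ [a1 [b1 ->]] [_ [a2 [b2 ->]] <-]] [_ [a3 [b3 ->]] <-]] [_ [a4 [b4 ->]] <-]].
  by exists (a1, a2, a3, a4), (b1, b2, b3, b4).
move=> _ [a [b ->]]; rewrite /box4; eexists; last first.
  by eexists; last reflexivity; exists a.2, b.2.
eexists; last by eexists; last reflexivity; exists a.1.2, b.1.2.
eexists; first by exists a.1.1.1, b.1.1.1.
by eexists; last reflexivity; exists a.1.1.2, b.1.1.2.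
Qed.

Lemma box4_mono (R : realType) m n : (m <= n)%N ->
  box4 (@cst4 R (- m%:R)) (cst4 m%:R) `<=` box4 (cst4 (- n%:R)) (cst4 n%:R).
Proof.
move=> mn [[[x y] z] t] [[[/= ? ?] ?] ?]; do ! split => /=; exact: (@itv_oo_mono R m n).
Qed.

Lemma box5_cover (R : realType) :
  \bigcup_n box5 (cst5 (- n%:R)) (cst5 n%:R) = [set: spacetime R].
Proof.
apply: bigcup_setX_T; [exact: box4_cover|exact: itv_oo_cover| |].
- exact: box4_mono.
- exact: itv_oo_mono.
Qed.

Lemma measurable_box5E (R : realType) :
  @measurable _ (spacetime R) = <<s @boxes5 R >>.
Proof.
pose g n : set (measurableTypeR R) := `](- n%:R)%R, (n%:R)%R[%classic.
pose I := [set A : set (measurableTypeR R) | exists a b : R, A = `]a, b[%classic].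
have mI : @measurable _ (measurableTypeR R) = <<s I >>
  by exact: RGenOpens.measurableE.
have Ig n : I (g n) by exists (- n%:R), n%:R.
have cg : \bigcup_n g n = setT by exact: itv_oo_cover.
have B4 n : boxes4 (box4 (@cst4 R (- n%:R)) (cst4 n%:R)) by eexists; eexists.
rewrite [LHS](measurable_prod_gen (@measurable_box4E R) mI B4 Ig (@box4_cover R) cg).
congr (<<s _ >>); apply/seteqP; split.
  by move=> _ [_ [a [b ->]] [_ [c [d ->]] <-]]; exists (a, c), (b, d).
move=> _ [a [b ->]]; eexists; last first.
  by eexists; last reflexivity; exists a.2, b.2.
by exists a.1, b.1.
Qed.

Definition ratr5 (R : realType) (p : rat * rat * rat * rat * rat) : spacetime R :=
  (ratr p.1.1.1.1, ratr p.1.1.1.2, ratr p.1.1.2, ratr p.1.2, ratr p.2).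

(** Balls of the product are sup-norm balls, so it is enough to choose rational endpoints within e
    on both sides of each coordinate. *)
Lemma ball5_box (R : realType) (z : spacetime R) (e : R) : 0 < e ->
  exists2 ab : (rat * rat * rat * rat * rat) * (rat * rat * rat * rat * rat),
  box5 (ratr5 R ab.1) (ratr5 R ab.2) z &
  box5 (ratr5 R ab.1) (ratr5 R ab.2) `<=` ball z e.
Proof.
move=> e0.
have H (t : R) : exists ab : rat * rat, (t - e < ratr ab.1 < t) && (t < ratr ab.2 < t + e).
  have [a] := @rat_in_itvoo R (t - e) t (ltac:(by rewrite ltrBlDr ltrDl)).
  rewrite in_itv/= => ha.
  have [b] := @rat_in_itvoo R t (t + e) (ltac:(by rewrite ltrDl)).
  by rewrite in_itv/= => hb; exists (a, b); rewrite ha hb.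
case: z => [[[[x1 x2] x3] x4] x5].
have [[a1 b1] /andP[/andP[? ?] /andP[? ?]]] := H x1.
have [[a2 b2] /andP[/andP[? ?] /andP[? ?]]] := H x2.
have [[a3 b3] /andP[/andP[? ?] /andP[? ?]]] := H x3.
have [[a4 b4] /andP[/andP[? ?] /andP[? ?]]] := H x4.
have [[a5 b5] /andP[/andP[? ?] /andP[? ?]]] := H x5.
exists ((a1, a2, a3, a4, a5), (b1, b2, b3, b4, b5)) => /=.
  by do ! split => //=; rewrite in_itv/=; apply/andP; split.
move=> [[[[y1 y2] y3] y4] y5]/= [[[[]]]]/=; rewrite !in_itv/=.
have D t y (a b : rat) : t - e < ratr a -> ratr b < t + e -> ratr a < y < ratr b ->
   `|t - y| < e :> R.
  by move=> ta bt /andP[ay yb]; rewrite ltr_norml; lra.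
move=> h1 h2 h3 h4 h5; do ! split => /=; rewrite /ball/=.
- by apply: D h1.
- by apply: D h2.
- by apply: D h3.
- by apply: D h4.
- by apply: D h5.
Qed.

(** The boxes with rational corners inside O are countably many and cover it. This ties the product
    topology to the product sigma-algebra: open sets become measurable, and cutoffs can be built box
    by box. *)
Lemma open5_bigcup (R : realType) (O : set (spacetime R)) : open O ->
  exists2 B : (set (spacetime R))^nat, (forall n, exists a b, B n = box5 a b) &
    O = \bigcup_n B n.
Proof.
move=> oO.
pose q := ratr5 R.
pose P := ((rat * rat * rat * rat * rat) * (rat * rat * rat * rat * rat))%type.
have [u hu] : exists u : nat -> option P, forall p, exists n, u n = Some p.
  by exists unpickle => p; exists (pickle p); exact: pickleK.
(* Indices that do not encode a rational box inside O get [box5 0 0], which is empty. *)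
pose B n := if u n is Some p then
   if `[< box5 (q (p : P).1) (q p.2) `<=` O >] then box5 (q p.1) (q p.2) else box5 0 0
   else box5 0 0.
have b0 : box5 (0 : spacetime R) 0 = set0.
  by apply/seteqP; split => // z [_]/=; rewrite in_itv/= => /andP[/lt_trans] /[apply]; rewrite ltxx.
exists B.
  by move=> n; rewrite /B; case: (u n) => [p|]; [case: ifP => _|]; eexists; eexists.
apply/seteqP; split => [z Oz|z [n _]]; last first.
  rewrite /B; case: (u n) => [p|]; rewrite ?b0//.
  by case: asboolP => [+ bz|_ []]; exact.
have /nbhs_ballP[e /= e0 eO] : nbhs z O by exact: open_nbhs_nbhs.
have [p /= pz pe] := ball5_box z e0.
have [n un] := hu p; exists n; first by [].
by rewrite /B un ifT//; apply/asboolP => y /pe; exact: eO.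
Qed.

Lemma open5_measurable (R : realType) (O : set (spacetime R)) :
  open O -> measurable O.
Proof.
move=> /open5_bigcup[B hB ->]; apply: bigcupT_measurable => n.
by have [a [b ->]] := hB n; exact: measurable_box5.
Qed.

(** O is a time section of the open cylinder over it, so the covering by boxes need not be redone in
    dimension four. *)
Lemma open4_measurable (R : realType) (O : set (space4 R)) :
  open O -> measurable O.
Proof.
move=> oO.
have oO' : open (fst @^-1` O : set (spacetime R)).
  by move: O oO; apply/continuousP => x; exact: cvg_fst.
have := measurable_ysection (0 : measurableTypeR R) (open5_measurable oO').
rewrite (_ : ysection _ _ = O)//.
by apply/seteqP; split => x; rewrite /ysection/= inE.
Qed.

Lemma continuous5_measurable (R : realType) (f : spacetime R -> R) :
  continuous f -> measurable_fun setT f.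
Proof.
move=> /continuousP cf; apply: (measurability _ (RGenOpens.measurableE R)).
move=> _ [_ [a [b ->] <-]]; rewrite setTI; apply: open5_measurable.
by apply: cf; exact: interval_open.
Qed.

Lemma continuous4_measurable (R : realType) (f : space4 R -> R) :
  continuous f -> measurable_fun setT f.
Proof.
move=> /continuousP cf; apply: (measurability _ (RGenOpens.measurableE R)).
move=> _ [_ [a [b ->] <-]]; rewrite setTI; apply: open4_measurable.
by apply: cf; exact: interval_open.
Qed.

Lemma cvge_lt (R : realType) (u : (\bar R)^nat) (l a : \bar R) :
  u @ \oo --> l -> (l < a)%E -> \forall n \near \oo, (u n < a)%E.
Proof.
move=> ul la; apply: (ul [set x | (x < a)%E]); apply: open_nbhs_nbhs; split => //.
exact: open_ereal_lt_ereal.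
Qed.

Lemma continuous_fst_comp (T U V : topologicalType) (f : T -> U * V) :
  continuous f -> continuous (fun x => (f x).1).
Proof. by move=> cf x; apply: cvg_comp (cf x) _; exact: cvg_fst. Qed.

Lemma continuous_snd_comp (T U V : topologicalType) (f : T -> U * V) :
  continuous f -> continuous (fun x => (f x).2).
Proof. by move=> cf x; apply: cvg_comp (cf x) _; exact: cvg_snd. Qed.

Lemma continuous_coord4 (R : realType) :
  [/\ continuous (fun x : space4 R => x.1.1.1), continuous (fun x : space4 R => x.1.1.2),
      continuous (fun x : space4 R => x.1.2) & continuous (fun x : space4 R => x.2)].
Proof.
have c0 : continuous (fun x : space4 R => x) by move=> x; exact: cvg_id.
have c1 := continuous_fst_comp c0; have c2 := continuous_fst_comp c1.
split.
- exact: continuous_fst_comp c2.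
- exact: continuous_snd_comp c2.
- exact: continuous_snd_comp c1.
- exact: continuous_snd_comp c0.
Qed.

Lemma continuous_coord5 (R : realType) :
  [/\ continuous (fun z : spacetime R => z.1.1.1.1),
      continuous (fun z : spacetime R => z.1.1.1.2),
      continuous (fun z : spacetime R => z.1.1.2), continuous (fun z : spacetime R => z.1.2) &
      continuous (fun z : spacetime R => z.2)].
Proof.
have c0 : continuous (fun x : spacetime R => x) by move=> x; exact: cvg_id.
have c1 := continuous_fst_comp c0; have c2 := continuous_fst_comp c1.
have c3 := continuous_fst_comp c2.
split.
- exact: continuous_fst_comp c3.
- exact: continuous_snd_comp c3.
- exact: continuous_snd_comp c2.
- exact: continuous_snd_comp c1.
- exact: continuous_snd_comp c0.
Qed.

Section regularity.
Context (R : realType) (m : {finite_measure set (spacetime R) -> \bar R}).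

(** The closed inner set is recorded by its complement [F], so that the gap between inner and outer
    set is the intersection of [U] and [F]. In this form complementation merely swaps the two. *)
Let regular (A : set (spacetime R)) := measurable A /\
  forall e : R, 0 < e -> exists F U, [/\ open F, open U, ~` F `<=` A, A `<=` U &
    (m (U `&` F) < e%:E)%E].

Let regularC A : regular A -> regular (~` A).
Proof.
move=> [mA rA]; split; first exact: measurableC.
move=> e /rA[F [U [oF oU FA AU mUF]]]; exists U, F; split => //.
- exact: subsetC.
- by rewrite -[X in _ `<=` X]setCK; exact: subsetC.
- by rewrite setIC.
Qed.

Let regularU (A : (set (spacetime R))^nat) :
  (forall n, regular (A n)) -> regular (\bigcup_n A n).
Proof.
move=> rA; split; first by apply: bigcupT_measurable => n; case: (rA n).
move=> e e0.
have H n : exists FU : set (spacetime R) * set (spacetime R),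
    [/\ open FU.1, open FU.2, ~` FU.1 `<=` A n, A n `<=` FU.2 &
    (m (FU.2 `&` FU.1) <= (e / 2 / (2 ^ n.+1)%:R)%:E)%E].
  have [|F [U [? ? ? ? mUF]]] := (rA n).2 (e / 2 / (2 ^ n.+1)%:R).
    by rewrite !divr_gt0// ltr0n expn_gt0.
  by exists (F, U); split => //; exact: ltW.
have {}[FU] := choice H.
move=> /all_and5[oF oU FA AU mUF].
(* An infinite union of closed sets need not be closed, so only the first n inner sets are kept. The
   gaps [G n] decrease to a set covered by the individual gaps, of total mass at most e / 2;
   finiteness of [m] then gives one n with gap below e. *)
pose U := \bigcup_n (FU n).2; pose G n := U `&` \bigcap_(i < n) (FU i).1.
have oU' : open U by exact: bigcup_open.
have oG n : open (\bigcap_(i < n) (FU i).1).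
  by rewrite bigcap_mkord; elim/big_ind : _ => [|? ?|i _]; [exact: openT|exact: openI|exact: oF].
have mG n : measurable (G n).
  by apply: measurableI; exact: open5_measurable.
have Gcap : (m (\bigcap_n G n) < e%:E)%E.
  apply: (@le_lt_trans _ _ (\sum_(n <oo) m ((FU n).2 `&` (FU n).1))%E).
    apply: measure_sigma_subadditive => //.
    - by move=> n; apply: measurableI; exact: open5_measurable.
    - exact: bigcapT_measurable.
    move=> z Gz; have [[n _ Uz] _] := Gz 0%N I.
    exists n => //; split => //.
    by have [_] := Gz n.+1 I; apply => /=.
  apply: (@le_lt_trans _ _ (\sum_(n <oo) (e / 2 / (2 ^ n.+1)%:R)%:E)%E).
    by apply: lee_nneseries => // n _; exact: mUF.
  apply: (@le_lt_trans _ _ (e / 2)%:E).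
    have := @epsilon_trick R (fun=> 0%E) (e / 2) xpredT (fun=> lexx _) (ltac:(lra)).
    rewrite (eq_eseriesr (g := fun n => (e / 2 / (2 ^ n.+1)%:R)%:E)); last first.
      by move=> n _; rewrite add0e.
    by rewrite (eseries0 (fun _ _ _ => erefl)) add0e.
  by rewrite lte_fin; lra.
have : m (G n) @[n --> \oo] --> m (\bigcap_n G n).
  apply: nonincreasing_cvg_mu => //.
  - by rewrite -ge0_fin_numE//; exact: fin_num_measure.
  - exact: bigcapT_measurable.
  - apply/nonincreasing_seqP => n; apply/subsetPset => z [Uz H'].
    by split => // i /= ni; apply: H' => /=; exact: ltnW.
move=> /cvge_lt/(_ Gcap)[N _ /(_ N (leqnn N))] /= GN.
exists (\bigcap_(i < N) (FU i).1), U; split => //.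
- move=> z nF; have [i /= iN Fi] : exists2 i, (i < N)%N & ~ (FU i).1 z.
    apply: contrapT => h; apply: nF => i /= iN; apply: contrapT => Fi; apply: h.
    by exists i.
  by exists i => //; exact: FA.
- by move=> z [n _ /AU Uz]; exists n.
Qed.

Let regularI A B : regular A -> regular B -> regular (A `&` B).
Proof.
move=> rA rB; rewrite -[_ `&` _]setCK setCI -bigcup2E; apply: regularC.
apply: regularU => -[|[|n]] /=; [exact: regularC..|].
split=> // e e0; exists setT, set0; split => //; [exact: openT| |].
  by rewrite setCT.
by rewrite set0I measure0 lte_fin.
Qed.

(** The set is already open; from inside it is exhausted by the closed sets where f is at least 1 /
    (n + 1), and the layers left over decrease to the empty set. *)
Let regular_gt0 (f : spacetime R -> R) : continuous f -> regular [set z | 0 < f z].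
Proof.
move=> cf.
have opr (A : set R) : open A -> open (f @^-1` A) by move: A; apply/continuousP.
have oU : open [set z | 0 < f z] by apply: (opr [set x | 0 < x]); exact: open_gt.
have oF (n : nat) : open [set z | f z < n.+1%:R^-1] by apply: (opr [set x | x < n.+1%:R^-1]); exact: open_lt.
split; first exact: open5_measurable.
move=> e e0.
pose G n := [set z | 0 < f z] `&` [set z | f z < n.+1%:R^-1].
have mG n : measurable (G n) by apply: measurableI; exact: open5_measurable.
have G0 : \bigcap_n G n = set0.
  apply/seteqP; split => // z Gz; have [/= fz _] := Gz 0%N I.
  have [_ /=] := Gz (Num.truncn (f z)^-1) I.
  rewrite ltNge => /negP; apply; rewrite -[leRHS]invrK lef_pV2 ?posrE ?invr_gt0//.
  by rewrite ltW// truncnS_gt.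
have : m (G n) @[n --> \oo] --> m (\bigcap_n G n).
  apply: nonincreasing_cvg_mu => //.
  - by rewrite -ge0_fin_numE//; exact: fin_num_measure.
  - exact: bigcapT_measurable.
  - apply/nonincreasing_seqP => n; apply/subsetPset => z [/= fz fn]; split => //=.
    by apply: lt_le_trans fn _; rewrite lef_pV2 ?posrE// ler_nat.
rewrite G0 measure0 => /cvge_lt/(_ (e0 : (0 < e%:E)%E))[N _ /(_ N (leqnn N))] /= GN.
exists [set z | f z < N.+1%:R^-1], [set z | 0 < f z]; split => //.
- move=> z /= /negP; rewrite -leNgt; apply: lt_le_trans.
  by rewrite invr_gt0.
Qed.

Let regular_box a b : regular (box5 a b).
Proof.
have [cx0 cx1 cx2 cx3 cx4] := continuous_coord5 R.
have half (f : spacetime R -> R) c d : continuous f -> regular [set z | c < f z < d].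
  move=> cf; rewrite (_ : [set _ | _] = [set z | 0 < f z - c] `&` [set z | 0 < d - f z]).
    apply: regularI; apply: regular_gt0 => z.
      by apply: cvgB; [exact: cf|exact: cvg_cst].
    by apply: cvgB; [exact: cvg_cst|exact: cf].
  by apply/seteqP; split => z /=; rewrite !subr_gt0 => /andP.
rewrite (_ : box5 a b = [set z | a.1.1.1.1 < z.1.1.1.1 < b.1.1.1.1] `&`
  [set z | a.1.1.1.2 < z.1.1.1.2 < b.1.1.1.2] `&` [set z | a.1.1.2 < z.1.1.2 < b.1.1.2]
  `&` [set z | a.1.2 < z.1.2 < b.1.2] `&` [set z | a.2 < z.2 < b.2]).
  by do 4 (apply: regularI; last exact: half); exact: half.
by apply/seteqP; split => z [[[[/= h1 h2] h3] h4] h5].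
Qed.

Lemma outer_regular (A : set (spacetime R)) (e : R) : measurable A -> 0 < e ->
  exists2 U, open U & A `<=` U /\ (m U <= m A + e%:E)%E.
Proof.
move=> mA e0; suff [_ /(_ _ e0)[F [U [oF oU FA AU mUF]]]] : regular A.
  exists U => //; split => //.
  rewrite -(setDUK AU).
  apply: le_trans (measureU2 _ _ _) _ => //.
    by apply: measurableD => //; exact: open5_measurable.
  rewrite leeD2l//; apply: le_trans (ltW mUF); apply: le_measure.
  - by rewrite inE; apply: measurableD => //; exact: open5_measurable.
  - by rewrite inE; apply: measurableI; exact: open5_measurable.
  - by apply: setIS; rewrite -[F]setCK; exact: subsetC.
move: mA; rewrite measurable_box5E; move: A.
suff : <<s @boxes5 R >> `<=` regular by [].
apply: smallest_sub; last by move=> _ [a [b ->]]; exact: regular_box.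
split.
- by rewrite -setCT; apply: regularC; rewrite -(setvU (box5 0 0)); rewrite -bigcup2E;
  apply: regularU => -[|[|n]] /=; [apply: regularC; exact: regular_box|exact: regular_box|];
  rewrite -(setICl (box5 0 0)); apply: regularI; [apply: regularC|]; exact: regular_box.
- by move=> A rA; rewrite setTD; exact: regularC.
- by move=> F; exact: regularU.
Qed.

End regularity.

(** A is approximated from outside with respect to [m2] at the cost of e, and the approximating open
    set is cut down to V, where the comparison on open sets applies. *)
Lemma le_measure_on_opens (R : realType)
    (m1 m2 : {finite_measure set (spacetime R) -> \bar R}) (V : set (spacetime R)) :
  open V -> (forall U, open U -> U `<=` V -> (m1 U <= m2 U)%E) ->
  forall A, measurable A -> A `<=` V -> (m1 A <= m2 A)%E.
Proof.
move=> oV m12 A mA AV; apply/lee_addgt0Pr => e e0.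
have [U oU [AU mU]] := outer_regular m2 mA e0.
apply: le_trans mU; have oUV : open (U `&` V) by exact: openI.
apply: (@le_trans _ _ (m1 (U `&` V))).
  by apply: le_measure; rewrite ?inE//; [exact: open5_measurable|rewrite subsetI].
apply: le_trans (m12 _ oUV (@subIsetr _ _ _)) _.
by apply: le_measure; rewrite ?inE//; exact: open5_measurable.
Qed.

(** * Lebesgue measure on R^4 and R^4 x R *)

(** The pushforward of Lebesgue measure under the translation has the right mass on half-open
    intervals, so uniqueness identifies it. *)
Lemma lebesgue_shift (R : realType) (c : R) (f : measurableTypeR R -> \bar R) :
  measurable_fun setT f -> (forall x, 0 <= f x)%E ->
  (\int[lebesgue_measure]_x f (x + c)%R = \int[lebesgue_measure]_x f x)%E.
Proof.
move=> mf f0.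
pose s : measurableTypeR R -> measurableTypeR R := fun x => x + c.
have ms : measurable_fun setT s by exact: measurable_funD.
rewrite -[LHS](_ : (\int[pushforward lebesgue_measure s]_x f x = _)%E); last first.
  by rewrite ge0_integral_pushforward.
apply: eq_measure_integral => A mA _.
apply/esym/lebesgue_measure_unique => // _ [[a b]] _ <-.
transitivity (lebesgue_measure (s @^-1` `]a, b])); last by [].
rewrite (_ : s @^-1` _ = `]a - c, b - c]%classic).
  rewrite !lebesgue_measure_itv/= !lte_fin ltrD2r.
  by rewrite -!EFinD; congr (if _ then _%:E else _); ring.
by apply/seteqP; split => x /=; rewrite !in_itv/= /s ltrBlDr lerBrDr.
Qed.

Lemma product_measure1_lty d1 d2 (T1 : measurableType d1) (T2 : measurableType d2)
  (R : realType) (m1 : {measure set T1 -> \bar R})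
  (m2 : {sigma_finite_measure set T2 -> \bar R}) A B : measurable A -> measurable B ->
  (m1 A < +oo -> m2 B < +oo -> (m1 \x m2) (A `*` B) < +oo)%E.
Proof.
move=> mA mB hA hB; rewrite product_measure1E//.
by apply: lte_mul_pinfty => //; rewrite ge0_fin_numE.
Qed.

Lemma lebesgue_itv_oo_lty (R : realType) (a b : R) :
  (lebesgue_measure `]a, b[ < +oo)%E.
Proof. by rewrite lebesgue_measure_itv/=; case: ifP; rewrite ?ltry. Qed.

Lemma leb4_box4_lty (R : realType) (a b : space4 R) : (leb4 (box4 a b) < +oo)%E.
Proof.
apply: product_measure1_lty (lebesgue_itv_oo_lty _ _) => //; first by do 2 apply: measurableX => //.
apply: product_measure1_lty (lebesgue_itv_oo_lty _ _) => //; first by apply: measurableX => //.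
apply: product_measure1_lty (lebesgue_itv_oo_lty _ _) => //.
exact: lebesgue_itv_oo_lty.
Qed.

(* The library endows products with a finite measure structure only, so the
   sigma-finite one is attached to an alias. *)
Definition sfprod d1 d2 (T1 : measurableType d1) (T2 : measurableType d2)
  (R : realType) (m1 : {sigma_finite_measure set T1 -> \bar R})
  (m2 : {sigma_finite_measure set T2 -> \bar R}) : set (T1 * T2) -> \bar R :=
  (m1 \x m2)%E.

Section sfprod.
Context d1 d2 (T1 : measurableType d1) (T2 : measurableType d2) (R : realType).
Variables (m1 : {sigma_finite_measure set T1 -> \bar R})
  (m2 : {sigma_finite_measure set T2 -> \bar R}).

HB.instance Definition _ := Measure.copy (sfprod m1 m2) (m1 \x m2)%E.

Lemma sfprod_sigma_finite : sigma_finite setT (sfprod m1 m2).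
Proof.
have /sigma_finiteP[F [TF ndF Foo]] := sigma_finiteT m1.
have /sigma_finiteP[G [TG ndG Goo]] := sigma_finiteT m2.
exists (fun n => F n `*` G n).
  by apply/esym/bigcup_setX_T => // m n mn; apply/subsetPset; [exact: ndF|exact: ndG].
move=> n; have [? ?] := Foo n; have [? ?] := Goo n.
by split; [exact: measurableX|exact: product_measure1_lty].
Qed.

HB.instance Definition _ :=
  @Measure_isSigmaFinite.Build _ _ _ (sfprod m1 m2) sfprod_sigma_finite.

End sfprod.

Definition leb4_sfinite (R : realType) :
    {sigma_finite_measure set (space4 R) -> \bar R} :=
  sfprod (sfprod (sfprod lebesgue_measure lebesgue_measure) lebesgue_measure)
    lebesgue_measure.

Lemma sfprodE d1 d2 (T1 : measurableType d1) (T2 : measurableType d2)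
  (R : realType) (m1 : {sigma_finite_measure set T1 -> \bar R})
  (m2 : {sigma_finite_measure set T2 -> \bar R}) :
  sfprod m1 m2 = (m1 \x m2)%E :> {measure set _ -> \bar R}.
Proof. by []. Qed.

Lemma eq_product_measure1 d1 d2 (T1 : measurableType d1) (T2 : measurableType d2)
  (R : realType) (m1 m1' : {measure set T1 -> \bar R})
  (m2 : {sigma_finite_measure set T2 -> \bar R}) :
  m1 = m1' -> (m1 \x m2)%E = (m1' \x m2)%E :> {measure set _ -> \bar R}.
Proof. by move=> ->. Qed.

(** Carries Tonelli, Fubini and translation invariance, available for [sfprod], over to [leb4]; the
    factors are replaced from the inside out. *)
Lemma leb4E (R : realType) :
  @leb4 R = @leb4_sfinite R :> {measure set _ -> \bar R}.
Proof.
have e2 := sfprodE (@lebesgue_measure R) (@lebesgue_measure R).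
have e3 := etrans (sfprodE (sfprod lebesgue_measure lebesgue_measure) (@lebesgue_measure R))
  (eq_product_measure1 lebesgue_measure e2).
have e4 := etrans (sfprodE (sfprod (sfprod lebesgue_measure lebesgue_measure) lebesgue_measure) (@lebesgue_measure R))
  (eq_product_measure1 lebesgue_measure e3).
exact: esym e4.
Qed.

Lemma leb5E (R : realType) :
  @leb5 R = sfprod (@leb4_sfinite R) lebesgue_measure :> {measure set _ -> \bar R}.
Proof.
exact: (esym (etrans (sfprodE (leb4_sfinite R) (@lebesgue_measure R))
  (eq_product_measure1 lebesgue_measure (esym (leb4E R))))).
Qed.

(** Invariance is assumed of each factor under an arbitrary measurable map, so that the product of
    two maps is again of the assumed kind and the lemma can be iterated up to four factors. *)
Lemma ge0_integral_prod_shift d1 d2 (T1 : measurableType d1) (T2 : measurableType d2)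
  (R : realType) (m1 : {sigma_finite_measure set T1 -> \bar R})
  (m2 : {sigma_finite_measure set T2 -> \bar R}) (s1 : T1 -> T1) (s2 : T2 -> T2) :
  measurable_fun setT s1 -> measurable_fun setT s2 ->
  (forall f, measurable_fun setT f -> (forall x, 0 <= f x)%E ->
    (\int[m1]_x f (s1 x) = \int[m1]_x f x)%E) ->
  (forall f, measurable_fun setT f -> (forall x, 0 <= f x)%E ->
    (\int[m2]_x f (s2 x) = \int[m2]_x f x)%E) ->
  forall f, measurable_fun setT f -> (forall x, 0 <= f x)%E ->
    (\int[sfprod m1 m2]_x f (s1 x.1, s2 x.2) = \int[sfprod m1 m2]_x f x)%E.
Proof.
move=> ms1 ms2 h1 h2 f mf f0.
rewrite [LHS](@fubini_tonelli1 _ _ _ _ _ m1 m2 (fun x => f (s1 x.1, s2 x.2)))//; last first.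
  apply: measurableT_comp => //; apply: measurable_fun_pair.
    exact: measurableT_comp ms1 measurable_fst.
  exact: measurableT_comp ms2 measurable_snd.
rewrite [RHS](@fubini_tonelli1 _ _ _ _ _ m1 m2 f)// /fubini_F/=.
rewrite -(h1 (fun x => \int[m2]_y f (x, y))%E).
- apply: eq_integral => x _; rewrite (h2 (fun y => f (s1 x, y)))//.
  exact: (measurableT_comp mf (pair1_measurable _)).
- exact: measurable_fun_fubini_tonelli_F.
- by move=> x; exact: integral_ge0.
Qed.

Lemma ge0_integral_leb4_shift (R : realType) (a : space4 R) (f : space4 R -> \bar R) :
  measurable_fun setT f -> (forall x, 0 <= f x)%E ->
  (\int[leb4]_x f (x + a)%R = \int[leb4]_x f x)%E.
Proof.
have ms (c : R) : measurable_fun setT ((fun x => x + c) : measurableTypeR R -> measurableTypeR R).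
  exact: measurable_funD.
have h1 (c : R) := @lebesgue_shift R c.
have h2 := ge0_integral_prod_shift (ms a.1.1.1) (ms a.1.1.2) (h1 _) (h1 _).
have mp d1 d2 (T1 : measurableType d1) (T2 : measurableType d2) (s1 : T1 -> T1) (s2 : T2 -> T2) :
    measurable_fun setT s1 -> measurable_fun setT s2 ->
    measurable_fun setT (fun x : T1 * T2 => (s1 x.1, s2 x.2)).
  move=> ms1 ms2; apply: measurable_fun_pair.
    exact: measurableT_comp ms1 measurable_fst.
  exact: measurableT_comp ms2 measurable_snd.
have m2 := mp _ _ _ _ _ _ (ms a.1.1.1) (ms a.1.1.2).
have h3 := ge0_integral_prod_shift m2 (ms a.1.2) h2 (h1 _).
have m3 := mp _ _ _ _ _ _ m2 (ms a.1.2).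
have h4 := ge0_integral_prod_shift m3 (ms a.2) h3 (h1 _).
move=> mf f0; rewrite leb4E; exact: h4.
Qed.

Lemma tonelli_sfprod d1 d2 (T1 : measurableType d1) (T2 : measurableType d2)
  (R : realType) (m1 : {sigma_finite_measure set T1 -> \bar R})
  (m2 : {sigma_finite_measure set T2 -> \bar R}) (f : T1 * T2 -> \bar R) :
  measurable_fun setT f -> (forall z, 0 <= f z)%E ->
  (\int[sfprod m1 m2]_z f z = \int[m2]_y \int[m1]_x f (x, y))%E.
Proof. by move=> mf f0; exact: (fubini_tonelli2 f). Qed.

Lemma fubini_sfprod d1 d2 (T1 : measurableType d1) (T2 : measurableType d2)
  (R : realType) (m1 : {sigma_finite_measure set T1 -> \bar R})
  (m2 : {sigma_finite_measure set T2 -> \bar R}) (f : T1 * T2 -> \bar R) :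
  (sfprod m1 m2).-integrable setT f ->
  (\int[sfprod m1 m2]_z f z = \int[m2]_y \int[m1]_x f (x, y))%E.
Proof. by move=> mf; apply/esym; exact: integral21_prod_meas1. Qed.

Lemma tonelli5 (R : realType) (f : spacetime R -> \bar R) :
  measurable_fun setT f -> (forall z, 0 <= f z)%E ->
  (\int[leb5]_z f z = \int[lebesgue_measure]_t \int[leb4]_x f (x, t))%E.
Proof. by move=> mf f0; rewrite leb5E tonelli_sfprod. Qed.

Lemma measurable_tonelli5 (R : realType) (f : spacetime R -> \bar R) :
  measurable_fun setT f -> (forall z, 0 <= f z)%E ->
  measurable_fun setT (fun t => \int[leb4]_x f (x, t))%E.
Proof.
rewrite leb4E => mf f0; exact: (measurable_fun_fubini_tonelli_G f mf f0).
Qed.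

Lemma fubini5 (R : realType) (f : spacetime R -> \bar R) :
  leb5.-integrable setT f ->
  (\int[leb5]_z f z = \int[lebesgue_measure]_t \int[leb4]_x f (x, t))%E.
Proof. by rewrite leb5E => fi; rewrite fubini_sfprod. Qed.

(** * The Loomis-Whitney inequality *)

Lemma cube_root (R : realType) (x : R) : 0 <= x -> exists2 t : R, 0 <= t & t ^+ 3 = x.
Proof.
move=> x0; exists (x `^ 3^-1); first exact: powR_ge0.
by rewrite -powR_mulrn ?powR_ge0// -powRrM mulVf// powRr1.
Qed.

Lemma amgm3 (R : realFieldType) (x y z : R) : 0 <= x -> 0 <= y -> 0 <= z ->
  27 * (x * y * z) <= (x + y + z) ^+ 3.
Proof.
move=> x0 y0 z0.
have h1 : 0 <= x * (y - z) ^+ 2 by rewrite mulr_ge0// sqr_ge0.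
have h2 : 0 <= y * (x - z) ^+ 2 by rewrite mulr_ge0// sqr_ge0.
have h3 : 0 <= z * (x - y) ^+ 2 by rewrite mulr_ge0// sqr_ge0.
have h4 : 0 <= (x + y + z) * ((x - y) ^+ 2 + (y - z) ^+ 2 + (x - z) ^+ 2).
  by rewrite mulr_ge0// ?addr_ge0// sqr_ge0.
nra.
Qed.

Lemma lee_cube (R : realType) (x y : \bar R) :
  (0 <= x -> x <= y -> x ^+ 3 <= y ^+ 3)%E.
Proof.
move=> x0 xy; rewrite !(expeS, expe0) !mule1.
by rewrite lee_pmul// ?mule_ge0// lee_pmul.
Qed.

Section amgm_integral.
Context d (T : measurableType d) (R : realType) (mu : {measure set T -> \bar R}).
Local Open Scope ereal_scope.

(** Hoelder's inequality with three exponents 1/3. If A, B, G are the integrals of a, b, c and t^3 =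
    k A B G, the inequality of means gives f <= (t / 3) (a / A + b / B + c / G) pointwise, and the
    right side integrates to t. *)
Lemma amgm_integral (k : \bar R) (f a b c : T -> \bar R) :
  measurable_fun setT f -> measurable_fun setT a -> measurable_fun setT b ->
  measurable_fun setT c -> (forall x, 0 <= f x) -> (forall x, 0 <= a x) ->
  (forall x, 0 <= b x) -> (forall x, 0 <= c x) -> 0 <= k ->
  (forall x, f x ^+ 3 <= k * a x * b x * c x) ->
  (\int[mu]_x f x) ^+ 3
  <= k * (\int[mu]_x a x) * (\int[mu]_x b x) * (\int[mu]_x c x).
Proof.
move=> mf ma mb mc f0 a0 b0 c0 k0 fabc.
have f30 x : 0 <= f x -> x = x -> f x ^+ 3 = 0 -> f x = 0.
  by move=> fx0 _ /eqP; rewrite expe_eq0 => /andP[_ /eqP].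
have zero (h : T -> \bar R) : measurable_fun setT h -> (forall x, 0 <= h x) ->
    (forall x, h x = 0 -> f x = 0) -> \int[mu]_x h x = 0 -> \int[mu]_x f x = 0.
  move=> mh h0 hf ih.
  have /ae_eq_integral_abs h1 : \int[mu]_x `|h x| = 0.
    by under eq_integral do rewrite gee0_abs//.
  have {}h1 : {ae mu, forall x, setT x -> h x = 0} by exact: h1.
  rewrite (ae_eq_integral (cst 0))//; first by rewrite integral0.
  by apply: filterS h1 => x + _ => /(_ I) /hf.
(* Since 0 times +oo is 0, a vanishing factor makes the claim say that the integral of f is 0. This
   case and that of infinite factors are settled before dividing by the integrals. *)
have kf : k = 0 -> \int[mu]_x f x = 0.
  move=> k00; rewrite integral0_eq// => x _; apply: f30 => //.
  by apply/eqP; rewrite eq_le expe_ge0// andbT (le_trans (fabc x))// k00 !mul0e.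
have af : \int[mu]_x a x = 0 -> \int[mu]_x f x = 0.
  apply: zero => // x ax; apply: f30 => //.
  by apply/eqP; rewrite eq_le expe_ge0// andbT (le_trans (fabc x))// ax mule0 !mul0e.
have bf : \int[mu]_x b x = 0 -> \int[mu]_x f x = 0.
  apply: zero => // x ax; apply: f30 => //.
  by apply/eqP; rewrite eq_le expe_ge0// andbT (le_trans (fabc x))// ax mule0 !mul0e.
have cf : \int[mu]_x c x = 0 -> \int[mu]_x f x = 0.
  apply: zero => // x ax; apply: f30 => //.
  by apply/eqP; rewrite eq_le expe_ge0// andbT (le_trans (fabc x))// ax mule0.
have ia0 : 0 <= \int[mu]_x a x by exact: integral_ge0.
have ib0 : 0 <= \int[mu]_x b x by exact: integral_ge0.
have ic0 : 0 <= \int[mu]_x c x by exact: integral_ge0.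
have done0 : \int[mu]_x f x = 0 ->
   (\int[mu]_x f x) ^+ 3 <= k * (\int[mu]_x a x) * (\int[mu]_x b x) * (\int[mu]_x c x).
  by move=> ->; rewrite expeS mul0e !mule_ge0.
move: k0; rewrite le_eqVlt => /predU1P[/esym/kf/done0//|k0].
move: (ia0); rewrite le_eqVlt => /predU1P[/esym/af/done0//|ia0'].
move: (ib0); rewrite le_eqVlt => /predU1P[/esym/bf/done0//|ib0'].
move: (ic0); rewrite le_eqVlt => /predU1P[/esym/cf/done0//|ic0'].
set al := \int[mu]_x a x in ia0 ia0' *; set be := \int[mu]_x b x in ib0 ib0' *.
set ga := \int[mu]_x c x in ic0 ic0' *.
have [ky|ky] := eqVneq k +oo.
  by rewrite ky !(gt0_mulye,mulyy)// leey.
have [ay|ay] := eqVneq al +oo.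
  by rewrite ay !(gt0_muley,gt0_mulye,mulyy)// leey.
have [by'|by'] := eqVneq be +oo.
  by rewrite by' !(gt0_muley,gt0_mulye,mulyy)// ?leey// mule_gt0.
have [cy|cy] := eqVneq ga +oo.
  by rewrite cy !(gt0_muley,gt0_mulye,mulyy)// ?leey// !mule_gt0.
have kfin : k \is a fin_num by rewrite gt0_fin_numE// ltey.
have afin : al \is a fin_num by rewrite gt0_fin_numE// ltey.
have bfin : be \is a fin_num by rewrite gt0_fin_numE// ltey.
have cfin : ga \is a fin_num by rewrite gt0_fin_numE// ltey.
rewrite -(fineK kfin) -(fineK afin) -(fineK bfin) -(fineK cfin).
set k' := fine k; set A := fine al; set B := fine be; set G := fine ga.
have k'0 : (0 < k')%R by rewrite fine_gt0// k0 ltey.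
have A0 : (0 < A)%R by rewrite fine_gt0// ia0' ltey.
have B0 : (0 < B)%R by rewrite fine_gt0// ib0' ltey.
have G0 : (0 < G)%R by rewrite fine_gt0// ic0' ltey.
have [t t0 t3] := @cube_root R (k' * A * B * G) (ltac:(by rewrite !mulr_ge0// ltW)).
have t0' : (0 < t)%R.
  rewrite lt_neqAle t0 andbT eq_sym; apply: contra_eq_neq t3 => ->.
  by rewrite expr0n/= eq_sym !mulf_neq0// gt_eqF.
have pt x : f x <= (t / 3 / A)%:E * a x + (t / 3 / B)%:E * b x + (t / 3 / G)%:E * c x.
  have A' : (0 < t / 3 / A)%R by rewrite !divr_gt0.
  have B' : (0 < t / 3 / B)%R by rewrite !divr_gt0.
  have G' : (0 < t / 3 / G)%R by rewrite !divr_gt0.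
  have := fabc x; have := a0 x; have := b0 x; have := c0 x; have := f0 x.
  case: (a x) => [ax| |] //; last first.
    move=> _ cx bx _ _; rewrite gt0_muley ?lte_fin// addye ?addye ?leey//.
    - by rewrite gt_eqF// (lt_le_trans _ (mule_ge0 _ cx))// ?lee_fin ?ltW.
    - by rewrite gt_eqF// (lt_le_trans _ (mule_ge0 _ bx))// ?lee_fin ?ltW.
  case: (b x) => [bx| |] //; last first.
    move=> _ cx _ ax0 _; rewrite gt0_muley ?lte_fin// addey ?addye ?leey//.
    by rewrite gt_eqF// (lt_le_trans _ (mule_ge0 _ cx))// ?lee_fin ?ltW.
  case: (c x) => [cx| |] //; last first.
    by move=> _ _ _ ax0 _; rewrite [X in _ + X]gt0_muley ?lte_fin// addey ?leey.
  rewrite -(fineK kfin) -/k' -!EFinM -!EFinD.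
  case: (f x) => [fx| |] //.
  rewrite -EFin_expe !lee_fin => fx0 cx0 bx0 ax0 h.
  have s0 : (0 <= ax / A + bx / B + cx / G)%R.
    by rewrite !addr_ge0// divr_ge0// ltW.
  have -> : (t / 3 / A * ax + t / 3 / B * bx + t / 3 / G * cx =
     t * ((ax / A + bx / B + cx / G) / 3))%R by field; rewrite !gt_eqF.
  rewrite -(@ler_pXn2r _ 3)// ?nnegrE ?mulr_ge0 ?divr_ge0//.
  apply: (le_trans h); rewrite exprMn t3 expr_div_n.
  have := @amgm3 R (ax / A) (bx / B) (cx / G) (ltac:(by rewrite divr_ge0// ltW))
    (ltac:(by rewrite divr_ge0// ltW)) (ltac:(by rewrite divr_ge0// ltW)).
  have -> : (k' * ax * bx * cx = (k' * A * B * G) * ((ax / A) * (bx / B) * (cx / G)))%R.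
    by field; rewrite !gt_eqF.
  move=> am; rewrite ler_pM2l ?mulr_gt0// ler_pdivlMr ?exprn_gt0//.
  by rewrite mulrC (_ : 3 ^+ 3 = 27 :> R)%R//; ring.
have mZ r (h : T -> \bar R) : measurable_fun setT h -> measurable_fun setT (fun x => r%:E * h x).
  by move=> mh; exact: emeasurable_funM.
have pos r (h : T -> \bar R) : (0 < r)%R -> (forall x, 0 <= h x) -> forall x, 0 <= r%:E * h x.
  by move=> r0 h0 x; rewrite mule_ge0// lee_fin ltW.
have A' : (0 < t / 3 / A)%R by rewrite !divr_gt0.
have B' : (0 < t / 3 / B)%R by rewrite !divr_gt0.
have G' : (0 < t / 3 / G)%R by rewrite !divr_gt0.
have le_t : \int[mu]_x f x <= t%:E.
  apply: le_trans (ge0_le_integral _ _ _ _ _ (fun x _ => pt x)) _ => //.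
    by apply: emeasurable_funD; [apply: emeasurable_funD|]; exact: mZ.
  rewrite ge0_integralD//; last 4 first.
    - by move=> x _; rewrite adde_ge0// pos.
    - by apply: emeasurable_funD; exact: mZ.
    - by move=> x _; rewrite pos.
    - exact: mZ.
  rewrite ge0_integralD//; last 4 first.
    - by move=> x _; rewrite pos.
    - exact: mZ.
    - by move=> x _; rewrite pos.
    - exact: mZ.
  rewrite !ge0_integralZl_EFin ?(ltW A', ltW B', ltW G')// -/al -/be -/ga.
  rewrite -(fineK afin) -(fineK bfin) -(fineK cfin) -/A -/B -/G -!EFinM -!EFinD lee_fin.
  by rewrite !divfK ?gt_eqF//; lra.
rewrite -!EFinM -t3 EFin_expe.
by apply: lee_cube => //; exact: integral_ge0.
Qed.

End amgm_integral.

Lemma measurable_partial_integral d (T : measurableType d) (R : realType)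
    (h : T -> measurableTypeR R -> \bar R) :
  measurable_fun setT (fun p : T * measurableTypeR R => h p.1 p.2) ->
  (forall t s, 0 <= h t s)%E ->
  measurable_fun setT (fun t => \int[lebesgue_measure]_s h t s)%E.
Proof.
move=> mh h0.
exact: (measurable_fun_fubini_tonelli_F (fun p => h p.1 p.2) mh (fun p => h0 p.1 p.2)).
Qed.

Lemma measurable_fst_comp d d1 d2 (T : measurableType d) (T1 : measurableType d1)
    (T2 : measurableType d2) (f : T -> T1 * T2) :
  measurable_fun setT f -> measurable_fun setT (fun x => (f x).1).
Proof. by move=> mf; exact: measurableT_comp measurable_fst mf. Qed.

Lemma measurable_snd_comp d d1 d2 (T : measurableType d) (T1 : measurableType d1)
    (T2 : measurableType d2) (f : T -> T1 * T2) :
  measurable_fun setT f -> measurable_fun setT (fun x => (f x).2).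
Proof. by move=> mf; exact: measurableT_comp measurable_snd mf. Qed.

Ltac measurable_proj :=
  repeat first [exact: measurable_id | exact: measurable_fst | exact: measurable_snd | exact: measurable_cst
    | apply: measurable_fun_pair | apply: measurable_fst_comp
    | apply: measurable_snd_comp ].

Section loomis_whitney.
Variable R : realType.
Let X := measurableTypeR R.
Local Notation l := (@lebesgue_measure R).
Local Open Scope ereal_scope.

Definition curry4 (g : space4 R -> \bar R) (x1 x2 x3 x4 : X) : \bar R :=
  g (x1, x2, x3, x4).

Lemma leb4_iterated (g : space4 R -> \bar R) : measurable_fun setT g ->
  (forall x, 0 <= g x) ->
  \int[leb4]_x g x =
  \int[l]_x4 \int[l]_x3 \int[l]_x2 \int[l]_x1 curry4 g x1 x2 x3 x4.
Proof.
move=> mg g0; rewrite leb4E /leb4_sfinite tonelli_sfprod//.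
apply: eq_integral => x4 _; rewrite tonelli_sfprod//; last first.
  by apply: measurableT_comp => //; measurable_proj.
apply: eq_integral => x3 _; rewrite tonelli_sfprod//.
by apply: (measurableT_comp mg) => //; measurable_proj.
Qed.

Let swap (h : X -> X -> \bar R) : measurable_fun setT (fun p : X * X => h p.1 p.2) ->
  (forall x y, 0 <= h x y) ->
  \int[l]_x \int[l]_y h x y = \int[l]_y \int[l]_x h x y.
Proof. by move=> mh h0; exact: (fubini_tonelli (fun p => h p.1 p.2)). Qed.

Ltac iterated_ge0 i0 c0 := intros; lazymatch goal with
  | |- context [@integral] => apply: (i0); iterated_ge0 i0 c0
  | |- _ => exact: c0 end.

Ltac measurable_iterated cm i0 c0 := lazymatch goal with
  | |- context [@integral] => apply: measurable_partial_integral;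
      [measurable_iterated cm i0 c0 | iterated_ge0 i0 c0]
  | |- _ => apply: (cm) => //; measurable_proj end.

(** One variable is integrated at a time. The factor whose line runs along that variable does not
    depend on it and serves as the constant of [amgm_integral]; Hoelder's inequality acts on the
    other three. The hypothesis is phrased with line integrals because that is what the cubic
    inequality on lines supplies. *)
Lemma loomis_whitney4 (f g0 g1 g2 g3 : space4 R -> \bar R) :
  measurable_fun setT f -> measurable_fun setT g0 -> measurable_fun setT g1 ->
  measurable_fun setT g2 -> measurable_fun setT g3 ->
  (forall x, 0 <= f x) -> (forall x, 0 <= g0 x) -> (forall x, 0 <= g1 x) ->
  (forall x, 0 <= g2 x) -> (forall x, 0 <= g3 x) ->
  (forall x, f x ^+ 3 <= (\int[l]_s g0 (s, x.1.1.2, x.1.2, x.2))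
     * (\int[l]_s g1 (x.1.1.1, s, x.1.2, x.2))
     * (\int[l]_s g2 (x.1.1.1, x.1.1.2, s, x.2))
     * (\int[l]_s g3 (x.1.1.1, x.1.1.2, x.1.2, s))) ->
  (\int[leb4]_x f x) ^+ 3 <= (\int[leb4]_x g0 x) * (\int[leb4]_x g1 x)
     * (\int[leb4]_x g2 x) * (\int[leb4]_x g3 x).
Proof.
move=> mf mg0 mg1 mg2 mg3 f0 g00 g10 g20 g30 fg.
have c0 (g : space4 R -> \bar R) : (forall x, 0 <= g x) -> forall x1 x2 x3 x4, 0 <= curry4 g x1 x2 x3 x4.
  by move=> h *; exact: h.
have i0 (h : X -> \bar R) : (forall x, 0 <= h x) -> 0 <= \int[l]_x h x.
  by move=> h0; exact: integral_ge0.
have cm d (T : measurableType d) (g : space4 R -> \bar R) (a b c e : T -> X) : measurable_fun setT g ->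
    measurable_fun setT a -> measurable_fun setT b -> measurable_fun setT c ->
    measurable_fun setT e -> measurable_fun setT (fun t => curry4 g (a t) (b t) (c t) (e t)).
  move=> mg ma mb mc me; apply: (measurableT_comp mg).
  by do 3 (apply: measurable_fun_pair => //).
rewrite !leb4_iterated//.
have p5 (a b c e b' c' e' : \bar R) : b = b' -> c = c' -> e = e' ->
    a * b * c * e <= a * b' * c' * e' by move=> -> -> ->.
have p4 (a b c e : \bar R) : a * b * c * e = b * a * c * e by rewrite (muleC a).
have p3 (a b c e : \bar R) : a * b * c * e = c * a * b * e by rewrite (muleC _ c) muleA.
have p2 (a b c e : \bar R) : a * b * c * e = b * c * e * a.
  by rewrite -!muleA [LHS]muleC -!muleA.
have p1 (a b c e : \bar R) : a * b * c * e = e * c * b * a.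
  by rewrite muleC (muleC _ c) (muleC a b) !muleA.
(* The line integral of [g0] is the constant here and becomes one of the three varying factors in
   the later steps. *)
have step1 x2 x3 x4 : (\int[l]_x1 curry4 f x1 x2 x3 x4) ^+ 3 <=
    (\int[l]_x1 curry4 g0 x1 x2 x3 x4)
    * (\int[l]_x1 \int[l]_s curry4 g1 x1 s x3 x4)
    * (\int[l]_x1 \int[l]_s curry4 g2 x1 x2 s x4)
    * (\int[l]_x1 \int[l]_s curry4 g3 x1 x2 x3 s).
  apply: amgm_integral.
  - by measurable_iterated cm i0 c0.
  - by measurable_iterated cm i0 c0.
  - by measurable_iterated cm i0 c0.
  - by measurable_iterated cm i0 c0.
  - by iterated_ge0 i0 c0.
  - by iterated_ge0 i0 c0.
  - by iterated_ge0 i0 c0.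
  - by iterated_ge0 i0 c0.
  - by iterated_ge0 i0 c0.
  - by move=> x1; exact: (fg (x1, x2, x3, x4)).
have step2 x3 x4 : (\int[l]_x2 \int[l]_x1 curry4 f x1 x2 x3 x4) ^+ 3 <=
    (\int[l]_x1 \int[l]_s curry4 g1 x1 s x3 x4)
    * (\int[l]_x2 \int[l]_x1 curry4 g0 x1 x2 x3 x4)
    * (\int[l]_x2 \int[l]_x1 \int[l]_s curry4 g2 x1 x2 s x4)
    * (\int[l]_x2 \int[l]_x1 \int[l]_s curry4 g3 x1 x2 x3 s).
  apply: amgm_integral.
  - by measurable_iterated cm i0 c0.
  - by measurable_iterated cm i0 c0.
  - by measurable_iterated cm i0 c0.
  - by measurable_iterated cm i0 c0.
  - by iterated_ge0 i0 c0.
  - by iterated_ge0 i0 c0.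
  - by iterated_ge0 i0 c0.
  - by iterated_ge0 i0 c0.
  - by iterated_ge0 i0 c0.
  - by move=> x2; rewrite -[leRHS]p4; exact: step1 x2 x3 x4.
have step3 x4 : (\int[l]_x3 \int[l]_x2 \int[l]_x1 curry4 f x1 x2 x3 x4) ^+ 3 <=
    (\int[l]_x2 \int[l]_x1 \int[l]_s curry4 g2 x1 x2 s x4)
    * (\int[l]_x3 \int[l]_x1 \int[l]_s curry4 g1 x1 s x3 x4)
    * (\int[l]_x3 \int[l]_x2 \int[l]_x1 curry4 g0 x1 x2 x3 x4)
    * (\int[l]_x3 \int[l]_x2 \int[l]_x1 \int[l]_s curry4 g3 x1 x2 x3 s).
  apply: amgm_integral.
  - by measurable_iterated cm i0 c0.
  - by measurable_iterated cm i0 c0.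
  - by measurable_iterated cm i0 c0.
  - by measurable_iterated cm i0 c0.
  - by iterated_ge0 i0 c0.
  - by iterated_ge0 i0 c0.
  - by iterated_ge0 i0 c0.
  - by iterated_ge0 i0 c0.
  - by iterated_ge0 i0 c0.
  - by move=> x3; rewrite -[leRHS]p3; exact: step2 x3 x4.
apply: (@le_trans _ _ ((\int[l]_x3 \int[l]_x2 \int[l]_x1 \int[l]_s curry4 g3 x1 x2 x3 s)
    * (\int[l]_x4 \int[l]_x3 \int[l]_x2 \int[l]_x1 curry4 g0 x1 x2 x3 x4)
    * (\int[l]_x4 \int[l]_x3 \int[l]_x1 \int[l]_s curry4 g1 x1 s x3 x4)
    * (\int[l]_x4 \int[l]_x2 \int[l]_x1 \int[l]_s curry4 g2 x1 x2 s x4))).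
  apply: amgm_integral.
  - by measurable_iterated cm i0 c0.
  - by measurable_iterated cm i0 c0.
  - by measurable_iterated cm i0 c0.
  - by measurable_iterated cm i0 c0.
  - by iterated_ge0 i0 c0.
  - by iterated_ge0 i0 c0.
  - by iterated_ge0 i0 c0.
  - by iterated_ge0 i0 c0.
  - by iterated_ge0 i0 c0.
  - by move=> x4; rewrite -[leRHS]p1; exact: step3 x4.
rewrite [leLHS]p2.
apply: p5.
- apply: eq_integral => x4 _; apply: eq_integral => x3 _; apply: swap.
    by measurable_iterated cm i0 c0.
  by iterated_ge0 i0 c0.
- apply: eq_integral => x4 _.
  transitivity (\int[l]_x2 \int[l]_s \int[l]_x1 curry4 g2 x1 x2 s x4).
    apply: eq_integral => x2 _; apply: swap.
      by measurable_iterated cm i0 c0.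
    by iterated_ge0 i0 c0.
  apply: swap.
    by measurable_iterated cm i0 c0.
  by iterated_ge0 i0 c0.
- transitivity (\int[l]_x3 \int[l]_x2 \int[l]_s \int[l]_x1 curry4 g3 x1 x2 x3 s).
    apply: eq_integral => x3 _; apply: eq_integral => x2 _; apply: swap.
      by measurable_iterated cm i0 c0.
    by iterated_ge0 i0 c0.
  transitivity (\int[l]_x3 \int[l]_s \int[l]_x2 \int[l]_x1 curry4 g3 x1 x2 x3 s).
    apply: eq_integral => x3 _; apply: swap.
      by measurable_iterated cm i0 c0.
    by iterated_ge0 i0 c0.
  apply: swap.
    by measurable_iterated cm i0 c0.
  by iterated_ge0 i0 c0.
Qed.

End loomis_whitney.

(** * The cubic inequality on a line *)

Section line_cube.
Variables (R : realType) (P G : R -> R).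
Let l := @lebesgue_measure R.
Hypotheses (P0 : forall s, 0 <= P s) (G0 : forall s, 0 <= G s).
Hypotheses (mP : measurable_fun [set: R] P) (mG : measurable_fun [set: R] G).
Hypothesis G2 : (\int[l]_(s in `[0%R, +oo[) (G s ^+ 2)%:E < +oo)%E.
Hypothesis P2 : (\int[l]_(s in `[0%R, +oo[) (P s ^+ 2)%:E < +oo)%E.
(* P is absolutely continuous with |P'| <= G almost everywhere. *)
Hypothesis PG : forall a b : R, 0 <= a -> a <= b ->
  (`|P b - P a|%:E <= \int[l]_(s in `[a, b[) (G s)%:E)%E.

Let sub0 (a b : R) : 0 <= a -> `[a, b[%classic `<=` (`[0%R, +oo[%classic : set R).
Proof.
by move=> a0 x /=; rewrite !in_itv/= andbT => /andP[ax _]; exact: le_trans ax.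
Qed.

Let mGS (A : set R) : measurable_fun A (fun s => (G s)%:E).
Proof. by apply: measurable_funTS; exact/measurable_EFinP. Qed.

Let mG2S (A : set R) : measurable_fun A (fun s => (G s ^+ 2)%:E).
Proof. by apply: measurable_funTS; apply/measurable_EFinP; exact: measurable_funX. Qed.


Let itv_length (a b : R) : a <= b -> l `[a, b[ = (b - a)%:E.
Proof.
rewrite /l lebesgue_measure_itv/= lte_fin le_eqVlt => /predU1P[->|->//].
by rewrite ltxx subrr.
Qed.

(** Absolute continuity of the integral made explicit: G <= c G^2 + 1 / (4 c), where c is chosen so
    that the first term contributes at most eta / 2, and on an interval of length 2 c eta the second
    contributes at most eta / 2. *)
Let intG_small (eta : R) : 0 < eta -> exists2 delta : R, 0 < delta &
  forall a b : R, 0 <= a -> a <= b -> b - a <= delta ->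
    (\int[l]_(s in `[a, b[) (G s)%:E <= eta%:E)%E.
Proof.
move=> eta0; have := G2; set K := (\int[l]_(s in `[0%R, +oo[) (G s ^+ 2)%:E)%E => G2'.
have K0 : (0 <= K)%E by apply: integral_ge0 => s _; rewrite lee_fin sqr_ge0.
have Kf : K \is a fin_num by rewrite ge0_fin_numE.
pose c : R := eta / (2 * (fine K + 1)).
have k0 : 0 <= fine K by exact: fine_ge0.
have c0 : 0 < c by rewrite divr_gt0// mulr_gt0// ltr_wpDl.
exists (2 * c * eta); first by rewrite mulr_gt0// mulr_gt0.
move=> a b a0 ab bad.
apply: (@le_trans _ _ (\int[l]_(s in `[a, b[) (c%:E * (G s ^+ 2)%:E + (4 * c)^-1%:E))%E).
  apply: ge0_le_integral => //.
  - by move=> x _; rewrite lee_fin.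
  - exact: mGS.
  - by apply: emeasurable_funD => //; apply: emeasurable_funM => //; exact: mG2S.
  - move=> x _; rewrite -EFinM -EFinD lee_fin.
    have -> : c * G x ^+ 2 + (4 * c)^-1 = G x + c * (G x - (2 * c)^-1) ^+ 2.
      by field; rewrite gt_eqF.
    by rewrite lerDl mulr_ge0 ?sqr_ge0// ltW.
rewrite ge0_integralD//; last 3 first.
- by move=> x _; rewrite -EFinM lee_fin mulr_ge0 ?sqr_ge0// ltW.
- by apply: emeasurable_funM => //; exact: mG2S.
- by move=> x _; rewrite lee_fin invr_ge0 mulr_ge0// ltW.
rewrite ge0_integralZl_EFin//; last 3 first.
- by move=> x _; rewrite lee_fin sqr_ge0.
- exact: mG2S.
- exact: ltW.
rewrite integral_cst// [X in (_ + _ * X)%E](itv_length ab).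
apply: (@le_trans _ _ (c%:E * K + (4 * c)^-1%:E * (b - a)%:E)%E).
  rewrite leeD2r// lee_wpmul2l ?lee_fin ?(ltW c0)//.
  apply: ge0_subset_integral => //; [exact: mG2S| |exact: sub0].
  by move=> x _; rewrite lee_fin sqr_ge0.
rewrite -(fineK Kf) -!EFinM -EFinD lee_fin.
have h1 : c * fine K <= eta / 2.
  have -> : c * fine K = eta / 2 * (fine K / (fine K + 1)).
    by rewrite /c; field; rewrite gt_eqF// ltr_wpDl.
  rewrite ler_piMr ?divr_ge0 ?(ltW eta0)// ler_pdivrMr ?ltr_wpDl//.
  by rewrite mul1r lerDl.
have h2 : (4 * c)^-1 * (b - a) <= eta / 2.
  rewrite mulrC ler_pdivrMr; last by rewrite mulr_gt0.
  apply: (le_trans bad).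
  by rewrite le_eqVlt; apply/orP; left; apply/eqP; field.
by lra.
Qed.

Let F (eta s : R) : \bar R := ((P s + eta) ^+ 2 * G s)%:E.

Let F0 eta s : (0 <= F eta s)%E.
Proof. by rewrite lee_fin mulr_ge0 ?sqr_ge0. Qed.

Let mF eta (A : set R) : measurable_fun A (F eta).
Proof.
apply: measurable_funTS; apply/measurable_EFinP; apply: measurable_funM => //.
by apply: measurable_funX; exact: measurable_funD.
Qed.


(** On an interval this short P varies by at most eta, so the larger end value M is at most P + eta
    throughout. The increment of P^3 is at most 3 M^2 times the integral of G, and M^2 can then be
    moved under the integral as (P + eta)^2. *)
Let small_step (eta delta a b : R) : 0 < eta ->
  (forall a b : R, 0 <= a -> a <= b -> b - a <= delta ->
    (\int[l]_(s in `[a, b[) (G s)%:E <= eta%:E)%E) ->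
  0 <= a -> a <= b -> b - a <= delta ->
  ((P a ^+ 3)%:E <= (P b ^+ 3)%:E + 3%:E * \int[l]_(s in `[a, b[) F eta s)%E.
Proof.
move=> eta0 hd a0 ab bad.
pose M : R := Num.max (P a) (P b).
have M0 : 0 <= M by rewrite le_max P0.
have near s : s \in `[a, b[ -> M <= P s + eta.
  rewrite in_itv/= => /andP[as' sb].
  have h1 : `|P s - P a| <= eta.
    rewrite -lee_fin; apply: le_trans (PG a0 as') (hd _ _ a0 as' _).
    by apply: le_trans bad; rewrite lerB// ltW.
  have h2 : `|P b - P s| <= eta.
    have s0 : 0 <= s by exact: le_trans as'.
    rewrite -lee_fin; apply: le_trans (PG s0 (ltW sb)) (hd _ _ s0 (ltW sb) _).
    by apply: le_trans bad; rewrite lerB.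
  by rewrite /M ge_max; move: h1 h2; rewrite !ler_norml; lra.
have I3 : ((3 * M ^+ 2)%:E * \int[l]_(s in `[a, b[) (G s)%:E <=
    3%:E * \int[l]_(s in `[a, b[) F eta s)%E.
  rewrite EFinM -muleA lee_wpmul2l// ?lee_fin//.
  rewrite -ge0_integralZl_EFin ?sqr_ge0//; [|by move=> x _; rewrite lee_fin|exact: mGS].
  apply: ge0_le_integral => //.
  - by move=> x _; rewrite mule_ge0// lee_fin ?sqr_ge0.
  - by apply: emeasurable_funM => //; exact: mGS.
  - exact: mF.
  - move=> x xab; rewrite -EFinM lee_fin ler_wpM2r// ler_sqr ?nnegrE//.
      by apply: near; rewrite inE.
    by rewrite addr_ge0// ltW.
apply: le_trans (leeD2l _ I3).
apply: (@le_trans _ _ ((P b ^+ 3)%:E + (3 * M ^+ 2)%:E * `|P b - P a|%:E)%E).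
  rewrite -EFinM -EFinD lee_fin.
  have h : P a ^+ 3 - P b ^+ 3 = (P a - P b) * (P a ^+ 2 + P a * P b + P b ^+ 2) by ring.
  have h1 : P a - P b <= `|P b - P a| by rewrite distrC ler_norm.
  have aM : P a <= M by rewrite le_max lexx.
  have bM : P b <= M by rewrite le_max lexx orbT.
  have h2 : P a ^+ 2 + P a * P b + P b ^+ 2 <= 3 * M ^+ 2.
    have e1 : P a ^+ 2 <= M ^+ 2 by rewrite ler_sqr ?nnegrE.
    have e2 : P b ^+ 2 <= M ^+ 2 by rewrite ler_sqr ?nnegrE.
    have e3 : P a * P b <= M ^+ 2 by rewrite expr2 ler_pM.
    by lra.
  rewrite -lerBlDl h mulrC.
  apply: (@le_trans _ _ ((P a ^+ 2 + P a * P b + P b ^+ 2) * `|P b - P a|)).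
    by rewrite ler_wpM2l// !addr_ge0 ?sqr_ge0 ?mulr_ge0.
  by rewrite ler_wpM2r.
rewrite leeD2l// lee_wpmul2l ?lee_fin ?mulr_ge0 ?sqr_ge0//.
exact: PG.
Qed.

Let chain (eta delta : R) n : 0 < eta -> 0 < delta ->
  (forall a b : R, 0 <= a -> a <= b -> b - a <= delta ->
    (\int[l]_(s in `[a, b[) (G s)%:E <= eta%:E)%E) ->
  forall a b : R, 0 <= a -> a <= b -> b - a <= n%:R * delta ->
  ((P a ^+ 3)%:E <= (P b ^+ 3)%:E + 3%:E * \int[l]_(s in `[a, b[) F eta s)%E.
Proof.
move=> eta0 delta0 hd; elim: n => [|n IHn] a b a0 ab.
  by rewrite mul0r => bd; apply: small_step hd _ _ _ => //; rewrite (le_trans bd)// ltW.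
move=> bd; have [bad|/ltW bad] := leP (b - a) delta; first exact: small_step hd _ _ _.
have am : a <= a + delta by rewrite lerDl ltW.
have mb : a + delta <= b by rewrite addrC -lerBrDr.
apply: le_trans (small_step eta0 hd a0 am _) _; first by rewrite addrC addKr.
have := IHn (a + delta) b (le_trans a0 am) mb.
have -> : b - (a + delta) = b - a - delta by ring.
rewrite lerBlDr => /(_ _)/le_trans IH.
have -> : (`[a, b[ = `[a, (a + delta)%R[ `|` `[(a + delta)%R, b[)%classic.
  by rewrite -itv_bndbnd_setU// bnd_simp.
rewrite ge0_integral_setU//; last first.
- apply/disj_setPS => x [/=]; rewrite !in_itv/= => /andP[_ xa] /andP[ax _].
  by move: (lt_le_trans xa ax); rewrite ltxx.
- exact: mF.
rewrite [X in (_ <= _ + X)%E]ge0_muleDr; [|by apply: integral_ge0..].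
rewrite [X in (_ <= _ + X)%E]addeC addeA leeD2r//.
by apply: IH => //; move: bd; rewrite -natr1; lra.
Qed.

Let PbJ (b : R) : 0 <= b ->
  ((P 0 ^+ 3)%:E <= (P b ^+ 3)%:E + 3%:E * \int[l]_(s in `[0%R, +oo[) F 0 s)%E.
Proof.
move=> b0; set J := (\int[l]_(s in `[0%R, +oo[) F 0 s)%E.
have J0 : (0 <= J)%E by exact: integral_ge0.
have [->|Jy] := eqVneq J +oo%E.
  by rewrite gt0_muley ?lte_fin// addey// leey.
have Jf : J \is a fin_num by rewrite ge0_fin_numE// ltey.
set K := (\int[l]_(s in `[0%R, b[) (G s)%:E)%E.
have K0 : (0 <= K)%E by apply: integral_ge0 => s _; rewrite lee_fin.
have Kf : K \is a fin_num.
  rewrite ge0_fin_numE//.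
  apply: (@le_lt_trans _ _ (\int[l]_(s in `[0%R, b[) ((G s ^+ 2)%:E + 1%:E))%E).
    apply: ge0_le_integral => //.
    - by move=> x _; rewrite lee_fin.
    - exact: mGS.
    - by apply: emeasurable_funD => //; exact: mG2S.
    - move=> x _; rewrite -EFinD lee_fin.
      have : 0 <= (G x - 2^-1) ^+ 2 by exact: sqr_ge0.
      by nra.
  rewrite ge0_integralD//; last 2 first.
  - by move=> x _; rewrite lee_fin sqr_ge0.
  - exact: mG2S.
  rewrite integral_cst// [X in (_ + _ * X)%E](itv_length b0) lte_add_pinfty//; last by rewrite -EFinM ltry.
  apply: le_lt_trans G2; apply: ge0_subset_integral => //; [exact: mG2S| |exact: sub0].
  by move=> x _; rewrite lee_fin sqr_ge0.
have [j EJ] : exists j, J = j%:E by exists (fine J); rewrite fineK.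
have [k EK] : exists k, K = k%:E by exists (fine K); rewrite fineK.
have jj : 0 <= j by rewrite -lee_fin -EJ.
have kk : 0 <= k by rewrite -lee_fin -EK.
rewrite EJ -EFinM -EFinD lee_fin; apply/ler_addgt0Pr => e e0.
(* As (P + eta)^2 <= (1 + eta) P^2 + 2 eta for eta <= 1, the error of the chained inequality is eta
   (3 J + 6 K); [C] exceeds this coefficient and is positive. *)
pose C : R := 3 * j + 6 * k + 1.
have C0 : 0 < C by rewrite /C; lra.
pose eta : R := Num.min 1 (e / C).
have eta0 : 0 < eta by rewrite lt_min ltr01 divr_gt0.
have [delta delta0 hd] := intG_small eta0.
have bd : b - 0 <= (Num.truncn (b / delta)).+1%:R * delta.
  by rewrite subr0 -ler_pdivrMr// ltW// truncnS_gt.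
have := chain eta0 delta0 hd (lexx 0) b0 bd.
have FI : (\int[l]_(s in `[0%R, b[) F eta s <= (1 + eta)%:E * J + (2 * eta)%:E * K)%E.
  apply: (@le_trans _ _ (\int[l]_(s in `[0%R, b[) ((1 + eta)%:E * F 0 s + (2 * eta)%:E * (G s)%:E))%E).
    apply: ge0_le_integral => //.
    - exact: mF.
    - by apply: emeasurable_funD; apply: emeasurable_funM => //; [exact: mF|exact: mGS].
    - move=> x _; rewrite /F addr0 -!EFinM -EFinD lee_fin.
      have -> : (1 + eta) * (P x ^+ 2 * G x) + 2 * eta * G x =
        (P x + eta) ^+ 2 * G x + eta * ((P x - 1) ^+ 2 + 1 - eta) * G x by ring.
      have e1 : eta <= 1 by rewrite ge_min lexx.
      rewrite lerDl mulr_ge0// mulr_ge0 ?(ltW eta0)//.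
      have := sqr_ge0 (P x - 1); lra.
  rewrite ge0_integralD//; last 4 first.
  - by move=> x _; rewrite mule_ge0// lee_fin; lra.
  - by apply: emeasurable_funM => //; exact: mF.
  - by move=> x _; rewrite -EFinM lee_fin mulr_ge0// mulr_ge0// ltW.
  - by apply: emeasurable_funM => //; exact: mGS.
  rewrite [X in (X + _)%E]ge0_integralZl_EFin//; last 2 first.
  - exact: mF.
  - by lra.
  rewrite [X in (_ + X)%E]ge0_integralZl_EFin//; last 3 first.
  - by move=> x _; rewrite lee_fin.
  - exact: mGS.
  - by rewrite mulr_ge0// ltW.
  rewrite leeD2r// lee_wpmul2l// ?lee_fin; first lra.
  by apply: ge0_subset_integral => //; [exact: mF|exact: sub0].
move=> h; have {h} := le_trans h (leeD2l _ (lee_wpmul2l _ FI)).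
have h3 : (0 <= 3%:E :> \bar R)%E by rewrite lee_fin.
move=> /(_ h3).
rewrite EJ EK -!EFinM -!EFinD lee_fin/= => h.
apply: (le_trans h).
have : eta * C <= e by rewrite -ler_pdivlMr// ge_min lexx orbT.
by rewrite /C; lra.
Qed.

(** P^3 is treated as an antiderivative of 3 P^2 P' without a chain rule for absolutely continuous
    functions: finitely many short steps are chained and eta tends to 0. The far end value P b can
    be made small because P^2 is integrable on the ray. *)
Lemma line_cube :
  ((P 0 ^+ 3)%:E <= 3%:E * \int[l]_(s in `[0%R, +oo[) (P s ^+ 2 * G s)%:E)%E.
Proof.
rewrite [X in (_ <= _ * X)%E](_ : _ = (\int[l]_(s in `[0%R, +oo[) F 0 s)%E); last first.
  by apply: eq_integral => s _; rewrite /F addr0.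
apply/lee_addgt0Pr => e e0.
have [t t0 t3] := cube_root (ltW e0).
(* Otherwise P^2 would exceed t^2 > 0 on a ray of infinite length. *)
have [b b0 bt] : exists2 b : R, 0 <= b & P b <= t.
  apply: contrapT => nb.
  have Pt s : 0 <= s -> t < P s.
    by move=> s0; rewrite ltNge; apply/negP => Ps; apply: nb; exists s.
  have t0' : 0 < t.
    rewrite lt_neqAle t0 andbT; apply: contraTneq e0 => tE.
    by rewrite -t3 -tE expr0n/= ltxx.
  move: P2; rewrite ltNge => /negP; apply.
  apply: (@le_trans _ _ (\int[l]_(s in `[0%R, +oo[) (t ^+ 2)%:E)%E).
    have ly : l `[0, +oo[ = +oo%E by rewrite /l lebesgue_measure_itv/= ltry.
    rewrite integral_cst// [X in (_ <= _ * X)%E]ly gt0_muley// lte_fin.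
    by rewrite exprn_gt0.
  apply: ge0_le_integral => //.
  - by move=> x _; rewrite lee_fin sqr_ge0.
  - by apply/measurable_EFinP; apply: measurable_funX; exact: measurable_funTS.
  - move=> x /=; rewrite in_itv/= andbT => x0; rewrite lee_fin ler_sqr ?nnegrE//.
    by rewrite ltW// Pt.
apply: le_trans (PbJ b0) _; rewrite addeC leeD2l// lee_fin -t3.
by rewrite ler_pXn2r// nnegrE.
Qed.

End line_cube.

(** * Smooth bump functions *)

Section Cn_closure.
Variables (R : realType) (V : normedModType R).
Implicit Types (f g : V -> R).

Lemma CnW n f : Cn n.+1 f -> Cn n f.
Proof.
elim: n f => [|n IHn] f [df Df].
  by move=> x; apply: differentiable_continuous; exact: df.
by split => // v; apply: IHn; exact: Df.
Qed.

Lemma Cn_cst n (c : R) : Cn n (cst c : V -> R).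
Proof.
elim: n c => [|n IHn] c; first by move=> x; exact: cvg_cst.
split => [x|v]; first exact: differentiable_cst.
have -> : 'D_v (cst c : V -> R) = cst 0 by apply/funext => x; rewrite derive_cst.
exact: IHn.
Qed.

Lemma CnD n f g : Cn n f -> Cn n g -> Cn n (fun x => f x + g x).
Proof.
elim: n f g => [|n IHn] f g.
  by move=> cf cg x; apply: cvgD; [exact: cf|exact: cg].
move=> [df Df] [dg Dg]; split => [x|v]; first exact: differentiableD.
have -> : 'D_v (fun x => f x + g x) = (fun x => 'D_v f x + 'D_v g x).
  by apply/funext => x; rewrite -deriveD//; exact: diff_derivable.
exact: (IHn _ _ (Df v) (Dg v)).
Qed.

Lemma CnM n f g : Cn n f -> Cn n g -> Cn n (fun x => f x * g x).
Proof.
elim: n f g => [|n IHn] f g.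
  by move=> cf cg x; apply: cvgM; [exact: cf|exact: cg].
move=> Cf Cg; have [[df Df] [dg Dg]] := (Cf, Cg).
split => [x|v]; first exact: differentiableM.
have -> : 'D_v (fun x => f x * g x) = (fun x => f x * 'D_v g x + g x * 'D_v f x).
  by apply/funext => x; rewrite (@deriveM _ _ f g)//; exact: diff_derivable.
exact: (CnD (IHn _ _ (CnW Cf) (Dg v)) (IHn _ _ (CnW Cg) (Df v))).
Qed.

Lemma CnN n f : Cn n f -> Cn n (fun x => - f x).
Proof.
move=> Cf; rewrite (_ : (fun x => _) = (fun x => cst (-1) x * f x)).
  by apply: CnM => //; exact: Cn_cst.
by apply/funext => x; rewrite /cst mulN1r.
Qed.

End Cn_closure.

(** The derivative along v is again of this form, namely the derivative of f along L v composed with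
    the same affine map, so the induction closes. *)
Lemma Cn_comp_affine (R : realType) (V W : normedModType R) n (f : W -> R)
    (L : {linear V -> W}) (d : W) :
  continuous L -> Cn n f -> Cn n (fun x => f (L x + d)).
Proof.
move=> cL; elim: n f => [|n IHn] f.
  move=> cf x; apply: (@continuous_comp _ _ _ (fun x => L x + d) f); last exact: cf.
  by apply: cvgD; [exact: cL|exact: cvg_cst].
move=> [df Df].
have dL x : differentiable (fun x => L x + d) x.
  by apply: differentiableD => //; exact: linear_differentiable.
split => [x|v]; first exact: (@differentiable_comp _ _ _ _ (fun x => L x + d) f).
suff -> : 'D_v (fun x => f (L x + d)) = (fun x => 'D_(L v) f (L x + d)).
  exact: (IHn _ (Df (L v))).
apply/funext => x; rewrite deriveE; last first.
  exact: (@differentiable_comp _ _ _ _ (fun x => L x + d) f).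
rewrite (@diff_comp _ _ _ _ (fun x => L x + d) f)//= deriveE//.
congr ('d f (L x + d) _).
rewrite (@diffD _ _ _ L (cst d))//; last exact: linear_differentiable.
rewrite diff_cst (@diff_lin _ _ _ L)//=.
exact: addr0.
Qed.

Section flat_function.
Variable R : realType.
Implicit Types (p : {poly R}) (t : R).

(* The class of functions P(1/t) exp(-1/t) on t > 0, extended by 0, is stable
   under differentiation. *)
Definition flat p t : R := if 0 < t then p.[t^-1] * expR (- t^-1) else 0.

(** In p(1/t) exp(-1/t) the inner derivatives of both factors produce t^-2, once with p and once
    with -p'; the square of the indeterminate is that t^-2. *)
Definition dflat p : {poly R} := 'X^2 * (p - p^`()).

(** A quadratic bound makes the difference quotient at 0 vanish in the limit. For 1/t >= 1 the
    polynomial is at most a multiple of t^-n, and s^(n+2) <= (n+2)! e^s by the exponential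
    series. *)
Lemma flat_bound p : exists2 C : R, 0 <= C &
  forall t, 0 < t -> t <= 1 -> `|flat p t| <= C * t ^+ 2.
Proof.
pose n := size p.
pose A : R := \sum_(i < n) `|p`_i|.
have A0 : 0 <= A by apply: sumr_ge0 => i _.
exists (A * (n.+2)`!%:R) => [|t t0 t1]; first by rewrite mulr_ge0.
have s1 : 1 <= t^-1 by rewrite invf_ge1.
have s0 : 0 <= t^-1 by rewrite invr_ge0 ltW.
rewrite /flat t0 normrM (ger0_norm (expR_ge0 _)).
have h1 : `|p.[t^-1]| <= A * t^-1 ^+ n.
  rewrite horner_coef mulr_suml (le_trans (ler_norm_sum _ _ _))//.
  apply: ler_sum => i _; rewrite normrM ler_wpM2l// ger0_norm ?exprn_ge0//.
  by rewrite ler_weXn2l// ltnW.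
have h2 : t^-1 ^+ n.+2 * expR (- t^-1) <= (n.+2)`!%:R.
  rewrite expRN ler_pdivrMr ?expR_gt0//.
  have := expR_ge1Dxn n.+1 s0; set E := expR _ => hE.
  have : t^-1 ^+ n.+2 / (n.+2)`!%:R <= E by apply: le_trans hE; rewrite lerDr.
  by rewrite ler_pdivrMr ?ltr0n ?fact_gt0// mulrC.
have h3 : t^-1 ^+ n * expR (- t^-1) <= (n.+2)`!%:R * t ^+ 2.
  have -> : t^-1 ^+ n * expR (- t^-1) = (t^-1 ^+ n.+2 * expR (- t^-1)) * t ^+ 2.
    rewrite -(addn2 n) exprD -!mulrA; congr (_ * _).
    by field; rewrite gt_eqF.
  by rewrite ler_wpM2r// exprn_ge0 ?ltW.
apply: le_trans (ler_wpM2r (expR_ge0 _) h1) _.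
by rewrite -!mulrA ler_wpM2l.
Qed.

Lemma is_derive_flat p t : is_derive t (1 : R) (flat p) (flat (dflat p) t).
Proof.
have [t0|t0|->] := ltgtP t 0.
- rewrite [X in is_derive _ _ _ X]/flat ltNge (ltW t0)/=.
  apply: (@near_eq_is_derive _ _ _ (cst 0)) => //.
  near=> z; rewrite /flat /cst/= ltNge ifF//; apply/negbTE; rewrite negbK ltW//.
  by near: z; exact: lt_nbhsl.
- rewrite [X in is_derive _ _ _ X]/flat t0.
  apply: (@near_eq_is_derive _ R R (fun z : R => p.[z^-1] * expR (- z^-1))).
    near=> z; rewrite /flat ifT//.
    by near: z; exact: lt_nbhsr.
  have tn : t != 0 by rewrite gt_eqF.
  have dV : is_derive t (1 : R) (fun z : R => z^-1) (- t ^- 2).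
    apply: is_derive_eq; first by apply: is_deriveV.
    by rewrite /GRing.scale/= mulr1.
  have dp : is_derive t (1 : R) (fun z : R => p.[z^-1]) (p^`().[t^-1] * (- t ^- 2)).
    exact: (@is_derive1_comp _ (horner p) (fun z => z^-1)).
  have dN : is_derive t (1 : R) (fun z : R => - z^-1) (t ^- 2).
    by apply: is_derive_eq; rewrite opprK.
  have de : is_derive t (1 : R) (fun z : R => expR (- z^-1)) (expR (- t^-1) * t ^- 2).
    exact: (@is_derive1_comp _ expR (fun z => - z^-1)).
  apply: is_derive_eq.
  rewrite /dflat !hornerE/= /GRing.scale/= exprVn; ring.
- rewrite [X in is_derive _ _ _ X]/flat ltxx.
  have [C C0 hC] := flat_bound p.
  have f0 : flat p 0 = 0 by rewrite /flat ltxx.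
  have key : (fun h : R => h^-1 *: (flat p (h *: 1 + 0) - flat p 0)) @ 0^' --> (0 : R).
    apply/cvgrPdist_le => e e0.
    have e1 : 0 < e / (C + 1) by rewrite divr_gt0// ltr_wpDl.
    near=> h.
    rewrite f0 subr0 sub0r normrN /GRing.scale/= mulr1 addr0 normrM.
    have h1 : `|h| <= 1.
      near: h; apply: (@nbhs_dnbhs _ 0); exists 1 => //= z /=.
      by rewrite sub0r normrN => /ltW.
    have he : `|h| <= e / (C + 1).
      near: h; apply: (@nbhs_dnbhs _ 0); exists (e / (C + 1)) => //= z /=.
      by rewrite sub0r normrN => /ltW.
    have [h0|h0] := leP h 0.
      by rewrite /flat ltNge h0/= normr0 mulr0 ltW.
    rewrite (gtr0_norm h0) in h1 he.
    rewrite gtr0_norm ?invr_gt0//.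
    apply: (@le_trans _ _ (h^-1 * (C * h ^+ 2))).
      by rewrite ler_wpM2l ?hC// invr_ge0 ltW.
    have -> : h^-1 * (C * h ^+ 2) = C * h by field; rewrite gt_eqF.
    have C1 : 0 < C + 1 by rewrite ltr_wpDl.
    move: he; rewrite ler_pdivlMr// => he; apply: le_trans he.
    by rewrite mulrC ler_wpM2l ?(ltW h0)// lerDl.
  by apply: DeriveDef; [apply/cvg_ex; exists 0|apply/cvg_lim].
Unshelve. all: by end_near. Qed.

Lemma Cn_flat n p : Cn n (flat p).
Proof.
elim: n p => [|n IHn] p.
  move=> t; apply: differentiable_continuous; apply/derivable1_diffP.
  by have [] := is_derive_flat p t.
have df t : differentiable (flat p) t.
  by apply/derivable1_diffP; have [] := is_derive_flat p t.
split => // v.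
suff -> : 'D_v (flat p) = flat (v *: dflat p) by exact: IHn.
apply/funext => t; rewrite deriveE// diff1E//= derive1E.
have [_ ->] := is_derive_flat p t.
by rewrite /flat; case: ifP => _; rewrite ?scaler0// hornerZ /GRing.scale/= mulrA.
Qed.

(** The classical flat function: exp(-1/t) for t > 0 and 0 elsewhere. *)
Definition expinv := flat 1.

Lemma expinv_ge0 t : 0 <= expinv t.
Proof. by rewrite /expinv /flat; case: ifP => // _; rewrite hornerC mul1r expR_ge0. Qed.

Lemma expinv_le1 t : expinv t <= 1.
Proof.
rewrite /expinv /flat; case: ifP => // t0; rewrite hornerC mul1r.
by rewrite -expR0 ler_expR oppr_le0 invr_ge0 ltW.
Qed.

Lemma expinv_eq0 t : t <= 0 -> expinv t = 0.
Proof. by move=> t0; rewrite /expinv /flat ltNge t0. Qed.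

Lemma cvg_expinv t : 0 < t -> (fun n : nat => expinv (n%:R * t)) @ \oo --> (1 : R).
Proof.
move=> t0.
have H : (fun n : nat => expR (- (n%:R * t)^-1)) @ \oo --> (1 : R).
  rewrite -[X in _ --> X]expR0; apply: continuous_cvg; first exact: continuous_expR.
  rewrite -[X in _ --> X]oppr0; apply: cvgN.
  apply/cvgrPdist_le => e e0; near=> n; rewrite sub0r normrN.
  have n0 : 0 < n%:R * t :> R by rewrite mulr_gt0// ltr0n; near: n; exists 1%N.
  rewrite gtr0_norm ?invr_gt0// -[leRHS]invrK lef_pV2 ?posrE ?invr_gt0//.
  rewrite -ler_pdivrMr//; near: n; exact: nbhs_infty_ger.
apply: cvg_trans H; apply: near_eq_cvg; near=> n.
rewrite /expinv /flat ifT ?hornerC ?mul1r// mulr_gt0// ltr0n; near: n; by exists 1%N.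
Unshelve. all: by end_near. Qed.

End flat_function.

Section bumps.
Variable R : realType.
Implicit Types (a b t s : R).

(** For n > 0 the parameter only steepens the two ramps: the function stays positive exactly on the
    open interval and tends to its indicator. A shift of the argument merely shifts a and b, so the
    family is stable under translation, on which the passage to lines relies. *)
Definition bump1 a b (n : nat) t : R :=
  expinv (n%:R * (t - a)) * expinv (n%:R * (b - t)).

Lemma bump1_ge0 a b n t : 0 <= bump1 a b n t.
Proof. by rewrite mulr_ge0// expinv_ge0. Qed.

Lemma bump1_le1 a b n t : bump1 a b n t <= 1.
Proof. by rewrite mulr_ile1// ?expinv_ge0// expinv_le1. Qed.

Lemma bump1_eq0 a b n t : ~~ (a < t < b) -> bump1 a b n t = 0.
Proof.
rewrite negb_and -!leNgt /bump1 => /orP[ta|bt].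
  by rewrite expinv_eq0 ?mul0r// mulr_ge0_le0// subr_le0.
by rewrite [X in _ * X]expinv_eq0 ?mulr0// mulr_ge0_le0// subr_le0.
Qed.

Lemma cvg_bump1 a b t :
  (fun n => bump1 a b n t) @ \oo --> (\1_(`]a, b[%classic) t : R).
Proof.
rewrite indicE; have [h|h] := boolP (a < t < b).
  rewrite mem_set/= ?in_itv//; case/andP: h => at' tb; rewrite -[X in _ --> X]mulr1.
  by apply: cvgM; apply: cvg_expinv; rewrite subr_gt0.
rewrite memNset/=; last by rewrite in_itv/=; exact/negP.
rewrite (_ : (fun n => _) = cst 0); first exact: cvg_cst.
by apply/funext => n; rewrite bump1_eq0.
Qed.

Lemma bump1_shift a b n t s : bump1 a b n (t + s) = bump1 (a - s) (b - s) n t.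
Proof. by rewrite /bump1; congr (expinv (_ * _) * expinv (_ * _)); ring. Qed.

Lemma Cn_bump1_linear (V : normedModType R) (L : {linear V -> R}) a b n k :
  continuous L -> Cn k (fun x => bump1 a b n (L x)).
Proof.
move=> cL.
have Cscale (c d : R) : Cn k (fun t : R => expinv (c * t + d)).
  have lm : linear ( *%R c : R -> R).
    by move=> x u v; rewrite mulrDr /GRing.scale/= mulrCA.
  pose m : {linear R -> R} := HB.pack ( *%R c : R -> R) (GRing.isLinear.Build _ _ _ _ _ lm).
  have cm : continuous m by exact: mulrl_continuous.
  exact: (Cn_comp_affine d cm (Cn_flat k 1)).
have -> : (fun x => bump1 a b n (L x)) = (fun x =>
    (fun t => expinv (n%:R * t + (- n%:R * a))) (L x + 0) *
    (fun t => expinv (- n%:R * t + n%:R * b)) (L x + 0)).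
  by apply/funext => x; rewrite /bump1; congr (expinv _ * expinv _); ring.
apply: CnM.
- exact: (Cn_comp_affine 0 cL (Cscale _ _)).
- exact: (Cn_comp_affine 0 cL (Cscale _ _)).
Qed.

Let c0 : {linear space4 R -> R} := fst \o (fst \o fst).
Let c1 : {linear space4 R -> R} := snd \o (fst \o fst).
Let c2 : {linear space4 R -> R} := snd \o fst.
Let c3 : {linear space4 R -> R} := snd.

Definition bump4 (a b : space4 R) (n : nat) (x : space4 R) : R :=
  bump1 a.1.1.1 b.1.1.1 n x.1.1.1 * bump1 a.1.1.2 b.1.1.2 n x.1.1.2
  * bump1 a.1.2 b.1.2 n x.1.2 * bump1 a.2 b.2 n x.2.

Definition cbox4 (a b : space4 R) : set (space4 R) :=
  `[a.1.1.1, b.1.1.1] `*` `[a.1.1.2, b.1.1.2] `*` `[a.1.2, b.1.2] `*` `[a.2, b.2].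

Lemma compact_cbox4 (a b : space4 R) : compact (cbox4 a b).
Proof. by do 3 (apply: compact_setX; last exact: segment_compact); exact: segment_compact. Qed.

Lemma closed_cbox4 (a b : space4 R) : closed (cbox4 a b).
Proof.
apply: compact_closed; last exact: compact_cbox4.
exact: norm_hausdorff.
Qed.

Lemma box4_sub_cbox4 (a b : space4 R) : box4 a b `<=` cbox4 a b.
Proof.
move=> x [[[]]]/= h1 h2 h3 h4; do ! split => /=; exact: subset_itv_oo_cc.
Qed.

Lemma bump4_ge0 (a b : space4 R) n x : 0 <= bump4 a b n x.
Proof. by do 3 (apply: mulr_ge0; last exact: bump1_ge0); exact: bump1_ge0. Qed.

Lemma bump4_le1 (a b : space4 R) n x : bump4 a b n x <= 1.
Proof.
have p (y z : R) : 0 <= y <= 1 -> 0 <= z <= 1 -> 0 <= y * z <= 1.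
  by move=> /andP[y0 y1] /andP[z0 z1]; rewrite mulr_ge0// mulr_ile1.
have b1 c d m t : 0 <= bump1 c d m t <= 1 by rewrite bump1_ge0 bump1_le1.
by have /andP[] := p _ _ (p _ _ (p _ _ (b1 a.1.1.1 b.1.1.1 n x.1.1.1) (b1 a.1.1.2 b.1.1.2 n x.1.1.2))
  (b1 a.1.2 b.1.2 n x.1.2)) (b1 a.2 b.2 n x.2).
Qed.

Lemma bump4_eq0 (a b : space4 R) n x : ~ box4 a b x -> bump4 a b n x = 0.
Proof.
move=> nx; apply/eqP; apply: contrapT => /negP.
rewrite !mulf_eq0 !negb_or => /andP[/andP[/andP[h1 h2] h3] h4]; apply: nx.
have h (c d t : R) :
    (expinv (n%:R * (t - c)) != 0) && (expinv (n%:R * (d - t)) != 0) -> c < t < d.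
  rewrite -negb_or -mulf_eq0; apply: contra_neqT => /(bump1_eq0 n); exact.
by do ! split => /=; rewrite in_itv/=; exact: h.
Qed.

Lemma cvg_bump4 (a b x : space4 R) : (fun n => bump4 a b n x) @ \oo --> (\1_(box4 a b) x : R).
Proof.
have -> : \1_(box4 a b) x = \1_(`]a.1.1.1, b.1.1.1[%classic) x.1.1.1
   * \1_(`]a.1.1.2, b.1.1.2[%classic) x.1.1.2 * \1_(`]a.1.2, b.1.2[%classic) x.1.2
   * \1_(`]a.2, b.2[%classic) x.2 :> R.
  by rewrite /box4 !indicE !in_setX -!natrM !mulnb.
by do 3 (apply: cvgM; last exact: cvg_bump1); exact: cvg_bump1.
Qed.

Lemma bump4_shift (a b : space4 R) n (x c : space4 R) : bump4 a b n (x + c) = bump4 (a - c) (b - c) n x.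
Proof. by rewrite /bump4/= !bump1_shift. Qed.

Lemma Cn_bump4 (a b : space4 R) n k : Cn k (bump4 a b n).
Proof.
have [h0 h1 h2 h3] := continuous_coord4 R.
apply: CnM; first apply: CnM; first apply: CnM.
- exact: (@Cn_bump1_linear _ c0).
- exact: (@Cn_bump1_linear _ c1).
- exact: (@Cn_bump1_linear _ c2).
- exact: (@Cn_bump1_linear _ c3).
Qed.

Definition bump5 (a b : spacetime R) (n : nat) (z : spacetime R) : R :=
  bump4 a.1 b.1 n z.1 * bump1 a.2 b.2 n z.2.

Definition cbox5 (a b : spacetime R) : set (spacetime R) :=
  cbox4 a.1 b.1 `*` `[a.2, b.2].

Lemma compact_cbox5 (a b : spacetime R) : compact (cbox5 a b).
Proof. by apply: compact_setX; [exact: compact_cbox4|exact: segment_compact]. Qed.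

Lemma box5_sub_cbox5 (a b : spacetime R) : box5 a b `<=` cbox5 a b.
Proof.
by move=> x [h1 h2]; split; [exact: box4_sub_cbox4|exact: subset_itv_oo_cc].
Qed.

Lemma bump5_itv01 (a b : spacetime R) n z : 0 <= bump5 a b n z <= 1.
Proof.
have [h1 h2 h3 h4] := And4 (bump4_ge0 a.1 b.1 n z.1) (bump4_le1 a.1 b.1 n z.1)
  (bump1_ge0 a.2 b.2 n z.2) (bump1_le1 a.2 b.2 n z.2).
by apply/andP; split; [exact: mulr_ge0|exact: mulr_ile1].
Qed.

Lemma bump5_eq0 (a b : spacetime R) n z : ~ box5 a b z -> bump5 a b n z = 0.
Proof.
move=> nz; rewrite /bump5; have [h1|h1] := pselect (box4 a.1 b.1 z.1); last first.
  by rewrite bump4_eq0// mul0r.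
rewrite [X in _ * X]bump1_eq0 ?mulr0//; apply/negP => h2; exact: nz.
Qed.

Lemma cvg_bump5 (a b z : spacetime R) : box5 a b z ->
  (fun n => bump5 a b n z) @ \oo --> (1 : R).
Proof.
move=> [h1 h2]; rewrite -[X in _ --> X]mulr1; apply: cvgM.
  by have := @cvg_bump4 a.1 b.1 z.1; rewrite indicE mem_set.
by have := @cvg_bump1 a.2 b.2 z.2; rewrite indicE mem_set.
Qed.

Lemma compact_support_sub (V : normedModType R) (f : V -> R) (K : set V) :
  compact K -> (forall x, f x != 0 -> K x) -> compact (closure [set x | f x != 0]).
Proof.
move=> cK fK; apply: (subclosed_compact (@closed_closure _ _) cK).
rewrite [X in _ `<=` X](closure_id _).1; first exact: closure_subset.
by apply: compact_closed cK; exact: norm_hausdorff.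
Qed.

Lemma test_function_bump4 (a b : space4 R) n : test_function (bump4 a b n).
Proof.
split=> [k|]; first exact: Cn_bump4.
apply: (compact_support_sub (@compact_cbox4 a b)) => x; apply: contra_neqP.
by move=> nx; apply: bump4_eq0 => /box4_sub_cbox4.
Qed.

Let p1 : {linear spacetime R -> space4 R} := fst.
Let p2 : {linear spacetime R -> R} := snd.

Lemma continuous_fst5 : continuous (fst : spacetime R -> space4 R).
Proof. by move=> z; exact: cvg_fst. Qed.

Lemma continuous_snd5 : continuous (snd : spacetime R -> R).
Proof. by move=> z; exact: cvg_snd. Qed.

Lemma test_function_bump5 (a b : spacetime R) n : test_function (bump5 a b n).
Proof.
split=> [k|].
  apply: CnM; last exact: (@Cn_bump1_linear _ p2 _ _ _ _ continuous_snd5).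
  have := @Cn_comp_affine R _ _ k _ p1 0 continuous_fst5 (Cn_bump4 a.1 b.1 n k).
  by congr (Cn _ _); apply/funext => z; rewrite addr0.
apply: (compact_support_sub (@compact_cbox5 a b)) => x; apply: contra_neqP.
by move=> nx; apply: bump5_eq0 => /box5_sub_cbox5.
Qed.

End bumps.

(** * Test functions: algebra, bounds, slices and cutoffs of open sets *)

Section test_functions.
Variables (R : realType) (V : normedModType R).
Implicit Types f g : V -> R.

Lemma test_functionM f g : (forall n, Cn n f) -> test_function g ->
  test_function (fun x => f x * g x).
Proof.
move=> Cf [Cg sg]; split=> [n|]; first exact: CnM.
apply: (subclosed_compact _ sg); first exact: closed_closure.
by apply: closure_subset => x /=; rewrite mulf_eq0 negb_or => /andP[].
Qed.

Lemma test_functionD f g : test_function f -> test_function g ->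
  test_function (fun x => f x + g x).
Proof.
move=> [Cf sf] [Cg sg]; split=> [n|]; first exact: CnD.
apply: (subclosed_compact (@closed_closure _ _) (compactU sf sg)).
rewrite -closureU; apply: closure_subset => x /= fg.
have [f0|f0] := eqVneq (f x) 0; [right|left] => //.
by move: fg; rewrite f0 add0r.
Qed.

Lemma test_functionN f : test_function f -> test_function (fun x => - f x).
Proof.
move=> [Cf sf]; split=> [n|]; first exact: CnN.
by under eq_set do rewrite oppr_eq0.
Qed.

Lemma test_function0 : test_function (fun _ : V => 0 : R).
Proof.
split=> [n|]; first exact: Cn_cst.
rewrite (_ : [set _ | _] = set0) ?closure0; first exact: compact0.
by apply/seteqP; split=> // x /=; rewrite eqxx.
Qed.

Lemma continuous_support_bounded f (K : set V) : continuous f -> compact K ->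
  (forall x, ~ K x -> f x = 0) -> exists M : R, forall x, `|f x| <= M.
Proof.
move=> cf cK f0; have cfK : compact (f @` K).
  by apply: continuous_compact => //; exact: continuous_subspaceT.
have [M [_ /(_ (Num.max M 0 + 1))]] := compact_bounded cfK.
rewrite ltr_pwDr ?le_max ?lexx// => /(_ isT) bM.
exists (Num.max M 0 + 1) => x; have [Kx|nKx] := pselect (K x).
  by apply: bM; exists x.
by rewrite f0// normr0 addr_ge0// le_max lexx orbT.
Qed.

Lemma test_function_bounded f : test_function f -> exists M : R, forall x, `|f x| <= M.
Proof.
move=> [Cf sf]; apply: (continuous_support_bounded (Cf 0%N) sf) => x nx.
by apply/eqP; apply: contrapT => /negP fx; apply: nx; exact: subset_closure.
Qed.

Lemma derive_eq0_off_support f e x : ~ closure [set x | f x != 0] x -> 'D_e f x = 0.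
Proof.
move=> nx; rewrite -[RHS](derive_cst (0 : R) e x); apply: near_eq_derive.
have : open (~` closure [set x | f x != 0]) by apply/closed_openC/closed_closure.
rewrite openE => /(_ _ nx); apply: filterS => y ny /=.
by apply/eqP; apply: contrapT => /negP fx; apply: ny; exact: subset_closure.
Qed.

Lemma derive_test_bounded f e : test_function f -> exists M : R, forall x, `|'D_e f x| <= M.
Proof.
move=> [Cf sf]; have [_ /(_ e) cD] := Cf 1%N.
apply: (continuous_support_bounded cD sf) => x; exact: derive_eq0_off_support.
Qed.

End test_functions.

Section slices.
Variable R : realType.
Implicit Types phi : spacetime R -> R.

Lemma derive_slice phi (t : R) (v x : space4 R) :
  'D_v (fun y => phi (y, t)) x = 'D_((v, 0) : spacetime R) phi (x, t).
Proof.
rewrite /derive; apply: (congr1 (fun F : R -> R => lim (F @ 0^'))); apply/funext => h.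
congr (_ *: (phi _ - _)) => /=; congr (_, _); exact: esym (etrans (congr1 (+%R^~ t) (mulr0 h)) (add0r t)).
Qed.

Lemma test_function_slice phi (t : R) : test_function phi ->
  test_function (fun x : space4 R => phi (x, t)).
Proof.
move=> [Cphi sphi]; split=> [n|].
  have li : linear (fun x : space4 R => (x, 0) : spacetime R).
    move=> c u v; congr (_, _).
    exact: esym (etrans (addr0 _) (mulr0 c)).
  pose L : {linear space4 R -> spacetime R} :=
    HB.pack (fun x : space4 R => (x, 0) : spacetime R) (GRing.isLinear.Build _ _ _ _ _ li).
  have cL : continuous L.
    move=> x; apply/cvg_ballP => e e0; have := nbhsx_ballx x e e0.
    by apply: filterS => y xy; split => //=; exact: ballxx.
  have := Cn_comp_affine ((0, t) : spacetime R) cL (Cphi n).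
  by congr (Cn _ _); apply/funext => x; congr (phi (_, _)); rewrite ?addr0 ?add0r.
apply: (@compact_support_sub _ _ _ (fst @` closure [set z | phi z != 0])).
  apply: continuous_compact => //; apply: continuous_subspaceT; exact: continuous_fst5.
by move=> x nx; exists (x, t) => //; exact: subset_closure.
Qed.

Lemma compact_sub_box5 (K : set (spacetime R)) : compact K ->
  exists n : nat, K `<=` box5 (cst5 (- n%:R)) (cst5 n%:R).
Proof.
move=> /compact_bounded[M [_ /(_ (Num.max M 0 + 1))]].
rewrite ltr_pwDr ?le_max ?lexx// => /(_ isT) bM.
exists (Num.truncn (Num.max M 0 + 1)).+1 => z /bM nz.
have n2 (U V : normedModType R) (w : U * V) (C : R) :
    `|w| <= C -> `|w.1| <= C /\ `|w.2| <= C by rewrite prod_normE ge_max => /andP.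
have [w4 h5] := n2 (R * R * R * R)%type R z _ nz.
have [w3 h4] := n2 (R * R * R)%type R z.1 _ w4.
have [w2 h3] := n2 (R * R)%type R z.1.1 _ w3.
have [h1 h2] := n2 R R z.1.1.1 _ w2.
have h (s : R) : `|s| <= Num.max M 0 + 1 ->
    `](- (Num.truncn (Num.max M 0 + 1)).+1%:R)%R, ((Num.truncn (Num.max M 0 + 1)).+1%:R)%R[%classic s.
  move=> hs /=; rewrite in_itv/= -ltr_norml; apply: le_lt_trans hs _; exact: truncnS_gt.
by do ! split; exact: h.
Qed.

(** With b_k the n-th bump of the k-th box covering O, the cutoff is 1 - prod_(k < n) (1 - b_k), a
    smooth substitute for the maximum with values in [0, 1] and zero off O. The recursion phi + b -
    phi b keeps it a test function. For n > k it dominates b_k, which tends to 1 inside the k-th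
    box. *)
Lemma open_cutoffs (O : set (spacetime R)) : open O ->
  exists phi : nat -> spacetime R -> R,
  [/\ forall n, test_function (phi n), forall n z, 0 <= phi n z <= 1,
      forall n z, ~ O z -> phi n z = 0 &
      forall z, O z -> (fun n => phi n z) @ \oo --> (1 : R)].
Proof.
move=> oO; have [B hB OB] := open5_bigcup oO.
have /choice[p hp] : forall n, exists p : spacetime R * spacetime R, B n = box5 p.1 p.2.
  by move=> n; have [a [b ->]] := hB n; exists (a, b).
pose f n z k := 1 - bump5 (p k).1 (p k).2 n z.
have f01 n z k : 0 <= f n z k <= 1.
  by have /andP[? ?] := bump5_itv01 (p k).1 (p k).2 n z; apply/andP; split; rewrite /f; lra.
have prod01 n z k (P : pred 'I_k) : 0 <= \prod_(i < k | P i) f n z i <= 1.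
  apply: (big_ind (fun x : R => 0 <= x <= 1)) => [|x y /andP[? ?] /andP[? ?]|//].
    by rewrite ler01 lexx.
  by rewrite mulr_ge0 ?mulr_ile1.
pose phi k n z := 1 - \prod_(i < k) f n z i.
have phi01 k n z : 0 <= phi k n z <= 1.
  have : 0 <= \prod_(i < k) f n z i <= 1.
    by exact: prod01.
  by rewrite /phi => /andP[? ?]; apply/andP; split; lra.
exists (fun n => phi n n); split => //.
- move=> n; suff : forall k, test_function (phi k n) by [].
  elim=> [|k IHk].
    rewrite (_ : phi 0%N n = fun=> 0); first exact: test_function0.
    by apply/funext => z; rewrite /phi big_ord0 subrr.
  have tb := test_function_bump5 (p k).1 (p k).2 n.
  have -> : phi k.+1 n = (fun z => (phi k n z + bump5 (p k).1 (p k).2 n z)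
      + (- (phi k n z * bump5 (p k).1 (p k).2 n z))).
    apply/funext => z; rewrite /phi big_ord_recr/= {2}/f; ring.
  apply: test_functionD; first exact: test_functionD.
  apply: test_functionN; apply: test_functionM => //; exact: IHk.1.
- move=> n z nO; rewrite /phi big1 ?subrr// => i _; rewrite /f bump5_eq0 ?subr0//.
  by rewrite -hp => Bz; apply: nO; rewrite OB; exists i.
- move=> z; rewrite OB => -[i _]; rewrite hp => zi.
  apply: (@squeeze_cvgr _ _ _ _ (fun n => bump5 (p i).1 (p i).2 n z) (cst 1)); last exact: cvg_cst.
    exists i.+1 => // n /= ni; rewrite (andP (phi01 _ _ _)).2 andbT /phi.
    rewrite (bigD1 (Ordinal ni))//= {1}/f.
    set P := \prod_(_ | _) _.
    have /andP[P0 P1] : 0 <= P <= 1 by exact: prod01.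
    have /andP[? ?] := bump5_itv01 (p i).1 (p i).2 n z.
    by nra.
  exact: cvg_bump5.
Qed.

End slices.

(** * The fundamental theorem of calculus along a line *)

Section derive_line.
Variables (R : realType) (V : normedModType R) (f : V -> R) (e : V).

Lemma derive_line x s : 'D_1 (fun s : R => f (x + s *: e)) s = 'D_e f (x + s *: e).
Proof.
rewrite /derive; apply: (congr1 (fun F : R -> R => lim (F @ 0^'))); apply/funext => h.
by congr (_ *: (f _ - _)) => /=; rewrite [h%:A]mulr1 scalerDl addrCA.
Qed.

Lemma derivable_line x (s : R) : derivable f (x + s *: e) e ->
  derivable (fun s : R => f (x + s *: e)) s 1.
Proof.
rewrite /derivable.
set F := (fun h : R => _ *: (((fun _ => _) \o _) _ - _)).
set G := (fun h : R => _ *: ((_ \o shift s) _ - _)).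
suff -> : G = F by [].
by apply/funext => h; congr (_ *: (f _ - _)) => /=; rewrite [h%:A]mulr1 scalerDl addrCA.
Qed.

Hypothesis Cf : Cn 1 f.

Lemma continuous_derive : continuous ('D_e f).
Proof. by have [_ /(_ e)] := Cf. Qed.

Lemma FTC_line x (h : R) : 0 < h ->
  \int[lebesgue_measure]_(s in `[0, h]) 'D_e f (x + s *: e) = f (x + h *: e) - f x.
Proof.
move=> h0; have [df _] := Cf.
have cl : continuous (fun s : R => x + s *: e).
  by move=> s; apply: cvgD; [exact: cvg_cst|exact: scalel_continuous].
have dl s : derivable (fun s : R => f (x + s *: e)) s 1.
  by apply: derivable_line; exact: diff_derivable.
have cF : continuous (fun s : R => f (x + s *: e)).
  by move=> s; apply: differentiable_continuous; apply/derivable1_diffP.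
have cD : continuous (fun s : R => 'D_e f (x + s *: e)).
  move=> s; apply: (@continuous_comp _ _ _ (fun s : R => x + s *: e) ('D_e f)).
    exact: cl.
  exact: continuous_derive.
have ftc := @continuous_FTC2 _ (fun s : R => 'D_e f (x + s *: e))
  (fun s : R => f (x + s *: e)) 0 h h0.
rewrite /Rintegral ftc/=; first by rewrite scale0r addr0.
- exact: continuous_subspaceT.
- split=> //.
  + by apply: cvg_at_right_filter; exact: cF.
  + by apply: cvg_at_left_filter; exact: cF.
- by move=> s _; rewrite derive1E derive_line.
Qed.

End derive_line.

(** * Square integrable functions and weak derivatives on lines *)

Lemma indic_idem (R : pzRingType) (T : Type) (A : set T) (x : T) :
  \1_A x * \1_A x = \1_A x :> R.
Proof. by rewrite indicE; case: (_ \in _); rewrite ?mulr0 ?mulr1. Qed.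

Section square_integrable.
Context d (T : measurableType d) (R : realType) (mu : {measure set T -> \bar R}).
Implicit Types f g : T -> R.

Definition sqint f : Prop := (\int[mu]_x (f x ^+ 2)%:E < +oo)%E.

Lemma integrable_sqM f g : measurable_fun setT f -> measurable_fun setT g ->
  sqint f -> sqint g -> mu.-integrable setT (fun x => (f x * g x)%:E).
Proof.
move=> mf mg sf sg; apply/integrableP; split.
  by apply/measurable_EFinP; exact: measurable_funM.
apply: (@le_lt_trans _ _ (\int[mu]_x ((f x ^+ 2)%:E + (g x ^+ 2)%:E))%E).
  apply: ge0_le_integral => //.
  - by apply/measurable_EFinP/measurableT_comp => //; exact: measurable_funM.
  - by apply: emeasurable_funD; apply/measurable_EFinP; exact: measurable_funX.
  - move=> x _; rewrite -EFinD lee_fin normrM -(real_normK (num_real (f x))).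
    rewrite -(real_normK (num_real (g x))).
    by have := normr_ge0 (f x); have := normr_ge0 (g x); nra.
rewrite ge0_integralD//; first exact: lte_add_pinfty.
- by move=> x _; rewrite lee_fin sqr_ge0.
- by apply/measurable_EFinP; exact: measurable_funX.
- by move=> x _; rewrite lee_fin sqr_ge0.
- by apply/measurable_EFinP; exact: measurable_funX.
Qed.

Lemma sqint_bounded f (A : set T) (M : R) : measurable_fun setT f -> measurable A ->
  (mu A < +oo)%E -> (forall x, `|f x| <= M) -> (forall x, ~ A x -> f x = 0) -> sqint f.
Proof.
move=> mf mA muA fM f0; apply: (@le_lt_trans _ _ (\int[mu]_x ((M ^+ 2)%:E * (\1_A x)%:E))%E).
  apply: ge0_le_integral => //.
  - by move=> x _; rewrite lee_fin sqr_ge0.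
  - by apply/measurable_EFinP; exact: measurable_funX.
  - by apply: emeasurable_funM => //; apply/measurable_EFinP; exact: measurable_indic.
  - move=> x _; rewrite -EFinM lee_fin indicE; have [Ax|nAx] := pselect (A x).
      by rewrite mem_set// mulr1 -(real_normK (num_real (f x))) lerXn2r// ?nnegrE// (le_trans _ (fM x)).
    by rewrite memNset// f0// expr0n mulr0.
rewrite ge0_integralZl//.
- rewrite integral_indic// setIT lte_mul_pinfty ?lee_fin ?sqr_ge0//.
- by apply/measurable_EFinP; exact: measurable_indic.
- by rewrite lee_fin sqr_ge0.
Qed.

Lemma ae_lty_of_integral (f : T -> \bar R) : measurable_fun setT f -> (forall x, 0 <= f x)%E ->
  (\int[mu]_x f x < +oo)%E -> {ae mu, forall x, (f x < +oo)%E}.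
Proof.
move=> mf f0 fi.
have /(integrable_ae measurableT) : mu.-integrable setT f.
  apply/integrableP; split => //.
  by under eq_integral do rewrite gee0_abs//.
by apply: filterS => x /(_ I) /fin_numPlt/andP[].
Qed.

Lemma ae_eq0_of_integral (f : T -> \bar R) : measurable_fun setT f -> (forall x, 0 <= f x)%E ->
  (\int[mu]_x f x = 0)%E -> {ae mu, forall x, f x = 0%E}.
Proof.
move=> mf f0 If; have /(ae_eq_integral_abs mu measurableT mf) : (\int[mu]_x `|f x| = 0)%E.
  by rewrite -[RHS]If; apply: eq_integral => x _; rewrite gee0_abs.
by apply: filterS => x; apply.
Qed.

Lemma aeS (P Q : set T) : {ae mu, forall x, P x} -> (forall x, P x -> Q x) ->
  {ae mu, forall x, Q x}.
Proof. by move=> + PQ; apply: filterS. Qed.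

Lemma ae_eqS (f g : T -> \bar R) (P : set T) : {ae mu, forall x, P x} ->
  (forall x, P x -> f x = g x) -> ae_eq mu setT f g.
Proof. by move=> + Pfg; apply: filterS => x /Pfg. Qed.

Lemma ae_eq_integrable (f g : T -> \bar R) : measurable_fun setT f ->
  mu.-integrable setT g -> ae_eq mu setT f g -> mu.-integrable setT f.
Proof.
move=> mf /integrableP[mg ig] fg; apply/integrableP; split => //.
rewrite (ge0_ae_eq_integral (g := fun x => `|g x|%E))//.
- exact: measurableT_comp.
- exact: measurableT_comp.
- by apply: filterS fg => x + Tx => /(_ Tx) ->.
Qed.

End square_integrable.

Section lines.
Variable R : realType.
Local Notation l := (@lebesgue_measure R).
Implicit Types (e x : space4 R) (w g : space4 R -> R).

Lemma tonelli5' (f : spacetime R -> \bar R) :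
  measurable_fun setT f -> (forall z, 0 <= f z)%E ->
  (\int[leb5]_z f z = \int[leb4]_x \int[l]_t f (x, t))%E.
Proof. by move=> mf f0; rewrite leb5E leb4E; exact: (fubini_tonelli1 f). Qed.

Lemma fubini5' (f : spacetime R -> \bar R) :
  leb5.-integrable setT f ->
  (\int[leb5]_z f z = \int[leb4]_x \int[l]_t f (x, t))%E.
Proof. by rewrite leb5E leb4E => fi; apply/esym; exact: integral12_prod_meas1. Qed.

Lemma integral_leb4_shift (a : space4 R) (f : space4 R -> \bar R) :
  measurable_fun setT f -> (\int[leb4]_x f (x + a)%R = \int[leb4]_x f x)%E.
Proof.
move=> mf; rewrite integralE [RHS]integralE; congr (_ - _)%E.
- rewrite -(ge0_integral_leb4_shift a (measurable_funepos mf) (funepos_ge0 f)).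
  by apply: eq_integral => x _; rewrite !funeposE.
- rewrite -(ge0_integral_leb4_shift a (measurable_funeneg mf) (funeneg_ge0 f)).
  by apply: eq_integral => x _; rewrite !funenegE.
Qed.

(** The factor c takes the values 1, 0 and -1 below, so that forward moving, fixed and backward
    moving arguments are treated alike. *)
Lemma measurable_line (c : R) e :
  measurable_fun setT (fun z : spacetime R => z.1 + (c * z.2) *: e).
Proof.
have m0 (i : spacetime R -> R) (b : R) : measurable_fun setT i ->
    measurable_fun setT (fun z : spacetime R => i z + (c * z.2) * b).
  by move=> mi; apply: measurable_funD => //; do 2 apply: measurable_funM => //.
apply: measurable_fun_pair; last by apply: (m0 (fun z => z.1.2)); measurable_proj.
apply: measurable_fun_pair; last by apply: (m0 (fun z => z.1.1.2)); measurable_proj.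
apply: measurable_fun_pair; last by apply: (m0 (fun z => z.1.1.1.2)); measurable_proj.
by apply: (m0 (fun z => z.1.1.1.1)); measurable_proj.
Qed.

Lemma measurable_window (h : R) :
  measurable_fun setT (fun z : spacetime R => \1_(`[0, h]%classic) z.2 : R).
Proof. exact: measurableT_comp (measurable_indic _) measurable_snd. Qed.

Lemma sqint_line (c h : R) e g : measurable_fun setT g -> sqint leb4 g ->
  sqint leb5 (fun z => g (z.1 + (c * z.2) *: e) * \1_(`[0, h]%classic) z.2).
Proof.
move=> mg sg.
have m2 : measurable_fun setT (fun x => (g x ^+ 2)%:E).
  by apply/measurable_EFinP; exact: measurable_funX.
have p2 x : (0 <= (g x ^+ 2)%:E)%E by rewrite lee_fin sqr_ge0.
have E t : (\int[leb4]_x ((g (x + (c * t) *: e) * \1_(`[0, h]%classic) t) ^+ 2)%:E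
    = (\1_(`[0, h]%classic) t)%:E * \int[leb4]_x (g x ^+ 2)%:E)%E.
  rewrite -(ge0_integral_leb4_shift ((c * t) *: e) m2 p2) -ge0_integralZl//.
    by apply: eq_integral => x _; rewrite -EFinM exprMn mulrC indicE; case: (_ \in _); rewrite ?expr1n ?expr0n.
  apply: (measurableT_comp m2).
  exact: (measurableT_comp (measurable_line c e) (pair2_measurable t)).
rewrite /sqint tonelli5//.
- rewrite [ltLHS](_ : _ = \int[l]_t ((\1_(`[0, h]%classic) t)%:E * \int[leb4]_x (g x ^+ 2)%:E))%E.
    rewrite ge0_integralZr//.
    + rewrite integral_indic// setIT; apply: lte_mul_pinfty => //.
      by rewrite ge0_fin_numE//= lebesgue_measure_itv/=; case: ifP; rewrite ?ltry.
    + by apply/measurable_EFinP; exact: measurable_indic.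
    + by apply: integral_ge0 => x _.
  by apply: eq_integral => t _; exact: E.
- apply/measurable_EFinP; apply: measurable_funX; apply: measurable_funM.
    exact: measurableT_comp mg (measurable_line c e).
  exact: measurable_window.
- by move=> z; rewrite lee_fin sqr_ge0.
Qed.

Lemma integral_reflected_window (c r : R) : 0 <= r ->
  (\int[l]_s (\1_(`](- r)%R, r[%classic) (c - s)%R)%:E <= (r *+ 2)%:E)%E.
Proof.
move=> r0; have -> : (\int[l]_s (\1_(`](- r)%R, r[%classic) (c - s)%R)%:E =
    \int[l]_s (\1_(`](c - r)%R, (c + r)%R[%classic) s)%:E)%E.
  apply: eq_integral => s _; rewrite !indicE; congr (_%:R%:E); congr nat_of_bool.
  by apply/idP/idP; rewrite !inE/= !in_itv/= => /andP[? ?]; apply/andP; split; lra.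
rewrite integral_indic ?setIT; [|exact: measurableT|exact: measurable_itv].
have := lebesgue_measure_itv `](c - r)%R, (c + r)%R[; rewrite /= => ->; case: ifP => _.
  by rewrite -EFinB lee_fin mulr2n; lra.
by rewrite lee_fin mulrn_wge0.
Qed.

(** Integrating over all base points would count each line infinitely often, so base points are
    first confined to a strip |c x| < n, with [c] the coordinate along e. Tonelli and a translation
    by s e move the constraint onto the parameter s, whose window has length 2 n. *)
Lemma ae_sqint_on_lines e (c : space4 R -> R) g :
  measurable_fun setT c -> (forall x (s : R), c (x + s *: e) = c x + s) ->
  measurable_fun setT g -> sqint leb4 g ->
  {ae leb4, forall x, (\int[l]_s (g (x + s *: e) ^+ 2)%:E < +oo)%E}.
Proof.
move=> mc cD mg sg.
have m2 : measurable_fun setT (fun x => (g x ^+ 2)%:E).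
  by apply/measurable_EFinP; exact: measurable_funX.
have p2 x : (0 <= (g x ^+ 2)%:E)%E by rewrite lee_fin sqr_ge0.
have mL : measurable_fun setT (fun z : spacetime R => (g (z.1 + z.2 *: e) ^+ 2)%:E).
  have := measurableT_comp m2 (measurable_line 1 e).
  by apply: eq_measurable_fun => z _ /=; rewrite mul1r.
pose I n : set R := `](- n%:R)%R, n%:R[%classic.
have mI n : measurable_fun setT (\1_(I n) : measurableTypeR R -> R).
  by apply: measurable_indic; exact: measurable_itv.
suff H n : {ae leb4, forall x, I n (c x) -> (\int[l]_s (g (x + s *: e) ^+ 2)%:E < +oo)%E}.
  have := ae_foralln H; apply: filterS => x Hx.
  have [n _ In] : (\bigcup_n I n) (c x) by rewrite itv_oo_cover.
  exact: Hx In.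
pose F (z : spacetime R) := ((\1_(I n) (c z.1))%:E * (g (z.1 + z.2 *: e) ^+ 2)%:E)%E.
have mF : measurable_fun setT F.
  apply: emeasurable_funM => //; apply/measurable_EFinP.
  exact: measurableT_comp (mI n) (measurableT_comp mc measurable_fst).
have F0 z : (0 <= F z)%E by rewrite mule_ge0// lee_fin ?sqr_ge0.
have : (\int[leb4]_x \int[l]_s F (x, s) < +oo)%E.
  rewrite -tonelli5'// tonelli5//.
  have -> : (\int[l]_t \int[leb4]_x F (x, t) = \int[l]_t \int[leb4]_x
      ((\1_(I n) (c x - t))%:E * (g x ^+ 2)%:E))%E.
    apply: eq_integral => t _.
    rewrite -(ge0_integral_leb4_shift (t *: e) (f := fun x => ((\1_(I n) (c x - t))%:E * (g x ^+ 2)%:E)%E)).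
    - by apply: eq_integral => x _; rewrite /F/= cD addrK.
    - apply: emeasurable_funM => //; apply/measurable_EFinP.
      apply: (measurableT_comp (mI n)); exact: measurable_funB.
    - by move=> x; rewrite mule_ge0.
  have mF' : measurable_fun setT (fun z : spacetime R => ((\1_(I n) (c z.1 - z.2))%:E * (g z.1 ^+ 2)%:E)%E).
    apply: emeasurable_funM; last exact: measurableT_comp m2 measurable_fst.
    apply/measurable_EFinP; apply: (measurableT_comp (mI n)).
    by apply: measurable_funB; [exact: measurableT_comp mc measurable_fst|exact: measurable_snd].
  rewrite -(tonelli5 mF'); last by move=> z; rewrite mule_ge0.
  rewrite tonelli5'//; last by move=> z; rewrite mule_ge0.
  apply: (@le_lt_trans _ _ (\int[leb4]_x ((n%:R *+ 2)%:E * (g x ^+ 2)%:E))%E).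
    apply: ge0_le_integral => //.
    + by move=> x _; apply: integral_ge0 => s _; rewrite mule_ge0.
    + apply: (measurable_partial_integral mF') => x s; by rewrite mule_ge0.
    + by apply: emeasurable_funM.
    + move=> x _ /=; rewrite ge0_integralZr//; last first.
        apply/measurable_EFinP; apply: (measurableT_comp (mI n)); exact: measurable_funB.
      apply: lee_wpmul2r => //.
      exact: integral_reflected_window.
  rewrite ge0_integralZl// ?lee_fin ?mulrn_wge0//.
  by apply: lte_mul_pinfty => //; rewrite lee_fin mulrn_wge0.
have mFx : measurable_fun setT (fun x => \int[l]_s F (x, s))%E.
  apply: measurable_partial_integral => [|x s]; last exact: F0.
  by apply: eq_measurable_fun mF => -[].
move=> /(ae_lty_of_integral mFx (fun x => integral_ge0 _ (fun s _ => F0 (x, s)))).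
apply: filterS => x + Ix; rewrite /F/= indicE mem_set//.
by under eq_integral do rewrite mul1e.
Qed.

End lines.

Section test_square_integrable.
Variable R : realType.
Implicit Types eta : space4 R -> R.

Lemma compact_sub_box4 (K : set (space4 R)) : compact K ->
  exists n : nat, K `<=` box4 (cst4 (- n%:R)) (cst4 n%:R).
Proof.
move=> cK; have cK0 : compact (K `*` [set (0 : R)] : set (spacetime R)).
  by apply: compact_setX => //; exact: compact_set1.
have [n Kn] := compact_sub_box5 cK0; exists n => x Kx.
by have [] : box5 (cst5 (- n%:R)) (cst5 n%:R) (x, 0 : R) by exact: Kn.
Qed.

Lemma sqint_compact_support (f : space4 R -> R) (K : set (space4 R)) M :
  continuous f -> compact K -> (forall x, `|f x| <= M) -> (forall x, ~ K x -> f x = 0) ->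
  sqint leb4 f.
Proof.
move=> cf cK fM f0; have [n Kn] := compact_sub_box4 cK.
apply: (sqint_bounded (continuous4_measurable cf) (measurable_box4 (cst4 (- n%:R)) (cst4 n%:R))
  (leb4_box4_lty _ _) fM).
by move=> x nx; apply: f0 => /Kn.
Qed.

Lemma sqint_test eta : test_function eta -> sqint leb4 eta.
Proof.
move=> teta; have [M etaM] := test_function_bounded teta; have [Ceta seta] := teta.
apply: (sqint_compact_support (Ceta 0%N) seta etaM) => x nx.
by apply/eqP; apply: contrapT => /negP fx; apply: nx; exact: subset_closure.
Qed.

Lemma sqint_derive_test eta (e : space4 R) : test_function eta -> sqint leb4 ('D_e eta).
Proof.
move=> teta; have [M etaM] := derive_test_bounded e teta; have [Ceta seta] := teta.
have [_ /(_ e) cD] := Ceta 1%N.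
by apply: (sqint_compact_support cD seta etaM) => x; exact: derive_eq0_off_support.
Qed.

Lemma measurable_test eta : test_function eta -> measurable_fun setT eta.
Proof. by move=> [Ceta _]; apply: continuous4_measurable; exact: (Ceta 0%N). Qed.

Lemma measurable_derive_test eta (e : space4 R) : test_function eta ->
  measurable_fun setT ('D_e eta).
Proof. by move=> [/(_ 1%N)[_ /(_ e) cD] _]; exact: continuous4_measurable. Qed.

Lemma derive_shift (f : space4 R -> R) (c e x : space4 R) :
  'D_e (fun y => f (y + c)) x = 'D_e f (x + c).
Proof.
rewrite /derive; apply: (congr1 (fun F : R -> R => lim (F @ 0^'))); apply/funext => h.
by congr (_ *: (f _ - _)) => /=; rewrite addrA.
Qed.

End test_square_integrable.

Lemma FTC_line_backward (R : realType) (V : normedModType R) (f : V -> R) (e : V) x (h : R) :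
  Cn 1 f -> 0 < h ->
  \int[lebesgue_measure]_(s in `[0, h]) 'D_e f (x - s *: e) = f x - f (x - h *: e).
Proof.
move=> Cf h0; have := FTC_line (- e) Cf x h0.
rewrite scalerN -[X in X = _ -> _]opprK => /eqP; rewrite eqr_oppLR opprB => /eqP <-.
have DN y : 'D_(- e) f y = - 'D_e f y.
  by have [df _] := Cf; rewrite !deriveE// linearN.
rewrite -mulN1r -RintegralZl//.
  by apply: eq_Rintegral => s _; rewrite mulN1r DN opprK scalerN.
apply: continuous_compact_integrable; first exact: segment_compact.
apply: continuous_subspaceT => s.
apply: (@continuous_comp _ _ _ (fun s : R => x + s *: (- e)) ('D_(- e) f)).
  by apply: cvgD; [exact: cvg_cst|exact: scalel_continuous].
exact: continuous_derive.
Qed.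

(** * The fundamental lemma of the calculus of variations, with bumps as test functions *)

Section fundamental_lemma.
Variables (R : realType) (W : space4 R -> R).
Hypotheses (mW : measurable_fun setT W)
  (iW : forall a b : space4 R, leb4.-integrable setT (fun x => (W x * \1_(box4 a b) x)%:E))
  (W0 : forall (a b : space4 R) n, (\int[leb4]_x (W x * bump4 a b n x)%:E = 0)%E).

Let integral_box (a b : space4 R) : (\int[leb4]_x (W x * \1_(box4 a b) x)%:E = 0)%E.
Proof.
have iab := iW a b; have mab := measurable_int _ iab.
have mb n : measurable_fun setT (fun x => (W x * bump4 a b n x)%:E).
  apply/measurable_EFinP; apply: measurable_funM => //.
  exact: measurable_test (test_function_bump4 a b n).
have cvgb x : (fun n => (W x * bump4 a b n x)%:E) @ \oo --> (W x * \1_(box4 a b) x)%:E.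
  by apply/cvg_EFin; [exact: nearW|apply: cvgM; [exact: cvg_cst|exact: cvg_bump4]].
have dom x n : (`|(W x * bump4 a b n x)%:E| <= `|(W x * \1_(box4 a b) x)%:E|)%E.
  have [abx|nabx] := pselect (box4 a b x); last by rewrite bump4_eq0// mulr0 abse0.
  have := bump4_le1 a b n x; have := bump4_ge0 a b n x; move: (bump4 a b n x) => y y0 y1.
  by rewrite indicE mem_set// mulr1 !abse_EFin lee_fin normrM (ger0_norm y0) ler_piMr.
have [_ _] := dominated_convergence measurableT mb mab (aeW _ (fun x _ => cvgb x))
  (integrable_abse iab) (aeW _ (fun x n _ => dom x n)).
move=> /cvg_lim <-//; apply/esym.
by under eq_fun do rewrite W0; rewrite lim_cst.
Qed.

(** Bumps tend to indicators of boxes, so the integrals of W over boxes vanish. Boxes form a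
    pi-system generating the Borel sets, and Dynkin's argument, run inside one large box to keep W
    integrable, reaches all measurable sets. *)
Lemma ae_eq0_of_bumps : {ae leb4, forall x, W x = 0}.
Proof.
suff H n : {ae leb4, forall x, box4 (cst4 (- n%:R)) (cst4 n%:R) x -> W x = 0}.
  have := ae_foralln H; apply: filterS => x Hx.
  have [n _ nx] : (\bigcup_n box4 (cst4 (- n%:R)) (cst4 n%:R)) x by rewrite box4_cover.
  exact: Hx nx.
set D := box4 _ _; pose f x := (W x * \1_D x)%:E.
have fi : leb4.-integrable setT f by exact: iW.
have fS A : measurable A -> leb4.-integrable A f.
  by move=> mA; exact: (integrableS measurableT).
have f0 A : measurable A -> (\int[leb4]_(x in A) f x = 0)%E.
  rewrite measurable_box4E.
  apply: (@dynkin_induction _ _ (@boxes4 R) (fun A => \int[leb4]_(x in A) f x = 0)%E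
    (@measurable_box4E R)).
  - exact: setI_closed_boxes4.
  - exact: integral_box.
  - move=> _ [a [b ->]]; rewrite integral_mkcond.
    have [c [d cd]] := box4I a b (cst4 (- n%:R)) (cst4 n%:R).
    rewrite -[RHS](integral_box c d) -cd; apply: eq_integral => x _.
    rewrite patchE /f [in RHS]indicE in_setI indicE /D.
    by case: (x \in box4 a b) => //=; rewrite mulr0.
  - move=> S mS S0; have := @integral_setU _ _ _ leb4 S (~` S) f mS (measurableC mS).
    rewrite setUCr S0 add0e => <-; [exact: integral_box|exact: measurable_int fi|].
    by apply/eqP; rewrite setICr.
  - move=> F mF tF F0; rewrite integral_bigcup//; last by apply: fS; exact: bigcup_measurable.
    by rewrite eseries0// => k _ _; exact: F0.
have : ae_eq leb4 setT f (cst 0%E).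
  apply: integral_ae_eq => // E _ mE; rewrite f0// integral0//.
apply: filterS => x /(_ I); rewrite /f indicE => + Dx.
by rewrite mem_set// mulr1 => -[].
Qed.

End fundamental_lemma.

(** * From weak derivatives to increments along almost every line *)

Section weak_derivative_on_lines.
Variable R : realType.
Local Notation l := (@lebesgue_measure R).
Variables (e : space4 R) (w g : space4 R -> R).
Hypotheses (mw : measurable_fun setT w) (mg : measurable_fun setT g)
  (sw : sqint leb4 w) (sg : sqint leb4 g).

(** The interval enters as a factor on the whole line, which makes joint measurability in x and h
    accessible to Tonelli. In the sign convention of this section g is minus the derivative of w
    along e, so this is the decrement of w from x to x + h e. *)
Definition primitive_on_line (x : space4 R) (h : R) : R :=
  \int[l]_s (g (x + s *: e) * \1_(`[0, h]%classic) s).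

Lemma measurable_integral_on_line (f : space4 R -> measurableTypeR R -> measurableTypeR R -> R) :
  measurable_fun setT (fun z : spacetime R * measurableTypeR R => f z.1.1 z.1.2 z.2) ->
  measurable_fun setT (fun z : spacetime R => \int[l]_s f z.1 z.2 s).
Proof.
move=> mf; apply: measurableT_comp; first exact: fine_measurable.
have mf' : measurable_fun setT
    (fun p : spacetime R * measurableTypeR R => (f p.1.1 p.1.2 p.2)%:E).
  exact/measurable_EFinP.
under eq_fun do rewrite integralE.
apply: emeasurable_funB.
- apply: measurable_partial_integral => [|z s]; last exact: funepos_ge0.
  have := measurable_funepos mf'; apply: eq_measurable_fun => p _.
  by rewrite !funeposE.
- apply: measurable_partial_integral => [|z s]; last exact: funeneg_ge0.
  have := measurable_funeneg mf'; apply: eq_measurable_fun => p _.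
  by rewrite !funenegE.
Qed.

Lemma measurable_primitive_on_line :
  measurable_fun setT (fun z : spacetime R => primitive_on_line z.1 z.2).
Proof.
apply: (@measurable_integral_on_line
  (fun x h s => g (x + s *: e) * \1_(`[0, h]%classic) s)).
apply: measurable_funM.
  have := measurableT_comp mg (measurable_line 1 e).
  set G := (g \o _) => mG.
  have mp : measurable_fun setT
    (fun p : spacetime R * measurableTypeR R => ((p.1.1, p.2) : spacetime R)).
    by measurable_proj.
  by have := measurableT_comp mG mp; apply: eq_measurable_fun => p _; rewrite /G/= mul1r.
have mA : measurable [set p : spacetime R * measurableTypeR R | 0 <= p.2 <= p.1.2].
  have -> : [set p : spacetime R * measurableTypeR R | 0 <= p.2 <= p.1.2] =
      (setT `&` [set p | 0 <= p.2]) `&` (setT `&` [set p | p.2 <= p.1.2]).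
    by rewrite !setTI; apply/seteqP; split => p /= => [/andP[]|[-> ->]].
  by apply: measurableI; apply: measurable_fun_le => //; measurable_proj.
rewrite [X in measurable_fun _ X](_ : _ =
    \1_[set p : spacetime R * measurableTypeR R | 0 <= p.2 <= p.1.2]).
  exact: measurable_indic.
apply/funext => p.
by rewrite !indicE; congr (_%:R); congr nat_of_bool; apply/idP/idP; rewrite !inE/= in_itv.
Qed.

Let P (c h : R) (f : space4 R -> R) (z : spacetime R) : R :=
  f (z.1 + (c * z.2) *: e) * \1_(`[0, h]%classic) z.2.

Let mP c h f : measurable_fun setT f -> measurable_fun setT (P c h f).
Proof.
move=> mf; apply: measurable_funM; last exact: measurable_window.
exact: measurableT_comp mf (measurable_line c e).
Qed.

Lemma sqint_window (h : R) : sqint l (\1_(`[0, h]%classic) : measurableTypeR R -> R).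
Proof.
rewrite /sqint; have -> : (\int[l]_s ((\1_(`[0%R, h]%classic) s ^+ 2)%:E) =
    \int[l]_s ((\1_(`[0%R, h]%classic) s)%:E))%E.
  by apply: eq_integral => s _; rewrite indicE; case: (_ \in _); rewrite ?expr1n ?expr0n.
rewrite integral_indic ?setIT; [|exact: measurableT|exact: measurable_itv].
by have := lebesgue_measure_itv `[0, h]; rewrite /= => ->; case: ifP; rewrite ?ltry.
Qed.

Lemma ae_integrable_on_line (h : R) : {ae leb4, forall x,
  l.-integrable setT (fun s => (g (x + s *: e) * \1_(`[0, h]%classic) s)%:E)}.
Proof.
have m2 : measurable_fun setT (fun z => (P 1 h g z ^+ 2)%:E).
  by apply/measurable_EFinP; apply: measurable_funX; exact: mP.
have p2 z : (0 <= (P 1 h g z ^+ 2)%:E)%E by rewrite lee_fin sqr_ge0.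
have := sqint_line 1 h e mg sg; rewrite /sqint tonelli5'// => fin.
have mFx : measurable_fun setT (fun x => \int[l]_s (P 1 h g (x, s) ^+ 2)%:E)%E.
  apply: measurable_partial_integral => [|x s]; last exact: p2.
  by apply: eq_measurable_fun m2 => -[].
have := ae_lty_of_integral mFx (fun x => integral_ge0 _ (fun s _ => p2 (x, s))) fin.
apply: filterS => x fx.
have mk : measurable_fun setT (fun s : measurableTypeR R => P 1 h g (x, s)).
  exact: measurableT_comp (mP 1 h mg) (pair1_measurable x).
have mi : measurable_fun setT (\1_(`[0, h]%classic) : measurableTypeR R -> R).
  by apply: measurable_indic; exact: measurable_itv.
have := integrable_sqM mk mi fx (sqint_window h); apply: eq_integrable => // s _.
by rewrite /P/= mul1r -mulrA indic_idem.
Qed.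

(** The indicator of the window is idempotent, so it can be given to both factors; each is then
    square integrable on space-time and Fubini applies to the product. *)
Lemma primitive_fubini (h : R) (q : space4 R -> R) : measurable_fun setT q -> sqint leb4 q ->
  leb4.-integrable setT (fun x => (primitive_on_line x h * q x)%:E) /\
  (\int[leb4]_x (primitive_on_line x h * q x)%:E
    = \int[leb5]_z (P 1 h g z * P 0 h q z)%:E)%E.
Proof.
move=> mq sq.
have iF : leb5.-integrable setT (fun z => (P 1 h g z * P 0 h q z)%:E).
  by apply: integrable_sqM; [exact: mP|exact: mP|exact: sqint_line|exact: sqint_line].
have mpq : measurable_fun setT (fun x => (primitive_on_line x h * q x)%:E).
  apply/measurable_EFinP; apply: measurable_funM => //.
  exact: measurableT_comp measurable_primitive_on_line (pair2_measurable h).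
have iFx : leb4.-integrable setT (fun x => \int[l]_s (P 1 h g (x, s) * P 0 h q (x, s))%:E)%E.
  by move: iF; rewrite leb5E leb4E; exact: integrable_fubini_F.
have ae : ae_eq leb4 setT (fun x => (primitive_on_line x h * q x)%:E)
    (fun x => \int[l]_s (P 1 h g (x, s) * P 0 h q (x, s))%:E)%E.
  apply: (ae_eqS (ae_integrable_on_line h)) => x ix.
  transitivity (\int[l]_s ((q x)%:E * (g (x + s *: e) * \1_(`[0, h]%classic) s)%:E))%E.
    rewrite integralZl// mulrC EFinM /primitive_on_line /Rintegral fineK//.
    exact: integrable_fin_num.
  apply: eq_integral => s _; rewrite -EFinM /P/= mul0r scale0r addr0 mul1r.
  congr EFin; rewrite mulrC -!mulrA; congr (_ * _); rewrite mulrCA indic_idem.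
  by rewrite mulrC.
split; first exact: ae_eq_integrable mpq iFx ae.
rewrite fubini5'//; apply: ae_eq_integral => //; exact: measurable_int iFx.
Qed.

Lemma sqint_shift (c : space4 R) (f : space4 R -> R) : measurable_fun setT f ->
  sqint leb4 f -> measurable_fun setT (fun x : space4 R => f (x + c)) /\
  sqint leb4 (fun x => f (x + c)).
Proof.
move=> mf sf; split.
  have := measurableT_comp (measurableT_comp mf (measurable_line 1 c)) (pair2_measurable (1 : R)).
  by apply: eq_measurable_fun => x _ /=; rewrite mulr1 scale1r.
rewrite /sqint (ge0_integral_leb4_shift c (f := fun x => (f x ^+ 2)%:E))//.
  by apply/measurable_EFinP; exact: measurable_funX.
by move=> x; rewrite lee_fin sqr_ge0.
Qed.

Lemma integral_derive_backward (eta : space4 R -> R) (x : space4 R) (r h : R) :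
  Cn 1 eta -> 0 < h ->
  (\int[l]_s (r * ('D_e eta (x - s *: e) * \1_(`[0%R, h]%classic) s))%:E
    = (r * (eta x - eta (x - h *: e))%R)%:E)%E.
Proof.
move=> Ceta h0.
have cD : continuous (fun s : R => 'D_e eta (x - s *: e)).
  move=> s; apply: (@continuous_comp _ _ _ (fun s : R => x - s *: e) ('D_e eta)).
    apply: cvgB; first exact: cvg_cst.
    exact: scalel_continuous.
  exact: continuous_derive.
have iD : l.-integrable `[0, h]%classic (EFin \o (fun s : R => 'D_e eta (x - s *: e))).
  apply: continuous_compact_integrable; first exact: segment_compact.
  exact: continuous_subspaceT.
rewrite -(FTC_line_backward e x Ceta h0) /Rintegral EFinM fineK; last first.
  exact: (integrable_fin_num _ iD).
rewrite -integralZl// integral_mkcond; apply: eq_integral => s _.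
rewrite patchE indicE; case: ifPn => _; first by rewrite mulr1 EFinM.
by rewrite !mulr0.
Qed.

Hypothesis weak : forall (a b : space4 R) n,
  (\int[leb4]_x (w x * 'D_e (bump4 a b n) x)%:E = \int[leb4]_x (g x * bump4 a b n x)%:E)%E.

(** For fixed t, a change of variable turns the integral of g(x + t e) eta(x) into that of g against
    the bump eta(. - t e), to which the hypothesis applies. Integrating t over [0, h] leaves w
    against eta(x) - eta(x - h e), and shifting back moves the difference onto w. *)
Let weak_line_bump (h : R) (a b : space4 R) n : 0 < h ->
  (\int[leb4]_x ((w x - w (x + h *: e)) * bump4 a b n x)%:E
   = \int[leb4]_x (primitive_on_line x h * bump4 a b n x)%:E)%E.
Proof.
move=> h0; have teta := test_function_bump4 a b n.
set eta := bump4 a b n in teta *.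
have [seta sDeta] := (sqint_test teta, sqint_derive_test e teta).
have [meta mDeta] := (measurable_test teta, measurable_derive_test e teta).
rewrite (primitive_fubini h meta seta).2.
have iF1 : leb5.-integrable setT (fun z => (P 0 h w z * P (-1) h ('D_e eta) z)%:E).
  by apply: integrable_sqM; [exact: mP|exact: mP|exact: sqint_line|exact: sqint_line].
have iF2 : leb5.-integrable setT (fun z => (P 1 h g z * P 0 h eta z)%:E).
  by apply: integrable_sqM; [exact: mP|exact: mP|exact: sqint_line|exact: sqint_line].
pose i t : R := \1_(`[0, h]%classic) t.
have S1 x t : P 0 h w (x, t) * P (-1) h ('D_e eta) (x, t) = w x * ('D_e eta (x - t *: e) * i t).
  by rewrite /P/= mul0r scale0r addr0 mulN1r scaleNr mulrACA indic_idem -mulrA.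
have S2 x t : P 1 h g (x, t) * P 0 h eta (x, t) = (g (x + t *: e) * eta x) * i t.
  by rewrite /P/= mul0r scale0r addr0 mul1r mulrACA indic_idem.
transitivity (\int[leb5]_z (P 0 h w z * P (-1) h ('D_e eta) z)%:E)%E; last first.
  rewrite (fubini5 iF1) (fubini5 iF2); apply: eq_integral => t _.
  transitivity (\int[leb4]_x (w x * ('D_e eta (x - t *: e) * i t))%:E)%E.
    by apply: eq_integral => x _; rewrite S1.
  transitivity (\int[leb4]_x (g (x + t *: e) * eta x * i t)%:E)%E; last first.
    by apply: eq_integral => x _; rewrite S2.
  (* Outside the window both sides vanish; inside it the hypothesis is applied to the shifted
     bump. *)
  have [it|it] : i t = 1 \/ i t = 0.
  - by rewrite /i indicE; case: (_ \in _); [left|right].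
  - transitivity (\int[leb4]_x (w x * 'D_e (bump4 (a + t *: e) (b + t *: e) n) x)%:E)%E.
      apply: eq_integral => x _; rewrite it mulr1; congr (_ * _)%:E.
      rewrite -derive_shift; congr ('D_e _ x); apply/funext => y.
      by rewrite /eta bump4_shift !opprK.
    rewrite weak -(integral_leb4_shift (t *: e)).
      by apply: eq_integral => x _; rewrite it mulr1 bump4_shift !addrK.
    apply/measurable_EFinP; apply: measurable_funM => //.
    exact: measurable_test (test_function_bump4 _ _ _).
  - by apply: eq_integral => x _; rewrite it !mulr0.
have [mw' sw'] := sqint_shift (h *: e) mw sw.
have [meta' seta'] := sqint_shift (- (h *: e)) meta seta.
rewrite (fubini5' iF1); transitivity (\int[leb4]_x (w x * (eta x - eta (x - h *: e)))%:E)%E.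
  transitivity (\int[leb4]_x (w x * eta x)%:E - \int[leb4]_x (w (x + h *: e) * eta x)%:E)%E.
    rewrite -integralB//; [|exact: integrable_sqM|exact: integrable_sqM].
    by apply: eq_integral => x _; rewrite -EFinB -mulrBl.
  rewrite -[X in (_ - X)%E](integral_leb4_shift (- (h *: e))).
    under [X in (_ - X)%E]eq_integral do rewrite subrK.
    rewrite -integralB//; [|exact: integrable_sqM|exact: integrable_sqM].
    by apply: eq_integral => x _; rewrite -EFinB -mulrBr.
  by apply/measurable_EFinP; exact: measurable_funM.
apply: eq_integral => x _; have [/(_ 1%N) Ceta _] := teta.
apply: etrans (esym (integral_derive_backward x (w x) Ceta h0)) _.
by apply: eq_integral => s _; rewrite S1.
Qed.

Lemma weak_derivative_ae (h : R) : 0 < h ->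
  {ae leb4, forall x, w x - w (x + h *: e) = primitive_on_line x h}.
Proof.
move=> h0; have [mw' sw'] := sqint_shift (h *: e) mw sw.
have mp : measurable_fun setT (fun x => primitive_on_line x h).
  exact: measurableT_comp measurable_primitive_on_line (pair2_measurable h).
pose W x := w x - w (x + h *: e) - primitive_on_line x h.
have mdw : measurable_fun setT (fun x => w x - w (x + h *: e)) by exact: measurable_funB.
have iW (q : space4 R -> R) : measurable_fun setT q -> sqint leb4 q ->
    leb4.-integrable setT (fun x => ((w x - w (x + h *: e)) * q x)%:E).
  move=> mq sq; have := integrableB measurableT (integrable_sqM mw mq sw sq)
    (integrable_sqM mw' mq sw' sq).
  by apply: eq_integrable => // x _; rewrite mulrBl.
suff : {ae leb4, forall x, W x = 0} by apply: filterS => x /subr0_eq.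
apply: ae_eq0_of_bumps.
- exact: measurable_funB.
- move=> a b; have mb : measurable_fun setT (\1_(box4 a b) : space4 R -> R).
    by apply: measurable_indic; exact: measurable_box4.
  have sb : sqint leb4 (\1_(box4 a b) : space4 R -> R).
    apply: (sqint_bounded (A := box4 a b) (M := 1)) => //; first exact: measurable_box4.
    - exact: leb4_box4_lty.
    - by move=> x; rewrite indicE; case: (_ \in _); rewrite ?normr1 ?normr0.
    - by move=> x nx; rewrite indicE memNset.
  have := integrableB measurableT (iW _ mb sb) (primitive_fubini h mb sb).1.
  by apply: eq_integrable => // x _; rewrite -EFinB -mulrBl.
- move=> a b n; have teta := test_function_bump4 a b n.
  have [seta meta] := (sqint_test teta, measurable_test teta).
  under eq_integral do rewrite mulrBl EFinB.
  rewrite integralB//; [|exact: iW|exact: (primitive_fubini h meta seta).1].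
  rewrite weak_line_bump// subee//.
  exact: integrable_fin_num (primitive_fubini h meta seta).1.
Qed.

(** For each h the identity holds off a null set depending on h. Tonelli for the exceptional set of
    pairs (x, h) exchanges the quantifiers, at the price of losing a null set of h on each line. *)
Lemma weak_derivative_on_lines :
  {ae leb4, forall x, {ae l, forall h, 0 < h -> w x - w (x + h *: e) = primitive_on_line x h}}.
Proof.
pose N := [set z : spacetime R | 0 < z.2 /\ w z.1 - w (z.1 + z.2 *: e) != primitive_on_line z.1 z.2].
pose W (z : spacetime R) := w z.1 - w (z.1 + z.2 *: e) - primitive_on_line z.1 z.2.
have mW : measurable_fun setT W.
  apply: measurable_funB; last exact: measurable_primitive_on_line.
  apply: measurable_funB; first exact: measurableT_comp mw measurable_fst.
  have := measurableT_comp mw (measurable_line 1 e).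
  by apply: eq_measurable_fun => z _ /=; rewrite mul1r.
have mN : measurable N.
  have -> : N = (setT `&` snd @^-1` `]0, +oo[) `&` (setT `&` W @^-1` ~` [set 0]).
    rewrite !setTI; apply/seteqP; split => z /=; rewrite in_itv/= andbT.
      by move=> [z0 /eqP nW]; split => // /subr0_eq.
    by move=> [z0 nW]; split => //; apply/eqP => h; apply: nW; rewrite /W h subrr.
  apply: measurableI; first exact: measurable_snd.
  by apply: mW => //; apply: measurableC.
have mF : measurable_fun setT (fun z => (\1_N z)%:E : \bar R).
  by apply/measurable_EFinP; exact: measurable_indic.
have F0 z : (0 <= (\1_N z)%:E :> \bar R)%E by rewrite lee_fin.
have : (\int[leb4]_x \int[l]_h (\1_N (x, h))%:E = 0 :> \bar R)%E.
  rewrite -(tonelli5' mF F0) (tonelli5 mF F0); apply: integral0_eq => t _.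
  have [t0|t0] := ltP 0 t; last first.
    apply: integral0_eq => x _; rewrite indicE memNset//= => -[].
    by rewrite ltNge t0.
  rewrite -(integral0 leb4 setT); apply: ge0_ae_eq_integral => //.
    exact: measurableT_comp mF (pair2_measurable t).
  apply: (ae_eqS (weak_derivative_ae t0)) => x xt.
  by rewrite indicE memNset// /N/= => -[_]; rewrite xt eqxx.
have mFx : measurable_fun setT (fun x => \int[l]_h (\1_N (x, h))%:E : \bar R)%E.
  apply: (measurable_partial_integral (h := fun x h => (\1_N (x, h))%:E)) => //.
move=> I0; have I1 x : (0 <= \int[l]_h (\1_N (x, h))%:E :> \bar R)%E by exact: integral_ge0.
have := ae_eq0_of_integral mFx I1 I0; apply: filterS => x Ix.
have mNx : measurable_fun setT (fun h : measurableTypeR R => (\1_N (x, h))%:E : \bar R).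
  exact: measurableT_comp mF (pair1_measurable x).
have := ae_eq0_of_integral mNx (fun h => F0 (x, h)) Ix; apply: filterS => h xh h0.
apply/eqP; apply: contrapT => /negP xhN; move: xh; rewrite indicE mem_set//.
by move=> [] /eqP; rewrite oner_eq0.
Qed.

End weak_derivative_on_lines.

(** * The Frobenius inner product and norm *)

Section frobenius.
Variables (R : realType) (m n : nat).
Implicit Types A B : 'M[R]_(m, n).

Lemma frobdotC A B : frobdot A B = frobdot B A.
Proof. by apply: eq_bigr => i _; apply: eq_bigr => j _; rewrite mulrC. Qed.

Lemma frobdotDl A B C : frobdot (A + B) C = frobdot A C + frobdot B C.
Proof.
rewrite /frobdot -big_split/=; apply: eq_bigr => i _; rewrite -big_split/=.
by apply: eq_bigr => j _; rewrite mxE mulrDl.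
Qed.

Lemma frobdotZl (c : R) A B : frobdot (c *: A) B = c * frobdot A B.
Proof.
rewrite /frobdot mulr_sumr; apply: eq_bigr => i _; rewrite mulr_sumr.
by apply: eq_bigr => j _; rewrite mxE mulrA.
Qed.

Lemma frobdot0l A : frobdot 0 A = 0.
Proof. by rewrite -[X in frobdot X _](scale0r A) frobdotZl mul0r. Qed.

Lemma frobdotNl A B : frobdot (- A) B = - frobdot A B.
Proof. by rewrite -scaleN1r frobdotZl mulN1r. Qed.

Lemma frobdotBl A B C : frobdot (A - B) C = frobdot A C - frobdot B C.
Proof. by rewrite frobdotDl frobdotNl. Qed.

Lemma frobdot_ge0 A : 0 <= frobdot A A.
Proof. by do 2 apply: sumr_ge0 => ? _; rewrite -expr2 sqr_ge0. Qed.

Lemma frob_ge0 A : 0 <= frob A. Proof. exact: sqrtr_ge0. Qed.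

Lemma sqr_frob A : frob A ^+ 2 = frobdot A A.
Proof. by rewrite sqr_sqrtr// frobdot_ge0. Qed.

Lemma le_entry_frob A i j : `|A i j| <= frob A.
Proof.
rewrite -(@ler_pXn2r _ 2)// ?nnegrE ?frob_ge0// sqr_frob real_normK ?num_real//.
rewrite /frobdot (bigD1 i)//= (bigD1 j)//= -expr2 -addrA lerDl addr_ge0//.
  by apply: sumr_ge0 => k _; rewrite -expr2 sqr_ge0.
by do 2 apply: sumr_ge0 => ? _; rewrite -expr2 sqr_ge0.
Qed.

Lemma frob_eq0 A : frob A = 0 -> A = 0.
Proof.
move=> A0; apply/matrixP => i j; rewrite mxE; apply/eqP.
by rewrite -normr_le0 -A0 le_entry_frob.
Qed.

Lemma frobdot_le A B : frobdot A B <= frob A * frob B.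
Proof.
have [A0|A0] := eqVneq (frob A) 0.
  by rewrite A0 mul0r (frob_eq0 A0) frobdot0l.
have [B0|B0] := eqVneq (frob B) 0.
  by rewrite B0 mulr0 (frob_eq0 B0) frobdotC frobdot0l.
have a0 : 0 < frob A by rewrite lt_neqAle eq_sym A0 frob_ge0.
have b0 : 0 < frob B by rewrite lt_neqAle eq_sym B0 frob_ge0.
have := frobdot_ge0 (frob B *: A - frob A *: B).
rewrite !(frobdotBl, frobdotZl) ![frobdot _ (_ - _)]frobdotC !(frobdotBl, frobdotZl).
rewrite -!sqr_frob [frobdot B A]frobdotC => h.
have : 0 <= (2 * (frob A * frob B)) * (frob A * frob B - frobdot A B) by apply: le_trans h _; lra.
by rewrite pmulr_rge0 ?subr_ge0// !mulr_gt0.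
Qed.

Lemma frobN A : frob (- A) = frob A.
Proof. by rewrite /frob frobdotNl frobdotC frobdotNl opprK. Qed.

Lemma frobZ (c : R) A : frob (c *: A) = `|c| * frob A.
Proof.
rewrite /frob frobdotZl frobdotC frobdotZl mulrA -expr2 sqrtrM ?sqr_ge0//.
by rewrite sqrtr_sqr.
Qed.

Lemma frob_triangle A B : frob (A + B) <= frob A + frob B.
Proof.
rewrite -(@ler_pXn2r _ 2)// ?nnegrE ?addr_ge0 ?frob_ge0// sqr_frob.
rewrite frobdotDl ![frobdot _ (_ + _)]frobdotC !frobdotDl -!sqr_frob [frobdot B A]frobdotC.
by have := frobdot_le A B; lra.
Qed.

Lemma ler_frob_dist A B : `|frob A - frob B| <= frob (A - B).
Proof.
have h (C D : 'M[R]_(m, n)) : frob C - frob D <= frob (C - D).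
  by rewrite lerBlDr; have := frob_triangle (C - D) D; rewrite subrK.
rewrite ler_norml; apply/andP; split; last exact: h.
by rewrite lerNl opprB -[X in _ <= X]frobN opprB; exact: h.
Qed.

Lemma measurable_frob d (T : measurableType d) (D : set T) (f : T -> 'M[R]_(m, n)) :
  (forall i j, measurable_fun D (fun z => f z i j)) -> measurable_fun D (fun z => frob (f z)).
Proof.
move=> mf; have ms : measurable_fun setT (@Num.sqrt R : measurableTypeR R -> measurableTypeR R).
  by apply: continuous_measurable_fun; exact: sqrt_continuous.
apply: (measurableT_comp ms).
rewrite /frobdot; apply: measurable_sum => i; apply: measurable_sum => j.
exact: measurable_funM.
Qed.

End frobenius.

(** * The Gagliardo-Nirenberg inequality *)

Lemma sqint_le (R : realType) d (T : measurableType d) (mu : {measure set T -> \bar R}) (f g : T -> R) :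
  measurable_fun setT f -> measurable_fun setT g ->
  (forall x, `|f x| <= g x) -> sqint mu g -> sqint mu f.
Proof.
move=> mf mg fg; apply: le_lt_trans; apply: ge0_le_integral => //.
- by move=> x _; rewrite lee_fin sqr_ge0.
- by apply/measurable_EFinP; exact: measurable_funX.
- by apply/measurable_EFinP; exact: measurable_funX.
- move=> x _; rewrite lee_fin -(real_normK (num_real (f x))).
  by rewrite lerXn2r// ?nnegrE// (le_trans _ (fg x)).
Qed.

Lemma primitive_on_lineE (R : realType) (e : space4 R) (g : space4 R -> R) (x : space4 R) (h : R) :
  primitive_on_line e g x h = \int[lebesgue_measure]_(s in `[0, h]) g (x + s *: e).
Proof.
rewrite Rintegral_mkcond; apply: eq_Rintegral => s _.
by rewrite patchE indicE; case: ifP; rewrite ?mulr1 ?mulr0.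
Qed.

Lemma integrable_sqint_itv (R : realType) (f : R -> R) (a b : R) (A : set (measurableTypeR R)) :
  measurable_fun setT f -> (\int[lebesgue_measure]_s (f s ^+ 2)%:E < +oo)%E ->
  measurable A -> A `<=` `[a, b]%classic ->
  lebesgue_measure.-integrable A (fun s => (f s)%:E).
Proof.
move=> mf sf mA Aab; apply: (integrableS _ mA Aab); first exact: measurable_itv.
apply/integrableP; split.
  by apply: measurable_funTS; apply/measurable_EFinP.
apply: (@le_lt_trans _ _ (\int[lebesgue_measure]_(s in `[a, b]) (1%:E + (f s ^+ 2)%:E))%E).
  apply: ge0_le_integral => //.
  - by apply: measurable_funTS; apply: measurableT_comp => //; apply/measurable_EFinP.
  - apply: measurable_funTS; apply: emeasurable_funD => //.
    by apply/measurable_EFinP; exact: measurable_funX.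
  - move=> s _; rewrite -EFinD lee_fin -(real_normK (num_real (f s))).
    by have := sqr_ge0 (`|f s| - 1); nra.
rewrite ge0_integralD//.
- apply: lte_add_pinfty.
    rewrite integral_cst// mul1e; have := lebesgue_measure_itv `[a, b].
    by rewrite /= => ->; case: ifP; rewrite ?ltry.
  apply: le_lt_trans sf; apply: ge0_subset_integral => //.
  + by apply/measurable_EFinP; exact: measurable_funX.
  + by move=> s _; rewrite lee_fin sqr_ge0.
- by move=> s _; rewrite lee_fin sqr_ge0.
- by apply: measurable_funTS; apply/measurable_EFinP; exact: measurable_funX.
Qed.

Lemma Rintegral_sum d (T : measurableType d) (R : realType) (mu : {measure set T -> \bar R})
    (A : set T) (I : Type) (r : seq I) (F : I -> T -> R) : measurable A ->
  (forall i, mu.-integrable A (fun x => (F i x)%:E)) ->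
  \int[mu]_(x in A) (\sum_(i <- r) F i x) = \sum_(i <- r) \int[mu]_(x in A) F i x.
Proof.
move=> mA iF; elim: r => [|i r IHr].
  by under eq_Rintegral do rewrite big_nil; rewrite big_nil /Rintegral integral0.
under eq_Rintegral do rewrite big_cons; rewrite big_cons RintegralD//; [by rewrite IHr|exact: iF|].
have := @integrable_sum _ _ _ mu A mA _ r xpredT (fun i x => (F i x)%:E) (fun i _ => iF i).
by apply: eq_integrable => // x _; rewrite sumEFin.
Qed.

Lemma frob_col_le (R : realType) (m n : nat) (A : 'M[R]_(m, n)) (j : 'I_n) :
  frob (col j A) <= frob A.
Proof.
rewrite -(@ler_pXn2r _ 2)// ?nnegrE ?frob_ge0// !sqr_frob /frobdot.
apply: ler_sum => i _; rewrite big_ord1 !mxE (bigD1 j)//= lerDl.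
by apply: sumr_ge0 => k _; rewrite -expr2 sqr_ge0.
Qed.

Lemma cauchy_schwarz d (T : measurableType d) (R : realType) (mu : {measure set T -> \bar R})
    (f g : T -> R) : measurable_fun setT f -> measurable_fun setT g ->
  sqint mu f -> sqint mu g ->
  (\int[mu]_x (f x * g x)) ^+ 2 <= \int[mu]_x (f x ^+ 2) * \int[mu]_x (g x ^+ 2).
Proof.
move=> mf mg sf sg.
have ifg := integrable_sqM mf mg sf sg.
have if2 : mu.-integrable setT (fun x => (f x ^+ 2)%:E) := integrable_sqM mf mf sf sf.
have ig2 : mu.-integrable setT (fun x => (g x ^+ 2)%:E) := integrable_sqM mg mg sg sg.
set I := Rintegral _ _ (fun x => f x * g x); set A := Rintegral _ _ (fun x => f x ^+ 2).
set B := Rintegral _ _ _.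
have A0 : 0 <= A by apply: Rintegral_ge0 => x _; exact: sqr_ge0.
have B0 : 0 <= B by apply: Rintegral_ge0 => x _; exact: sqr_ge0.
have H (a b : R) : 2 * a * b * I <= a ^+ 2 * A + b ^+ 2 * B.
  rewrite /I /A /B -!RintegralZl// -RintegralD//.
  - apply: le_Rintegral => //.
    + by have := integrableZl measurableT (2 * a * b) ifg; apply: eq_integrable.
    + have := integrableD measurableT (integrableZl measurableT (a ^+ 2) if2)
        (integrableZl measurableT (b ^+ 2) ig2).
      by apply: eq_integrable.
    + by move=> x _; have := sqr_ge0 (a * f x - b * g x); nra.
  - by have := integrableZl measurableT (a ^+ 2) if2; apply: eq_integrable.
  - by have := integrableZl measurableT (b ^+ 2) ig2; apply: eq_integrable.
have [A00|A1] := eqVneq A 0.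
  have [->|I0] := eqVneq I 0; first by rewrite expr0n A00 mul0r.
  (* When A = 0 but I is not, this choice of a makes the left side B + 1 and the right side B. *)
  have := H ((B + 1) / (2 * I)) 1; rewrite A00 (_ : 2 * _ * 1 * I = B + 1); first by lra.
  by field.
have : 0 <= A * (A * B - I ^+ 2) by have := H I A; lra.
by rewrite pmulr_rge0 ?subr_ge0// lt_neqAle eq_sym A1.
Qed.

(** Loomis-Whitney parametrizes a line by its moving coordinate, weak derivatives by the
    displacement from a point; a translation of the parameter relates the two. *)
Definition replace4 (R : realType) (j : 'I_4) (x : space4 R) (s : measurableTypeR R) : space4 R :=
  match val j with
  | 0 => (s, x.1.1.2, x.1.2, x.2) | 1 => (x.1.1.1, s, x.1.2, x.2)
  | 2 => (x.1.1.1, x.1.1.2, s, x.2) | _ => (x.1.1.1, x.1.1.2, x.1.2, s)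
  end.

Lemma integral_on_lines (R : realType) (g : space4 R -> \bar R) (x : space4 R) (j : 'I_4) :
  measurable_fun setT g -> (forall y, 0 <= g y)%E ->
  (\int[lebesgue_measure]_s g (x + s *: basis4 R j)%R
   = \int[lebesgue_measure]_s g (replace4 j x s))%E.
Proof.
move=> mg g0.
have h1 (r s : R) : r + s * 1 = s + r by rewrite mulr1 addrC.
have h0 (r s : R) : r + s * 0 = r by rewrite mulr0 addr0.
case: x => [[[a b] c] d]; case: j => -[|[|[|[|//]]]] ?; rewrite /replace4/=.
- rewrite -(lebesgue_shift a (f := fun s => g (s, b, c, d)))//.
    by apply: eq_integral => s _; congr g; congr (_, _, _, _); rewrite ?h1 ?h0.
  by apply: (measurableT_comp mg); measurable_proj.
- rewrite -(lebesgue_shift b (f := fun s => g (a, s, c, d)))//.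
    by apply: eq_integral => s _; congr g; congr (_, _, _, _); rewrite ?h1 ?h0.
  by apply: (measurableT_comp mg); measurable_proj.
- rewrite -(lebesgue_shift c (f := fun s => g (a, b, s, d)))//.
    by apply: eq_integral => s _; congr g; congr (_, _, _, _); rewrite ?h1 ?h0.
  by apply: (measurableT_comp mg); measurable_proj.
- rewrite -(lebesgue_shift d (f := fun s => g (a, b, c, s)))//.
    by apply: eq_integral => s _; congr g; congr (_, _, _, _); rewrite ?h1 ?h0.
  by apply: (measurableT_comp mg); measurable_proj.
Qed.

Lemma measurable_on_line (R : realType) (e x : space4 R) (f : space4 R -> R) :
  measurable_fun setT f -> measurable_fun setT (fun s : R => f (x + s *: e)).
Proof.
move=> mf.
have := measurableT_comp (measurableT_comp mf (measurable_line 1 e)) (pair1_measurable x).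
by apply: eq_measurable_fun => s _ /=; rewrite mul1r.
Qed.

Section truncated_line_inequality.
Variables (R : realType) (m : nat) (v : space4 R -> 'cV[R]_m) (Dv : space4 R -> 'M[R]_(m, 4)).
Local Notation l := (@lebesgue_measure R).
Hypotheses (mv : forall i, measurable_fun setT (fun x => v x i ord0))
  (mDv : forall i j, measurable_fun setT (fun x => Dv x i j))
  (sv : sqint leb4 (fun x => frob (v x))) (sDv : sqint leb4 (fun x => frob (Dv x)))
  (wg : forall (a b : space4 R) n i j,
    \int[leb4]_x (v x i ord0 * 'D_(basis4 R j) (bump4 a b n) x)
    = - \int[leb4]_x (Dv x i j * bump4 a b n x)).

Let P x := frob (v x).
Let G x := frob (Dv x).

Let mP : measurable_fun setT P.
Proof. by apply: measurable_frob => i j; rewrite ord1. Qed.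

Let mG : measurable_fun setT G.
Proof. exact: measurable_frob. Qed.

Let svi i : sqint leb4 (fun x => v x i ord0).
Proof. by apply: (sqint_le (mv i) mP _ sv) => x; exact: le_entry_frob. Qed.

Let sDvij i j : sqint leb4 (fun x => - Dv x i j).
Proof.
apply: (sqint_le _ mG _ sDv) => [|x]; first exact: measurableT_comp.
by rewrite normrN; exact: le_entry_frob.
Qed.

Let mNDv i j : measurable_fun setT (fun x => - Dv x i j).
Proof. exact: measurableT_comp. Qed.

Definition coord4 (j : 'I_4) (x : space4 R) : R :=
  match val j with 0 => x.1.1.1 | 1 => x.1.1.2 | 2 => x.1.2 | _ => x.2 end.

Lemma measurable_coord4 j : measurable_fun setT (coord4 j).
Proof. by case: j => -[|[|[|[|//]]]] ?; rewrite /coord4/=; measurable_proj. Qed.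

Lemma coord4_line j x (s : R) : coord4 j (x + s *: basis4 R j) = coord4 j x + s.
Proof.
have h (r : R) : r + s * 1 = r + s by rewrite mulr1.
by case: j => -[|[|[|[|//]]]] ?; exact: h.
Qed.

Let weak i j (a b : space4 R) n :
  (\int[leb4]_x (v x i ord0 * 'D_(basis4 R j) (bump4 a b n) x)%:E
   = \int[leb4]_x (- Dv x i j * bump4 a b n x)%:E)%E.
Proof.
have te := test_function_bump4 a b n.
have i1 := integrable_sqM (mv i) (measurable_derive_test (basis4 R j) te) (svi i)
  (sqint_derive_test (basis4 R j) te).
have i2 := integrable_sqM (mNDv i j) (measurable_test te) (sDvij i j) (sqint_test te).
rewrite -[LHS]fineK; last exact: integrable_fin_num i1.
rewrite -[RHS]fineK; last exact: integrable_fin_num i2.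
congr EFin; rewrite -[LHS]/(Rintegral _ _ _) wg -[RHS]/(Rintegral _ _ _).
rewrite -mulN1r -RintegralZl//.
  by apply: eq_Rintegral => x _; rewrite mulN1r mulNr.
have := integrableN i2; apply: eq_integrable => // x _ /=.
by rewrite mulNr opprK.
Qed.

(** Along almost every line in direction j, v agrees almost everywhere with the absolutely
    continuous curve [V], its value at x corrected by the integral of the derivative. [line_cube] is
    applied to min(|V|, N) on the half line from x, and the integral is transferred back to v and
    enlarged to the whole line. *)
Lemma truncated_line_inequality (N : R) (j : 'I_4) : 0 <= N ->
  {ae leb4, forall x, ((Num.min (P x) N ^+ 3)%:E
    <= 3%:E * \int[l]_s (Num.min (P (x + s *: basis4 R j)) N ^+ 2 * G (x + s *: basis4 R j))%:E)%E}.
Proof.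
move=> N0; set e := basis4 R j.
have a1 := ae_sqint_on_lines (measurable_coord4 j) (coord4_line j) mP sv.
have a2 := ae_sqint_on_lines (measurable_coord4 j) (coord4_line j) mG sDv.
have a3 : {ae leb4, forall x, forall i, {ae l, forall h, 0 < h ->
    v x i ord0 - v (x + h *: e) i ord0 = primitive_on_line e (fun x => - Dv x i j) x h}}.
  apply: filter_forall => i.
  exact: (weak_derivative_on_lines (mv i) (mNDv i j) (svi i) (sDvij i j) (weak i j)).
move: a1 a2 a3; apply: filterS3 => x Px Gx vx.
have mline (f : space4 R -> R) : measurable_fun setT f ->
    measurable_fun setT (fun s : R => f (x + s *: e)) by exact: measurable_on_line.
pose prim i h := primitive_on_line e (fun x => - Dv x i j) x h.
pose V (h : R) : 'cV[R]_m := \col_i (v x i ord0 - prim i h).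
have mV : measurable_fun setT (fun h => frob (V h)).
  apply: measurable_frob => i k.
  rewrite (_ : (fun z => _) = (fun h => v x i ord0 - prim i h)); last first.
    by apply/funext => h; rewrite mxE.
  apply: measurable_funB => //.
  exact: measurableT_comp (measurable_primitive_on_line e (mNDv i j)) (pair1_measurable x).
have V0 : frob (V 0) = P x.
  congr frob; apply/matrixP => i k.
  by rewrite mxE (ord1 k) /prim primitive_on_lineE set_itv1 Rintegral_set1 subr0.
have VP : {ae l, forall h, 0 <= h -> frob (V h) = P (x + h *: e)}.
  have vx' : {ae l, forall h, forall i, 0 < h ->
      v x i ord0 - v (x + h *: e) i ord0 = prim i h} by exact: filter_forall.
  apply: (aeS vx') => h vh; rewrite le_eqVlt => /predU1P[<-|h0].
    by rewrite V0 scale0r addr0.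
  congr frob; apply/matrixP => i k; rewrite mxE (ord1 k) -(vh i h0); exact: subKr.
pose PN h := Num.min (frob (V h)) N.
have mPN : measurable_fun setT PN by exact: measurable_minr.
have PN0 h : 0 <= PN h by rewrite le_min frob_ge0.
pose Gs s := G (x + s *: e).
have mGs : measurable_fun setT Gs by exact: mline.
have Gs0 s : 0 <= Gs s by exact: frob_ge0.
pose ray : set (measurableTypeR R) := `[0, +oo[%classic.
have mray : measurable ray by exact: measurable_itv.
have G2 : (\int[l]_(s in ray) (Gs s ^+ 2)%:E < +oo)%E.
  apply: le_lt_trans Gx; apply: ge0_subset_integral => //.
  - by apply/measurable_EFinP; exact: measurable_funX.
  - by move=> s _; rewrite lee_fin sqr_ge0.
pose PL s := Num.min (P (x + s *: e)) N.
have mPL : measurable_fun setT PL by apply: measurable_minr => //; exact: mline.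
have PL0 s : 0 <= PL s by rewrite le_min frob_ge0.
(* The integrand is left general because the same transfer from [V] to v serves the L^2 bound and
   the final integral. *)
have aePL (F : R -> R -> R) : ae_eq l ray (fun s => (F (PN s) s)%:E) (fun s => (F (PL s) s)%:E).
  apply: (aeS VP) => s + s0; rewrite /PN /PL => -> //.
  by move: s0; rewrite /ray/= in_itv/= andbT.
have P2 : (\int[l]_(s in ray) (PN s ^+ 2)%:E < +oo)%E.
  rewrite (ge0_ae_eq_integral _ _ _ _ _ (aePL (fun p s => p ^+ 2)))//.
  - apply: le_lt_trans Px; apply: (@le_trans _ _ (\int[l]_(s in ray) (P (x + s *: e) ^+ 2)%:E)%E).
      apply: ge0_le_integral => //.
      + by move=> s _; rewrite lee_fin sqr_ge0.
      + by apply: measurable_funTS; apply/measurable_EFinP; exact: measurable_funX.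
      + by apply: measurable_funTS; apply/measurable_EFinP; apply: measurable_funX; exact: mline.
      + move=> s _; rewrite lee_fin lerXn2r// ?nnegrE//; first exact: frob_ge0.
        by rewrite ge_min lexx.
    apply: ge0_subset_integral => //.
    + by apply/measurable_EFinP; apply: measurable_funX; exact: mline.
    + by move=> s _; rewrite lee_fin sqr_ge0.
  - by apply: measurable_funTS; apply/measurable_EFinP; exact: measurable_funX.
  - by apply: measurable_funTS; apply/measurable_EFinP; exact: measurable_funX.
  - by move=> s _; rewrite lee_fin sqr_ge0.
  - by move=> s _; rewrite lee_fin sqr_ge0.
have PG (a b : R) : 0 <= a -> a <= b ->
    (`|PN b - PN a|%:E <= \int[l]_(s in `[a, b[) (Gs s)%:E)%E.
  move=> a0 ab.
  (* The integrals over [0, b] and [0, a] differ by one over ]a, b]; the left-closed interval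
     expected by [line_cube] is restored at the end, endpoints being null. *)
  pose I : set (measurableTypeR R) := `]a, b]%classic.
  have mI : measurable I by exact: measurable_itv.
  have Iab : I `<=` `[a, b]%classic by exact: subset_itv_oc_cc.
  have iG : l.-integrable I (fun s => (Gs s)%:E) by exact: integrable_sqint_itv Iab.
  have iD i (c d : R) (A : set (measurableTypeR R)) : measurable A -> A `<=` `[c, d]%classic ->
      l.-integrable A (fun s => (- Dv (x + s *: e) i j)%:E).
    move=> mA Acd; apply: integrable_sqint_itv Acd => //; first exact: (mline (fun x => - Dv x i j)).
    apply: le_lt_trans Gx; apply: ge0_le_integral => //.
    - by move=> s _; rewrite lee_fin sqr_ge0.
    - apply/measurable_EFinP; apply: measurable_funX; exact: (mline (fun x => - Dv x i j)).
    - by apply/measurable_EFinP; exact: measurable_funX.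
    - move=> s _; rewrite lee_fin -(real_normK (num_real (- _))) normrN lerXn2r// ?nnegrE//.
        exact: frob_ge0.
      exact: le_entry_frob.
  set Y := V b - V a.
  have Yi i : Y i ord0 = - \int[l]_(s in I) (- Dv (x + s *: e) i j).
    rewrite /I -(@Rintegral_itvB _ _ (BLeft 0) (BRight b)).
    - rewrite !mxE /prim !primitive_on_lineE; lra.
    - by apply: (iD i 0 b) => //; exact: measurable_itv.
    - by rewrite bnd_simp.
    - by rewrite bnd_simp.
  (* Minkowski's inequality for a vector-valued integral: |Y|^2 is the integral of Y paired with the
     j-th column of the gradient, hence at most |Y| times the integral of [Gs]. *)
  have YG : frob Y <= \int[l]_(s in I) Gs s.
    have [Y0|Y0] := eqVneq (frob Y) 0.
      by rewrite Y0; apply: Rintegral_ge0 => s _; exact: Gs0.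
    have Y1 : 0 < frob Y by rewrite lt_neqAle eq_sym Y0 frob_ge0.
    rewrite -(ler_pM2l Y1) -RintegralZl// -expr2 sqr_frob.
    have -> : frobdot Y Y = \int[l]_(s in I) (\sum_i (- Y i ord0) * (- Dv (x + s *: e) i j)).
      rewrite Rintegral_sum//; last first.
        move=> i; have := integrableZl mI (- Y i ord0) (iD i a b I mI Iab).
        by apply: eq_integrable => // s _; rewrite EFinM.
      apply: eq_bigr => i _; rewrite big_ord1 RintegralZl//; last exact: (iD i a b).
      by rewrite {2}Yi mulrN mulNr.
    apply: le_Rintegral => //.
    - have := @integrable_sum _ _ _ l I mI _ (index_enum 'I_m) xpredT
        (fun i s => (- Y i ord0 * - Dv (x + s *: e) i j)%:E).
      move=> H; apply: eq_integrable (H _) => // [s _|i _]; first by rewrite /= sumEFin.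
      have := integrableZl mI (- Y i ord0) (iD i a b I mI Iab).
      by apply: eq_integrable => // s _; rewrite EFinM.
    - by have := integrableZl mI (frob Y) iG; apply: eq_integrable => // s _; rewrite EFinM.
    - move=> s _; apply: (@le_trans _ _ (frobdot Y (col j (Dv (x + s *: e))))).
        apply: ler_sum => i _; rewrite big_ord1 mulrNN le_eqVlt; apply/orP; left; apply/eqP.
        by congr (_ * _); rewrite mxE.
      apply: le_trans (frobdot_le _ _) _; rewrite ler_wpM2l ?frob_ge0//.
      exact: frob_col_le.
  (* Neither taking the norm nor truncating at N increases distances. *)
  apply: (@le_trans _ _ (frob Y)%:E).
    rewrite lee_fin; apply: le_trans (ler_frob_dist _ _).
    rewrite /PN; have := frob_ge0 (V b); have := frob_ge0 (V a).
    move: (frob (V b)) (frob (V a)) => p q q0 p0.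
    rewrite ler_norml; have := lerNnormlW (lexx `|p - q|); have := ler_norm (p - q).
    by rewrite /Num.min; case: ifPn => [?|]; case: ifPn => [?|]; rewrite -?leNgt;
      intros; apply/andP; split; lra.
  apply: (@le_trans _ _ (\int[l]_(s in I) Gs s)%:E); first by rewrite lee_fin.
  rewrite /Rintegral fineK; last exact: integrable_fin_num iG.
  have mGE (A : set (measurableTypeR R)) : measurable_fun A (fun s => (Gs s)%:E).
    by apply: measurable_funTS; apply/measurable_EFinP.
  rewrite /I integral_itv_obnd_cbnd; last exact: mGE.
  by rewrite -integral_itv_bndo_bndc//; exact: mGE.
have main := line_cube PN0 Gs0 mPN mGs G2 P2 PG.
rewrite {1}/PN V0 in main; apply: le_trans main _; rewrite lee_wpmul2l ?lee_fin//.
rewrite (ge0_ae_eq_integral _ _ _ _ _ (aePL (fun p s => p ^+ 2 * Gs s)))//.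
- apply: ge0_subset_integral => //.
  + by apply/measurable_EFinP; apply: measurable_funM => //; exact: measurable_funX.
  + by move=> s _; rewrite lee_fin mulr_ge0// sqr_ge0.
- apply: measurable_funTS; apply/measurable_EFinP; apply: measurable_funM => //; exact: measurable_funX.
- apply: measurable_funTS; apply/measurable_EFinP; apply: measurable_funM => //; exact: measurable_funX.
- by move=> s _; rewrite lee_fin mulr_ge0// sqr_ge0.
- by move=> s _; rewrite lee_fin mulr_ge0// sqr_ge0.
Qed.

Let trunc (N : R) (x : space4 R) : R := Num.min (P x) N.

Let trunc_ge0 N x : 0 <= N -> 0 <= trunc N x.
Proof. by move=> N0; rewrite le_min frob_ge0. Qed.

Let measurable_trunc N : measurable_fun setT (trunc N).
Proof. exact: measurable_minr. Qed.

Let sqint_trunc N : 0 <= N -> sqint leb4 (trunc N).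
Proof.
move=> N0; apply: (sqint_le (measurable_trunc N) mP _ sv) => x.
by rewrite ger0_norm ?trunc_ge0// ge_min lexx.
Qed.

Let sqint_trunc2 N : 0 <= N -> sqint leb4 (fun x => trunc N x ^+ 2).
Proof.
move=> N0; apply: (@sqint_le _ _ _ _ _ (fun x => N * P x)).
- exact: measurable_funX.
- exact: measurable_funM.
- move=> x; have h := trunc_ge0 x N0; rewrite ger0_norm ?sqr_ge0// expr2.
  by rewrite ler_pM// ge_min lexx ?orbT.
- have := integrableZl measurableT (N ^+ 2) (integrable_sqM mP mP sv sv).
  move=> /integrableP[_]; apply: le_lt_trans; apply: ge0_le_integral => //.
  + by move=> x _; rewrite lee_fin sqr_ge0.
  + by apply/measurable_EFinP; apply: measurable_funX; exact: measurable_funM.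
  + apply: measurableT_comp => //; apply: emeasurable_funM => //.
    by apply/measurable_EFinP; exact: measurable_funM.
  + by move=> x _; rewrite -EFinM abse_EFin lee_fin exprMn -expr2 ler_norm.
Qed.

(** With p the truncation, p^3 is at most the integral of 3 p^2 G along each of the four lines
    through almost every x. As (p^4)^3 = (p^3)^4, Loomis-Whitney gives I^3 <= (3 b)^4, where I and b
    are the integrals of p^4 and p^2 G. Cauchy-Schwarz, b^2 <= I E, leaves I^3 <= 81 I^2 E^2, and
    I^2 cancels because truncation has made I finite. *)
Lemma sobolev_trunc (N : R) : 0 <= N ->
  \int[leb4]_x ((trunc N x ^+ 2) ^+ 2) <= 81 * (\int[leb4]_x (G x ^+ 2)) ^+ 2.
Proof.
move=> N0; set p := trunc N; set I := Rintegral _ _ _; set E := Rintegral _ _ _.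
have mp : measurable_fun setT p by exact: measurable_trunc.
have mp2 : measurable_fun setT (fun x => p x ^+ 2) by exact: measurable_funX.
have p0 x : 0 <= p x by exact: trunc_ge0.
have G0 x : 0 <= G x by exact: frob_ge0.
have ip4 : leb4.-integrable setT (fun x => ((p x ^+ 2) ^+ 2)%:E).
  by have := integrable_sqM mp2 mp2 (sqint_trunc2 N0) (sqint_trunc2 N0).
have iG2 : leb4.-integrable setT (fun x => (p x ^+ 2 * G x)%:E).
  exact: integrable_sqM mp2 mG (sqint_trunc2 N0) sDv.
set b := \int[leb4]_x (p x ^+ 2 * G x).
have b2 : b ^+ 2 <= I * E by exact: (cauchy_schwarz mp2 mG (sqint_trunc2 N0) sDv).
pose g x : \bar R := (3 * (p x ^+ 2 * G x))%:E.
have mg : measurable_fun setT g.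
  by apply/measurable_EFinP; apply: measurable_funM => //; exact: measurable_funM.
have g0 x : (0 <= g x)%E by rewrite lee_fin !mulr_ge0// sqr_ge0.
have Ig : (\int[leb4]_x g x = (3 * b)%:E)%E.
  rewrite /g; under eq_integral do rewrite EFinM.
  by rewrite integralZl// EFinM /b /Rintegral fineK//; exact: integrable_fin_num iG2.
have [A [mA A0 Agood]] : {ae leb4, forall x, forall j : 'I_4, ((p x ^+ 3)%:E
    <= \int[l]_s g (x + s *: basis4 R j)%R)%E}.
  apply: filter_forall => j; apply: (aeS (truncated_line_inequality j N0)) => x.
  rewrite /g => /le_trans; apply; rewrite -ge0_integralZl//.
  - apply/measurable_EFinP.
    apply: (measurable_on_line _ _ (f := fun y => p y ^+ 2 * G y)).
    exact: measurable_funM.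
  - by move=> s _; rewrite lee_fin mulr_ge0 ?sqr_ge0 ?frob_ge0.
(* Loomis-Whitney wants its hypothesis at every point, so f is set to 0 on the null set A where a
   line inequality may fail. *)
pose f x : \bar R := ((p x ^+ 2) ^+ 2 * \1_(~` A) x)%:E.
have mf : measurable_fun setT f.
  apply/measurable_EFinP; apply: measurable_funM; first exact: measurable_funX.
  by apply: measurable_indic; exact: measurableC.
have If : (\int[leb4]_x f x = I%:E)%E.
  rewrite /I /Rintegral fineK; last exact: integrable_fin_num ip4.
  apply: ge0_ae_eq_integral => //.
  - exact: measurable_int ip4.
  - by move=> x _; rewrite lee_fin mulr_ge0// sqr_ge0.
  - by move=> x _; rewrite lee_fin sqr_ge0.
  - exists A; split => // x /= H; apply: contrapT => nAx; apply: H => _.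
    by rewrite /f indicE mem_set// mulr1.
have LW : (I%:E ^+ 3 <= ((3 * b) ^+ 4)%:E)%E.
  rewrite -If; apply: (le_trans (loomis_whitney4 mf mg mg mg mg _ g0 g0 g0 g0 _)).
  - by move=> x; rewrite lee_fin mulr_ge0// sqr_ge0.
  - move=> x; have i0 (F : R -> space4 R) : (0 <= \int[l]_s g (F s))%E by apply: integral_ge0.
    rewrite /f indicE; have [Ax|nAx] := pselect (A x).
      by rewrite memNset// mulr0 !expeS mul0e !mule_ge0.
    rewrite mem_set// mulr1.
    have H j : ((p x ^+ 3)%:E <= \int[l]_s g (x + s *: basis4 R j)%R)%E.
      by apply: contrapT => nH; apply: nAx; apply: Agood => /= K; apply: nH; exact: K.
    have := H (@Ordinal 4 3 isT); have := H (@Ordinal 4 2 isT).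
    have := H (@Ordinal 4 1 isT); have := H (@Ordinal 4 0 isT).
    rewrite !integral_on_lines// /replace4/= => h0 h1 h2 h3.
    apply: (@le_trans _ _ ((p x ^+ 3)%:E * (p x ^+ 3)%:E * (p x ^+ 3)%:E * (p x ^+ 3)%:E)%E).
      by rewrite -!EFinM lee_fin le_eqVlt; apply/orP; left; apply/eqP; ring.
    by rewrite !lee_pmul ?mule_ge0 ?lee_fin ?exprn_ge0.
  - by rewrite Ig -!EFinM lee_fin le_eqVlt; apply/orP; left; apply/eqP; ring.
have I0 : 0 <= I by apply: Rintegral_ge0 => x _; exact: sqr_ge0.
have E0 : 0 <= E by apply: Rintegral_ge0 => x _; exact: sqr_ge0.
move: LW; rewrite !expeS expe0 mule1 -!EFinM lee_fin => LW.
have [I1|I1] := eqVneq I 0; first by rewrite I1 mulr_ge0// sqr_ge0.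
have Ip : 0 < I by rewrite lt_neqAle eq_sym I1.
have b4 : (b ^+ 2) ^+ 2 <= (I * E) ^+ 2 by rewrite lerXn2r// ?nnegrE ?sqr_ge0 ?mulr_ge0.
have : I * (I * I) <= (I * I) * (81 * E ^+ 2).
  apply: (le_trans LW); rewrite (_ : (3 * b) ^+ 4 = 81 * (b ^+ 2) ^+ 2); last by ring.
  by rewrite (_ : _ * (81 * _) = 81 * (I * E) ^+ 2); [rewrite ler_wpM2l|ring].
by rewrite mulrC ler_pM2l// mulr_gt0.
Qed.

(** L^3 lies between L^2 and L^4: the square of int p^3 is at most int p^2 times int p^4, hence at
    most M^2 times 81 E^2, which gives 9 M E. Monotone convergence then removes the truncation. *)
Lemma gagliardo_nirenberg (M : R) : 0 <= M -> (\int[leb4]_x (P x ^+ 2)%:E <= (M ^+ 2)%:E)%E ->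
  (\int[leb4]_x (P x ^+ 3)%:E <= (9 * M)%:E * \int[leb4]_x (G x ^+ 2)%:E)%E.
Proof.
move=> M0 PM.
have iG2 : leb4.-integrable setT (fun x => (G x ^+ 2)%:E).
  by have := integrable_sqM mG mG sDv sDv.
rewrite -[X in (_ * X)%E]fineK; last exact: integrable_fin_num iG2.
set E := fine _; have E0 : 0 <= E by apply: Rintegral_ge0 => x _; exact: sqr_ge0.
have trunc3 n : (\int[leb4]_x (trunc n%:R x ^+ 3)%:E <= (9 * M)%:E * E%:E)%E.
  have N0 : 0 <= n%:R :> R by [].
  set p := trunc n%:R.
  have mp : measurable_fun setT p by exact: measurable_trunc.
  have mp2 : measurable_fun setT (fun x => p x ^+ 2) by exact: measurable_funX.
  have ip2 : leb4.-integrable setT (fun x => (p x ^+ 2)%:E).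
    by have := integrable_sqM mp mp (sqint_trunc N0) (sqint_trunc N0).
  have ip3 : leb4.-integrable setT (fun x => (p x ^+ 3)%:E).
    exact: integrable_sqM mp mp2 (sqint_trunc N0) (sqint_trunc2 N0).
  rewrite -[leLHS]fineK; last exact: integrable_fin_num ip3.
  have A2 : \int[leb4]_x (p x ^+ 2) <= M ^+ 2.
    rewrite -lee_fin /Rintegral fineK; last exact: integrable_fin_num ip2.
    apply: le_trans PM; apply: ge0_le_integral => //.
    - by move=> x _; rewrite lee_fin sqr_ge0.
    - exact: measurable_int ip2.
    - by apply/measurable_EFinP; exact: measurable_funX.
    - by move=> x _; rewrite lee_fin lerXn2r ?nnegrE ?trunc_ge0 ?frob_ge0// ge_min lexx.
  have := cauchy_schwarz mp mp2 (sqint_trunc N0) (sqint_trunc2 N0).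
  have := sobolev_trunc N0; rewrite -/p => S4.
  set J := Rintegral _ _ (fun x => p x * p x ^+ 2) => J2.
  rewrite -EFinM lee_fin -[leLHS]/J.
  have J0 : 0 <= J by apply: Rintegral_ge0 => x _; rewrite mulr_ge0 ?sqr_ge0 ?trunc_ge0.
  rewrite -(@ler_pXn2r _ 2) ?nnegrE ?mulr_ge0//; apply: (le_trans J2).
  rewrite (_ : (9 * M * E) ^+ 2 = M ^+ 2 * (81 * E ^+ 2)); last by ring.
  by apply: ler_pM => //; apply: Rintegral_ge0 => x _; exact: sqr_ge0.
have mp3 n : measurable_fun setT (fun x => (trunc n%:R x ^+ 3)%:E).
  by apply/measurable_EFinP; apply: measurable_funX; exact: measurable_trunc.
have p30 n x : (0 <= (trunc n%:R x ^+ 3)%:E)%E by rewrite lee_fin exprn_ge0// trunc_ge0.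
have nd x : {homo (fun n => (trunc n%:R x ^+ 3)%:E) : a b / (a <= b)%N >-> (a <= b)%E}.
  move=> a b ab; rewrite lee_fin lerXn2r ?nnegrE ?trunc_ge0//.
  by rewrite /trunc le_min !ge_min lexx/= ler_nat ab orbT.
have := cvg_monotone_convergence measurableT mp3 (fun n x _ => p30 n x) (fun x _ => nd x).
move=> /(_ leb4); have -> : (\int[leb4]_x limn (fun n => (trunc n%:R x ^+ 3)%:E) = \int[leb4]_x (P x ^+ 3)%:E)%E.
  apply: eq_integral => x _; apply/cvg_lim => //; apply: cvg_near_cst.
  exists (Num.truncn (P x)).+1 => // n /= nP; rewrite /trunc min_l//.
  by rewrite ltW// (lt_le_trans (truncnS_gt _))// ler_nat.
move=> tP; rewrite -(cvg_lim _ tP)//; apply: lime_le; first by apply/cvg_ex; eexists; exact: tP.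
exact: nearW.
Qed.

End truncated_line_inequality.

(** * Weak convergence in L^2 *)

Lemma integrable_sqint d (T : measurableType d) (R : realType) (mu : {measure set T -> \bar R})
    (f : T -> R) : mu.-integrable setT (fun x => (f x ^+ 2)%:E) -> sqint mu f.
Proof.
move=> /integrableP[_]; rewrite /sqint; congr (_ < _)%E; apply: eq_integral => x _.
by rewrite gee0_abs// lee_fin sqr_ge0.
Qed.

Lemma sqint_integrable d (T : measurableType d) (R : realType) (mu : {measure set T -> \bar R})
    (f : T -> R) : measurable_fun setT f -> sqint mu f ->
  mu.-integrable setT (fun x => (f x ^+ 2)%:E).
Proof. by move=> mf sf; have := integrable_sqM mf mf sf sf. Qed.

Section weakly_null.
Context d (T : measurableType d) (R : realType) (mu : {measure set T -> \bar R}).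
Variables (g : nat -> T -> R) (A : R).
Hypotheses (mg : forall k, measurable_fun setT (g k))
  (gA : forall k, (\int[mu]_x (g k x ^+ 2)%:E <= (A ^+ 2)%:E)%E).

Let sg k : sqint mu (g k).
Proof. exact: le_lt_trans (gA k) (ltry _). Qed.

Definition weakly_null (f : T -> R) : Prop :=
  [/\ measurable_fun setT f, sqint mu f &
      (fun k => \int[mu]_x (f x * g k x)) @ \oo --> (0 : R)].

Let int_null f k : weakly_null f -> mu.-integrable setT (EFin \o (fun x => f x * g k x)).
Proof. by move=> [mf sf _]; exact: integrable_sqM. Qed.

Lemma sqint_lincomb (a : R) (f h : T -> R) : measurable_fun setT f -> measurable_fun setT h ->
  sqint mu f -> sqint mu h -> sqint mu (fun x => a * f x + h x).
Proof.
move=> mf mh sf sh.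
have h1 := integrableZl measurableT (2 * a ^+ 2) (integrable_sqM mf mf sf sf).
have h2 := integrableZl measurableT 2 (integrable_sqM mh mh sh sh).
have /integrableP[mi] := integrableD measurableT h1 h2; apply: le_lt_trans.
apply: ge0_le_integral => //.
- by move=> x _; rewrite lee_fin sqr_ge0.
- apply/measurable_EFinP; apply: measurable_funX; apply: measurable_funD => //.
  exact: measurable_funM.
- exact: measurableT_comp.
- move=> x _; rewrite /= lee_fin.
  by apply: le_trans (ler_norm _); have := sqr_ge0 (a * f x - h x); nra.
Qed.

Lemma weakly_null_lincomb (a : R) f h : weakly_null f -> weakly_null h ->
  weakly_null (fun x => a * f x + h x).
Proof.
move=> nf nh; have [mf sf cf] := nf; have [mh sh ch] := nh; split.
- by apply: measurable_funD => //; exact: measurable_funM.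
- exact: sqint_lincomb.
- rewrite (_ : (fun k => _) =
    (fun k => a * \int[mu]_x (f x * g k x) + \int[mu]_x (h x * g k x))); last first.
    apply/funext => k; rewrite -RintegralZl//; last exact: int_null.
    rewrite -RintegralD//; [| |exact: int_null].
    + by apply: eq_Rintegral => x _; rewrite mulrDl mulrA.
    + by have := integrableZl measurableT a (int_null k nf); apply: eq_integrable.
  rewrite -[X in _ --> X](addr0 0) -[X in X + _](mulr0 a).
  by apply: cvgD => //; apply: cvgM => //; exact: cvg_cst.
Qed.

Lemma weakly_null0 : weakly_null (fun=> 0).
Proof.
split=> //.
- by rewrite /sqint; under eq_integral do rewrite expr0n; rewrite integral0.
- rewrite (_ : (fun k => _) = cst 0); first exact: cvg_cst.
  apply/funext => k; rewrite /Rintegral.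
  by under eq_integral do rewrite mul0r; rewrite integral0.
Qed.

(** The g_k are bounded in L^2, so pairing with them is continuous in L^2 uniformly in k; dominated
    convergence turns pointwise limits under a square integrable majorant into L^2 limits. This
    stability is what Dynkin's argument needs. *)
Lemma weakly_null_dominated (f : nat -> T -> R) (f0 h : T -> R) :
  (forall n, weakly_null (f n)) -> measurable_fun setT h -> sqint mu h ->
  (forall n x, `|f n x| <= h x) -> (forall x, (fun n => f n x) @ \oo --> f0 x) ->
  weakly_null f0.
Proof.
move=> nf mh sh fh ff0.
have mfn n : measurable_fun setT (f n) by have [] := nf n.
have mf0 : measurable_fun setT f0.
  by apply: (measurable_fun_cvg mfn) => x _; exact: ff0.
have f0h x : `|f0 x| <= h x.
  have fx : (fun n => `|f n x|) @ \oo --> `|f0 x| by apply: cvg_norm; exact: ff0.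
  rewrite -(cvg_lim _ fx)//.
  apply: limr_le; first by apply/cvg_ex; eexists; exact: fx.
  by apply: nearW => n; exact: fh.
have sf0 : sqint mu f0 by exact: sqint_le mf0 mh f0h sh.
split=> //.
pose D n x : R := f0 x - f n x.
have mD n : measurable_fun setT (D n) by exact: measurable_funB.
have Dh n x : `|D n x| <= 2 * h x.
  by rewrite mulrDl !mul1r; apply: le_trans (ler_normB _ _) _; exact: lerD.
have m2h : measurable_fun setT (fun x => 2 * h x) by exact: measurable_funM.
have s2h : sqint mu (fun x => 2 * h x).
  apply: integrable_sqint; have := integrableZl measurableT 4 (sqint_integrable mh sh).
  by apply: eq_integrable => // x _; rewrite -EFinM exprMn; congr (_ * _)%:E; ring.
have sD n : sqint mu (D n) by exact: sqint_le (mD n) m2h (Dh n) s2h.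
have D0 : (fun n => \int[mu]_x (D n x ^+ 2)) @ \oo --> (0 : R).
  have mD2 n : measurable_fun setT (fun x => (D n x ^+ 2)%:E).
    by apply/measurable_EFinP; exact: measurable_funX.
  have cD x : (fun n => (D n x ^+ 2)%:E) @ \oo --> 0%E.
    apply/cvg_EFin; first exact: nearW.
    have Dx : (fun n => D n x) @ \oo --> (0 : R).
      by rewrite -(subrr (f0 x)); apply: cvgB; [exact: cvg_cst|exact: ff0].
    by rewrite -[X in _ --> X](mulr0 (0 : R)); exact: (cvgM Dx Dx).
  have bD x n : (`|(D n x ^+ 2)%:E| <= ((2 * h x) ^+ 2)%:E)%E.
    rewrite abse_EFin lee_fin ger0_norm ?sqr_ge0// -(real_normK (num_real (D n x))).
    by rewrite lerXn2r// ?nnegrE// (le_trans _ (Dh n x)).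
  have [_ _ cI] := dominated_convergence measurableT mD2 (measurable_cst (0%E : \bar R))
    (aeW _ (fun x _ => cD x)) (sqint_integrable m2h s2h) (aeW _ (fun x n _ => bD x n)).
  by apply: fine_cvg; move: cI; rewrite integral0.
have i2 k : \int[mu]_x (g k x ^+ 2) <= A ^+ 2.
  rewrite -lee_fin /Rintegral fineK; first exact: gA.
  exact: integrable_fin_num (sqint_integrable (mg k) (sg k)).
apply/cvgrPdist_lt => e e0.
(* Adding 1 keeps the quotient meaningful when A = 0. *)
have e2 : 0 < (e / 2) ^+ 2 / (A ^+ 2 + 1).
  by rewrite divr_gt0 ?exprn_gt0 ?divr_gt0// ltr_pwDr ?sqr_ge0.
have /cvgrPdist_lt/(_ _ e2)[n _ /(_ n (leqnn _)) Dn] := D0.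
have [_ _ /cvgrPdist_lt/(_ (e / 2))] := nf n.
rewrite divr_gt0// => /(_ isT); apply: filterS => k.
rewrite !sub0r !normrN => fk.
have -> : \int[mu]_x (f0 x * g k x) = \int[mu]_x (f n x * g k x) + \int[mu]_x (D n x * g k x).
  rewrite -RintegralD//; [|exact: int_null|exact: integrable_sqM].
  by apply: eq_Rintegral => x _; rewrite -mulrDl /D addrC subrK.
apply: le_lt_trans (ler_normD _ _) _; rewrite [ltRHS]splitr ltrD//.
have Dn' : \int[mu]_x (D n x ^+ 2) * (A ^+ 2 + 1) < (e / 2) ^+ 2.
  rewrite -ltr_pdivlMr ?ltr_pwDr ?sqr_ge0//; move: Dn; rewrite sub0r normrN.
  by apply: le_lt_trans; exact: ler_norm.
have D00 : 0 <= \int[mu]_x (D n x ^+ 2) by apply: Rintegral_ge0 => x _; exact: sqr_ge0.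
have := cauchy_schwarz (mD n) (mg k) (sD n) (sg k) => CS.
rewrite -(@ltr_pXn2r _ 2) ?nnegrE ?divr_ge0 ?(ltW e0)// real_normK ?num_real//.
apply: le_lt_trans CS _; apply: le_lt_trans Dn'.
by rewrite ler_wpM2l// (le_trans (i2 k))// lerDl.
Qed.

End weakly_null.

Import HBSimple.
Import HBNNSimple.

Section weakly_null_spacetime.
Variables (R : realType) (g : nat -> spacetime R -> R) (A : R).
Hypotheses (mg : forall k, measurable_fun setT (g k))
  (gA : forall k, (\int[leb5]_x (g k x ^+ 2)%:E <= (A ^+ 2)%:E)%E).
Hypothesis base : forall (a b : spacetime R) n,
  weakly_null leb5 g (fun z => bump4 a.1 b.1 n z.1 * \1_(`]a.2, b.2[%classic) z.2).

Lemma leb5_box5_lty (a b : spacetime R) : (leb5 (box5 a b) < +oo)%E.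
Proof.
apply: product_measure1_lty; [exact: measurable_box4|exact: measurable_itv| |].
- exact: leb4_box4_lty.
- exact: lebesgue_itv_oo_lty.
Qed.

Lemma measurable_indic_box5 (a b : spacetime R) :
  measurable_fun setT (\1_(box5 a b) : spacetime R -> R).
Proof. by apply: measurable_indic; exact: measurable_box5. Qed.

Lemma sqint_indic_box5 (a b : spacetime R) : sqint leb5 (\1_(box5 a b) : spacetime R -> R).
Proof.
apply: (sqint_bounded (A := box5 a b) (M := 1)) => //.
- exact: measurable_indic_box5.
- exact: measurable_box5.
- exact: leb5_box5_lty.
- by move=> x; rewrite indicE; case: (_ \in _); rewrite ?normr1 ?normr0.
- by move=> x nx; rewrite indicE memNset.
Qed.

Let null_box (a b : spacetime R) : weakly_null leb5 g (\1_(box5 a b)).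
Proof.
apply: (weakly_null_dominated mg gA (base a b) (measurable_indic_box5 a b) (sqint_indic_box5 a b)).
- move=> n z; have b0 := bump4_ge0 a.1 b.1 n z.1; have b1 := bump4_le1 a.1 b.1 n z.1.
  have [z1|nz1] := pselect (box4 a.1 b.1 z.1); last by rewrite bump4_eq0// mul0r normr0 indicE.
  rewrite !indicE in_setX (mem_set z1)/= normrM ger0_norm//.
  by case: (_ \in _) => /=; rewrite ?normr1 ?normr0 ?mulr0 ?mulr1.
- move=> z; rewrite [in X in _ --> X]indicE in_setX -mulnb natrM -!indicE.
  apply: cvgM; [exact: cvg_bump4|exact: cvg_cst].
Qed.

Lemma weakly_null_sum (I : Type) (r : seq I) (c : I -> R) (f : I -> spacetime R -> R) :
  (forall i, weakly_null leb5 g (f i)) ->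
  weakly_null leb5 g (fun x => \sum_(i <- r) c i * f i x).
Proof.
move=> nf; elim: r => [|i r IHr].
  by under eq_fun do rewrite big_nil; exact: weakly_null0.
by under eq_fun do rewrite big_cons; exact: (weakly_null_lincomb mg gA (c i) (nf i) IHr).
Qed.

(** Dynkin's argument relative to a fixed box, which keeps every indicator square integrable. *)
Let null_measurable (a b : spacetime R) (S : set (spacetime R)) : measurable S ->
  weakly_null leb5 g (\1_(S `&` box5 a b)).
Proof.
set D := box5 a b; rewrite measurable_box5E.
have inD x E : (x \in E `&` D) = (x \in E) && (x \in D) by exact: in_setI.
apply: (@dynkin_induction _ _ (@boxes5 R) (fun S => weakly_null leb5 g (\1_(S `&` D)))
    (@measurable_box5E R)).
- exact: setI_closed_boxes5.
- by rewrite setTI; exact: null_box.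
- move=> _ [c [e ->]].
  have [c' [e' ->]] : boxes5 (box5 c e `&` D).
    by apply: setI_closed_boxes5; [exists c, e|exists a, b].
  exact: null_box.
- move=> {}S _ nS; have := weakly_null_lincomb mg gA (-1) nS (null_box a b).
  congr (weakly_null _ _ _); apply/funext => x; rewrite mulN1r !indicE -/D !inD in_setC.
  by case: (x \in S); case: (x \in D); rewrite /= ?addNr ?oppr0 ?add0r.
- move=> F mF tF nF.
  (* The factor 1 fits the form of [weakly_null_sum]. By disjointness the partial sum is itself an
     indicator, bounded by that of the box. *)
  pose f n x : R := \sum_(i < n) 1 * \1_(F i `&` D) x.
  have fE n x : f n x = \1_([set y | exists2 i, (i < n)%N & F i y] `&` D) x.
    elim: n => [|n IHn].
      rewrite /f big_ord0 indicE memNset// => -[[i]]; by rewrite ltn0.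
    rewrite /f big_ord_recr/= -/(f n x) IHn mul1r !indicE !inD.
    have [Dx|] := boolP (x \in D); rewrite ?andbF ?addr0// !andbT.
    have [/set_mem Fx|nFx] := boolP (x \in F n).
      rewrite memNset ?mem_set ?add0r//=; first by exists n.
      move=> [i ni Fi]; have /trivIsetP/(_ n i I I) := tF; rewrite gtn_eqF// => /(_ isT).
      by move/seteqP => [/(_ x) + _] => /(_ (conj Fx Fi)).
    rewrite addr0; congr (_%:R); congr nat_of_bool; apply/idP/idP => /set_mem[i ni Fi]; rewrite inE.
      by exists i => //; exact: ltnW.
    exists i => //; move: ni; rewrite ltnS leq_eqVlt => /predU1P[ein|//].
    by move: nFx; rewrite -ein mem_set.
  apply: (@weakly_null_dominated _ _ _ _ _ _ mg gA f _ (\1_D)).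
  + move=> n; exact: weakly_null_sum.
  + exact: measurable_indic_box5.
  + exact: sqint_indic_box5.
  + move=> n x; rewrite fE ger0_norm// !indicE inD; by case: (_ \in _) => //=; case: (_ \in _).
  + move=> x; apply: cvg_near_cst.
    have [[[i _ Fi] Dx]|nx] := pselect ((\bigcup_k F k `&` D) x).
      exists i.+1 => // n /= ni; rewrite fE !indicE !mem_set//.
      + by split => //; exists i.
      + by split => //; exists i.
    apply: nearW => n; rewrite fE !indicE !memNset// => -[[i _ Fi] Dx]; apply: nx.
    by split => //; exists i.
Qed.

(** Products of a spatial bump and a time indicator suffice as base class, since integration by
    parts in x asks for no smoothness in t. Limits of bumps give boxes, Dynkin's argument gives
    bounded measurable sets, simple functions cut off to growing boxes give every nonnegative f, and
    the two signs are treated separately. *)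
Lemma weakly_null_all (f : spacetime R -> R) : measurable_fun setT f -> sqint leb5 f ->
  weakly_null leb5 g f.
Proof.
suff nonneg (h : spacetime R -> R) : measurable_fun setT h -> (forall x, 0 <= h x) ->
    sqint leb5 h -> weakly_null leb5 g h.
  move=> mf sf.
  have mM (h : spacetime R -> R) : measurable_fun setT h -> measurable_fun setT (fun x => Num.max (h x) 0).
    by move=> mh; exact: measurable_maxr.
  have mN : measurable_fun setT (fun x => - f x) by exact: measurableT_comp.
  have np : weakly_null leb5 g (fun x => Num.max (f x) 0).
    apply: nonneg => [|x|]; [exact: mM|by rewrite le_max lexx orbT|].
    have mnf : measurable_fun setT (fun x => `|f x|) by exact: measurableT_comp.
    apply: (sqint_le (mM _ mf) mnf) => [x|].
      by rewrite ger0_norm ?le_max ?lexx ?orbT// ge_max ler_norm normr_ge0.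
    by rewrite /sqint; under eq_integral do rewrite real_normK ?num_real//.
  have nn : weakly_null leb5 g (fun x => Num.max (- f x) 0).
    apply: nonneg => [|x|]; [exact: mM|by rewrite le_max lexx orbT|].
    have mnf : measurable_fun setT (fun x => `|f x|) by exact: measurableT_comp.
    apply: (sqint_le (mM _ mN) mnf) => [x|].
      by rewrite ger0_norm ?le_max ?lexx ?orbT// ge_max -normrN ler_norm normr_ge0.
    by rewrite /sqint; under eq_integral do rewrite real_normK ?num_real//.
  have := weakly_null_lincomb mg gA (-1) nn np; congr (weakly_null _ _ _).
  apply/funext => x; rewrite mulN1r; have [fx|fx] := leP (f x) 0.
    by rewrite max_l ?oppr_ge0// opprK addr0.
  by rewrite max_r ?oppr_le0 ?(ltW fx)// oppr0 add0r.
move=> mh h0 sh.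
have mEh : measurable_fun setT (EFin \o h) by exact/measurable_EFinP.
pose p := nnsfun_approx measurableT mEh.
pose D (n : nat) := box5 (@cst5 R (- n%:R)) (cst5 n%:R).
have ph (x : spacetime R) : (fun n => p n x) @ \oo --> h x.
  have cE : (fun n => (p n x)%:E) @ \oo --> (h x)%:E.
    by apply: (@cvg_nnsfun_approx _ _ _ _ measurableT _ mEh) => // y _; rewrite /= lee_fin.
  exact: (fine_cvg cE).
have ple n (x : spacetime R) : p n x <= h x.
  have nd : nondecreasing_seq (fun n => p n x) by move=> i j ij; exact/lefP/nd_nnsfun_approx.
  rewrite -(cvg_lim _ (ph x))//; apply: nondecreasing_cvgn_le => //.
  by apply/cvg_ex; eexists; exact: ph.
have D1 (x : spacetime R) : (fun n => \1_(D n) x : R) @ \oo --> (1 : R).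
  have [n _ nx] : (\bigcup_n D n) x by rewrite box5_cover.
  apply: cvg_near_cst; exists n => // m /= nm; rewrite indicE mem_set//.
  move: nx => [h1 h2]; split; first exact: box4_mono nm _ h1.
  exact: itv_oo_mono nm _ h2.
apply: (@weakly_null_dominated _ _ _ _ _ _ mg gA (fun n (x : spacetime R) => p n x * \1_(D n) x) _ h) => //.
- move=> n.
  have [s sE] : exists s : seq R, forall x : spacetime R,
      p n x = \sum_(y <- s) y * \1_(p n @^-1` [set y]) x.
    by eexists => x; rewrite {1}fimfunE fsbig_finite.
  have -> : (fun x : spacetime R => p n x * \1_(D n) x) =
      (fun x => \sum_(y <- s) y * \1_((p n @^-1` [set y]) `&` D n) x).
    apply/funext => x; rewrite {1}sE mulr_suml.
    by apply: eq_bigr => y _; rewrite -mulrA indicI.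
  apply: (weakly_null_sum _ id) => y; apply: null_measurable; exact: measurable_funPTI.
- move=> n x; rewrite ger0_norm ?mulr_ge0//; apply: le_trans (ple n x).
  by rewrite ler_piMr// indicE; case: (_ \in _).
- by move=> x; rewrite -[X in _ --> X]mulr1; apply: cvgM.
Qed.

End weakly_null_spacetime.

(** * Vanishing products, mixed norms, weak gradients *)

(** Each term on the right becomes small for its own reason: a^3 is bounded in L^1 and r is large,
    the part of b^3 where b exceeds N has small integral for large N, and the a of the last term
    tends to 0 in local L^1. The cases are b <= N, b <= a / r and a < r b. *)
Lemma cubic_young (R : realType) (r N a b : R) : 1 <= r -> 0 <= N -> 0 <= a -> 0 <= b ->
  a ^+ 2 * b + a * b ^+ 2
  <= 2 * r^-1 * a ^+ 3 + 2 * r ^+ 2 * (b ^+ 3 * (N < b)%R%:R) + ((N + 1) ^+ 2 * r + N ^+ 2) * a.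
Proof.
move=> r1 N0 a0 b0; have r0 : 0 < r by lra.
set y := r^-1; have y0 : 0 < y by rewrite invr_gt0.
have ry : r * y = 1 by rewrite mulfV// gt_eqF.
have y1 : y <= 1 by rewrite invf_le1.
have a3 : 0 <= a ^+ 3 by rewrite exprn_ge0.
have b3 : 0 <= b ^+ 3 by rewrite exprn_ge0.
have [bN|Nb] := leP b N; rewrite ?mulr0 ?mulr1 ?addr0.
  have h1 : a ^+ 2 * b + a * b ^+ 2 <= a ^+ 2 * N + a * N ^+ 2.
    by rewrite lerD// ler_wpM2l ?sqr_ge0// lerXn2r.
  apply: (le_trans h1); rewrite -subr_ge0.
  have [u u0 ue] : exists2 u : R, 0 <= u & a = r * u.
    by exists (y * a); rewrite ?mulr_ge0 ?(ltW y0)// mulrA ry mul1r.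
  have -> : 2 * y * a ^+ 3 + ((N + 1) ^+ 2 * r + N ^+ 2) * a - (a ^+ 2 * N + a * N ^+ 2)
    = a * r * (2 * u ^+ 2 * (r * y) - N * u + (N + 1) ^+ 2) by rewrite ue; ring.
  rewrite ry mulr1 !mulr_ge0 ?(ltW r0)//.
  by have := sqr_ge0 (u - N / 2); nra.
have C0 : 0 <= ((N + 1) ^+ 2 * r + N ^+ 2) * a.
  by rewrite mulr_ge0// addr_ge0 ?sqr_ge0// mulr_ge0 ?sqr_ge0// ltW.
have [ba|ab] := leP b (y * a).
  have h1 : a ^+ 2 * b <= a ^+ 2 * (y * a) by rewrite ler_wpM2l ?sqr_ge0.
  have h2 : a * b ^+ 2 <= a * (y * a) ^+ 2 by rewrite ler_wpM2l// lerXn2r// nnegrE mulr_ge0 ?(ltW y0).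
  have h3 : a * (y * a) ^+ 2 <= y * a ^+ 3.
    rewrite (_ : a * _ = y * (y * a ^+ 3)); last by ring.
    by rewrite ler_pM2l// ler_piMl.
  have : 0 <= 2 * r ^+ 2 * b ^+ 3 by apply: mulr_ge0 => //; rewrite mulr_ge0// sqr_ge0.
  have h4 : a ^+ 2 * (y * a) = y * a ^+ 3 by ring.
  by move: h1 h2 h3 C0; rewrite h4; lra.
have arb : a <= r * b by rewrite -(mul1r a) -ry -mulrA ler_wpM2l ?(ltW r0)// ltW.
have rb0 : 0 <= r * b by rewrite mulr_ge0 ?(ltW r0).
have h1 : a ^+ 2 * b <= (r * b) ^+ 2 * b by rewrite ler_wpM2r// lerXn2r.
have h2 : a * b ^+ 2 <= r * b * b ^+ 2 by rewrite ler_wpM2r ?sqr_ge0.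
have h3 : r * b ^+ 3 <= r ^+ 2 * b ^+ 3 by rewrite ler_wpM2r// expr2 ler_peMl// ltW.
have : 0 <= 2 * y * a ^+ 3 by apply: mulr_ge0 => //; rewrite mulr_ge0// ltW.
have e1 : (r * b) ^+ 2 * b = r ^+ 2 * b ^+ 3 by ring.
have e2 : r * b * b ^+ 2 = r * b ^+ 3 by ring.
by move: h1 h2 h3 C0; rewrite e1 e2; lra.
Qed.

(** Meant for c = |V + W| with p = |V| and q = |W|: the two triangle inequalities pinch c^3 between
    |p - q|^3 and (p + q)^3. *)
Lemma cubic_difference (R : realType) (p q c : R) : 0 <= p -> 0 <= q ->
  `|p - q| <= c -> c <= p + q ->
  `|c ^+ 3 - p ^+ 3 - q ^+ 3| <= 3 * (p ^+ 2 * q + p * q ^+ 2).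
Proof.
move=> p0 q0 pqc cpq; have c0 : 0 <= c by exact: le_trans pqc.
have h1 : c ^+ 3 <= (p + q) ^+ 3 by rewrite lerXn2r ?nnegrE ?addr_ge0.
have h2 : `|p - q| ^+ 3 <= c ^+ 3 by rewrite lerXn2r ?nnegrE.
have pp : 0 <= p ^+ 2 * q by rewrite mulr_ge0 ?sqr_ge0.
have qq : 0 <= p * q ^+ 2 by rewrite mulr_ge0 ?sqr_ge0.
have e : (p + q) ^+ 3 = p ^+ 3 + q ^+ 3 + 3 * (p ^+ 2 * q + p * q ^+ 2) by ring.
rewrite ler_norml; apply/andP; split; last by lra.
have [qp|pq] := leP q p.
  move: h2; rewrite ger0_norm ?subr_ge0//.
  have : q ^+ 3 <= p * q ^+ 2 by rewrite exprS ler_wpM2r ?sqr_ge0.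
  have -> : (p - q) ^+ 3 = p ^+ 3 - q ^+ 3 - 3 * (p ^+ 2 * q) + 3 * (p * q ^+ 2) by ring.
  by lra.
move: h2; rewrite ler0_norm ?subr_le0 ?(ltW pq)// opprB.
have : p ^+ 3 <= p ^+ 2 * q by rewrite exprSr ler_wpM2l ?sqr_ge0// ltW.
have -> : (q - p) ^+ 3 = q ^+ 3 - p ^+ 3 + 3 * (p ^+ 2 * q) - 3 * (p * q ^+ 2) by ring.
by lra.
Qed.

Section vanishing_products.
Context d (T : measurableType d) (R : realType) (mu : {measure set T -> \bar R}).
Variables (w b : T -> R) (a : nat -> T -> R) (A : R).
Hypotheses (mw : measurable_fun setT w) (mb : measurable_fun setT b)
  (ma : forall k, measurable_fun setT (a k)).
Hypotheses (w01 : forall x, 0 <= w x <= 1) (b0 : forall x, 0 <= b x)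
  (a0 : forall k x, 0 <= a k x).
Hypothesis a3 : forall k, (\int[mu]_x (a k x ^+ 3)%:E <= A%:E)%E.
Hypothesis b3 : (\int[mu]_x (b x ^+ 3)%:E < +oo)%E.
Hypothesis wa : (fun k => \int[mu]_x (w x * a k x)%:E)%E @ \oo --> 0%E.

Let w0 x : 0 <= w x. Proof. by have /andP[] := w01 x. Qed.
Let w1 x : w x <= 1. Proof. by have /andP[] := w01 x. Qed.

Let A0 : 0 <= A.
Proof.
rewrite -lee_fin; apply: le_trans (a3 0%N); apply: integral_ge0 => x _.
by rewrite lee_fin exprn_ge0.
Qed.

Let ma3 k : measurable_fun setT (fun x => (a k x ^+ 3)%:E).
Proof. by apply/measurable_EFinP; exact: measurable_funX. Qed.

Let mwa k : measurable_fun setT (fun x => (w x * a k x)%:E).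
Proof. by apply/measurable_EFinP; exact: measurable_funM. Qed.

Let split_bound (k : nat) (f : T -> R) (beta : T -> R) (c1 c2 c3 e1 e2 e3 : R) :
  measurable_fun setT f -> (forall x, 0 <= f x) -> measurable_fun setT beta ->
  (forall x, 0 <= beta x) -> 0 <= c1 -> 0 <= c2 -> 0 <= c3 ->
  (forall x, f x <= c1 * a k x ^+ 3 + c2 * beta x + c3 * (w x * a k x)) ->
  c1 * A <= e1 -> (c2%:E * \int[mu]_x (beta x)%:E <= e2%:E)%E ->
  (c3%:E * \int[mu]_x (w x * a k x)%:E <= e3%:E)%E ->
  (\int[mu]_x (f x)%:E <= (e1 + e2 + e3)%:E)%E.
Proof.
move=> mf f0 mbeta beta0 c10 c20 c30 fle h1 h2 h3.
apply: (@le_trans _ _ (\int[mu]_x (c1%:E * (a k x ^+ 3)%:E + c2%:E * (beta x)%:E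
    + c3%:E * (w x * a k x)%:E))%E).
  apply: ge0_le_integral => //.
  - by move=> x _; rewrite lee_fin.
  - exact/measurable_EFinP.
  - apply: emeasurable_funD; last by apply: emeasurable_funM.
    by apply: emeasurable_funD; apply: emeasurable_funM => //; exact/measurable_EFinP.
  - by move=> x _; rewrite -!EFinM -!EFinD lee_fin; exact: fle.
have p1 x : (0 <= c1%:E * (a k x ^+ 3)%:E)%E by rewrite -EFinM lee_fin mulr_ge0// exprn_ge0.
have p2 x : (0 <= c2%:E * (beta x)%:E)%E by rewrite -EFinM lee_fin mulr_ge0.
have p3 x : (0 <= c3%:E * (w x * a k x)%:E)%E by rewrite -EFinM lee_fin !mulr_ge0.
have q1 : measurable_fun setT (fun x => c1%:E * (a k x ^+ 3)%:E)%E by exact: emeasurable_funM.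
have q2 : measurable_fun setT (fun x => c2%:E * (beta x)%:E)%E.
  by apply: emeasurable_funM => //; exact/measurable_EFinP.
have q3 : measurable_fun setT (fun x => c3%:E * (w x * a k x)%:E)%E by exact: emeasurable_funM.
rewrite ge0_integralD//; last 2 first.
- by move=> x _; exact: adde_ge0.
- exact: emeasurable_funD.
have mbE : measurable_fun setT (fun x => (beta x)%:E) by exact/measurable_EFinP.
have pb x : (0 <= (beta x)%:E)%E by rewrite lee_fin.
have pa x : (0 <= (a k x ^+ 3)%:E)%E by rewrite lee_fin exprn_ge0.
have pw x : (0 <= (w x * a k x)%:E)%E by rewrite lee_fin mulr_ge0.
rewrite ge0_integralD// !ge0_integralZl//.
rewrite !EFinD leeD// leeD//; apply: (@le_trans _ _ (c1 * A)%:E); last by rewrite lee_fin.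
by rewrite EFinM lee_wpmul2l.
Qed.

(** Interpolation of L^2 between L^1, where the sequence vanishes locally, and L^3, where it is
    bounded: a^2 <= a^3 / r + r a, with r so large that A / r <= e / 2. *)
Lemma vanishing_squares (e : R) : 0 < e ->
  \forall k \near \oo, (\int[mu]_x (w x * a k x ^+ 2)%:E <= e%:E)%E.
Proof.
move=> e0; pose r := 1 + 2 * A / e.
have r1 : 1 <= r by rewrite lerDl divr_ge0 ?mulr_ge0 ?(ltW e0).
have r0 : 0 < r by lra.
have er : 0 < e / (2 * r) by rewrite divr_gt0// mulr_gt0.
have : ((0%:E : \bar R) < (e / (2 * r))%:E)%E by rewrite lte_fin.
move=> /(cvge_lt wa); apply: filterS => k hk.
rewrite (_ : e = e / 2 + 0 + e / 2); last by lra.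
apply: (@split_bound k _ (fun=> 0) r^-1 0 r) => //.
- by apply: measurable_funM => //; exact: measurable_funX.
- by move=> x; rewrite mulr_ge0 ?sqr_ge0.
- by rewrite invr_ge0 ltW.
- exact: ltW.
- move=> x; rewrite mul0r addr0.
  apply: (@le_trans _ _ (w x * (r^-1 * a k x ^+ 3 + r * a k x))).
    rewrite ler_wpM2l// -subr_ge0.
    have -> : r^-1 * a k x ^+ 3 + r * a k x - a k x ^+ 2
      = a k x * (r^-1 * (a k x ^+ 2 - r * a k x + r ^+ 2)) by field; rewrite gt_eqF.
    rewrite !mulr_ge0 ?invr_ge0 ?(ltW r0)//.
    by have := sqr_ge0 (a k x - r / 2); nra.
  have : w x * (r^-1 * a k x ^+ 3) <= r^-1 * a k x ^+ 3.
    by rewrite ler_piMl// mulr_ge0 ?invr_ge0 ?exprn_ge0 ?(ltW r0).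
  by have := a0 k x; lra.
- rewrite mulrC ler_pdivrMr// /r; have := divfK (lt0r_neq0 e0) (2 * A); set y := _ / e.
  by move=> ye; nra.
- by rewrite mul0e.
- apply: (@le_trans _ _ (r%:E * (e / (2 * r))%:E)%E).
    by rewrite lee_wpmul2l ?lee_fin ?(ltW r0)// ltW.
  by rewrite -EFinM lee_fin le_eqVlt; apply/orP; left; apply/eqP; field; rewrite gt_eqF.
Qed.

(** The parameters are chosen in order: r from the L^3 bound so that 2 A / r <= e / 3, then n to
    make the tail of b^3 small against r^2, and only then k, once the coefficient C of the linear
    term is fixed. *)
Lemma vanishing_products (e : R) : 0 < e -> \forall k \near \oo,
  (\int[mu]_x (w x * (a k x ^+ 2 * b x + a k x * b x ^+ 2))%:E <= e%:E)%E.
Proof.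
move=> e0; pose r := 1 + 6 * A / e.
have r1 : 1 <= r by rewrite lerDl divr_ge0 ?mulr_ge0 ?(ltW e0).
have r0 : 0 < r by lra.
pose beta (n : nat) x : R := b x ^+ 3 * (n%:R < b x)%R%:R.
have mbeta n : measurable_fun setT (beta n).
  apply: measurable_funM; first exact: measurable_funX.
  rewrite (_ : (fun x => _) = \1_(setT `&` b @^-1` `]n%:R, +oo[)).
    by apply: measurable_indic; apply: mb => //; exact: measurable_itv.
  apply/funext => x; rewrite indicE setTI; congr (_%:R); congr nat_of_bool.
  by apply/idP/idP; rewrite inE/= in_itv/= andbT.
have beta0 n x : 0 <= beta n x by rewrite mulr_ge0 ?exprn_ge0.
have cbeta : (fun n => \int[mu]_x (beta n x)%:E)%E @ \oo --> 0%E.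
  have mbn n : measurable_fun setT (fun x => (beta n x)%:E) by exact/measurable_EFinP.
  have mb3 : measurable_fun setT (fun x => (b x ^+ 3)%:E).
    by apply/measurable_EFinP; exact: measurable_funX.
  have ib3 : mu.-integrable setT (fun x => (b x ^+ 3)%:E).
    apply/integrableP; split => //.
    by under eq_integral do rewrite gee0_abs ?lee_fin ?exprn_ge0//.
  have cb x : (fun n => (beta n x)%:E) @ \oo --> 0%E.
    apply: cvg_near_cst; exists (Num.truncn (b x)).+1 => // n /= nb.
    rewrite /beta ltNge ltW ?mulr0// (lt_le_trans (truncnS_gt _))// ler_nat//.
  have db x n : (`|(beta n x)%:E| <= (b x ^+ 3)%:E)%E.
    rewrite abse_EFin lee_fin ger0_norm// ler_piMr ?exprn_ge0//; by case: (_ < _).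
  have [_ _] := dominated_convergence measurableT mbn (measurable_cst (0%E : \bar R))
    (aeW _ (fun x _ => cb x)) ib3 (aeW _ (fun x n _ => db x n)).
  by rewrite integral0.
have eb : 0 < e / (6 * r ^+ 2) by rewrite divr_gt0// mulr_gt0// exprn_gt0.
have [n _ /(_ n (leqnn _)) bn] : \forall n \near \oo, (\int[mu]_x (beta n x)%:E < (e / (6 * r ^+ 2))%:E)%E.
  by apply: (cvge_lt cbeta); rewrite lte_fin.
pose C : R := (n%:R + 1) ^+ 2 * r + n%:R ^+ 2.
have C0 : 0 < C by rewrite ltr_pwDl ?sqr_ge0// mulr_gt0// exprn_gt0// ltr_wpDl.
have : ((0%:E : \bar R) < (e / (3 * C))%:E)%E by rewrite lte_fin divr_gt0// mulr_gt0.
move=> /(cvge_lt wa); apply: filterS => k hk.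
rewrite (_ : e = e / 3 + e / 3 + e / 3); last by lra.
apply: (@split_bound k _ (beta n) (2 * r^-1) (2 * r ^+ 2) C) => //.
- apply: measurable_funM => //; apply: measurable_funD; apply: measurable_funM => //; exact: measurable_funX.
- by move=> x; rewrite mulr_ge0// addr_ge0// mulr_ge0// sqr_ge0.
- by rewrite mulr_ge0// invr_ge0 ltW.
- by rewrite mulr_ge0// sqr_ge0.
- exact: ltW.
- move=> x; have cy := cubic_young r1 (ler0n R n) (a0 k x) (b0 x).
  rewrite -/(beta n x) -/C in cy.
  apply: (le_trans (ler_wpM2l (w0 x) cy)); rewrite 2!mulrDr.
  rewrite [w x * (C * _)]mulrCA lerD2r lerD// ler_piMl//.
  + by apply: mulr_ge0; [rewrite mulr_ge0// invr_ge0 ltW|exact: exprn_ge0].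
  + by apply: mulr_ge0; [rewrite mulr_ge0// sqr_ge0|exact: beta0].
- rewrite -mulrA mulrCA ler_pdivrMl// /r; have := divfK (lt0r_neq0 e0) (6 * A); set y := _ / e.
  by move=> ye; nra.
- apply: (@le_trans _ _ ((2 * r ^+ 2)%:E * (e / (6 * r ^+ 2))%:E)%E).
    by rewrite lee_wpmul2l ?lee_fin ?mulr_ge0 ?sqr_ge0// ltW.
  by rewrite -EFinM lee_fin le_eqVlt; apply/orP; left; apply/eqP; field; rewrite gt_eqF.
- apply: (@le_trans _ _ (C%:E * (e / (3 * C))%:E)%E).
    by rewrite lee_wpmul2l ?lee_fin ?(ltW C0)// ltW.
  by rewrite -EFinM lee_fin le_eqVlt; apply/orP; left; apply/eqP; field; rewrite gt_eqF.
Qed.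

End vanishing_products.

Section mixed_norms.
Variables (R : realType) (m n : nat).
Local Notation l := (@lebesgue_measure R).
Implicit Types (Q : set (spacetime R)) (f : spacetime R -> 'M[R]_(m, n)).

Lemma poweR2_Lnorm2 d (T : measurableType d) (mu : {measure set T -> \bar R}) (h : T -> R) :
  (Lnorm mu 2%:E (fun x => (h x)%:E) `^ 2 = \int[mu]_x (h x ^+ 2)%:E)%E.
Proof.
rewrite poweR_Lnorm//; apply: eq_integral => x _.
by rewrite abse_EFin poweR_EFin powR_mulrn// real_normK ?num_real.
Qed.

Lemma le_poweR2 (x : \bar R) (M : R) : 0 <= M -> (0 <= x)%E ->
  (x `^ 2 <= (M ^+ 2)%:E)%E = (x <= M%:E)%E.
Proof.
move=> M0; case: x => [r| |]//; last by rewrite poweRyr// !leye_eq.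
by rewrite poweR_EFin !lee_fin => r0; rewrite powR_mulrn// ler_pXn2r// nnegrE.
Qed.

Lemma mixed_norm22_le Q f (M : R) :
  measurable_fun setT (fun z => frob (f z) * \1_Q z) -> 0 <= M ->
  (mixed_norm 2%:E 2%:E Q f <= M%:E)%E ->
  (\int[leb5]_z ((frob (f z) * \1_Q z) ^+ 2)%:E <= (M ^+ 2)%:E)%E.
Proof.
move=> mf M0; rewrite -le_poweR2//; last exact: Lnorm_ge0.
rewrite /mixed_norm poweR_Lnorm// tonelli5//.
- congr (_ <= _)%E; apply: eq_integral => t _.
  by rewrite gee0_abs ?Lnorm_ge0// poweR2_Lnorm2.
- by apply/measurable_EFinP; exact: measurable_funX.
- by move=> z; rewrite lee_fin sqr_ge0.
Qed.

(** The essential supremum is at most M exactly when almost every slice obeys the bound; squaring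
    replaces the L^2 norm of a slice by an integral. *)
Lemma mixed_norm_oo2_le Q f (M : R) : 0 <= M ->
  (mixed_norm +oo 2%:E Q f <= M%:E)%E <->
  {ae l, forall t, (\int[leb4]_x ((frob (f (x, t)) * \1_Q (x, t)) ^+ 2)%:E <= (M ^+ 2)%:E)%E}.
Proof.
(* The norm with exponent [+oo] is defined by cases on whether the whole space has positive
   measure. *)
move=> M0; have l0 : (0 < l setT)%E.
  by rewrite -set_itvNyy lebesgue_measure_itv/= ltry.
have E (t : R) : (`|Lnorm leb4 2%:E (fun x => (frob (f (x, t)) * \1_Q (x, t))%:E)| <= M%:E)%E
    = (\int[leb4]_x ((frob (f (x, t)) * \1_Q (x, t)) ^+ 2)%:E <= (M ^+ 2)%:E)%E.
  by rewrite gee0_abs ?Lnorm_ge0// -le_poweR2 ?Lnorm_ge0// poweR2_Lnorm2.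
have LooE (h : measurableTypeR R -> \bar R) : Lnorm l +oo h = ess_sup l (abse \o h).
  by rewrite unlock l0.
rewrite /mixed_norm LooE; split.
- move=> /ess_supP H; apply: (aeS H) => t; by rewrite /= E.
- move=> H; apply/ess_supP; apply: (aeS H) => t; by rewrite /= E.
Qed.

End mixed_norms.

Section weak_gradient_rules.
Variables (R : realType) (m : nat).
Implicit Types (v w : space4 R -> 'cV[R]_m) (Dv Dw : space4 R -> 'M[R]_(m, 4)).

Lemma sqint_bounded_mul d (T : measurableType d) (mu : {measure set T -> \bar R})
    (f g : T -> R) (M : R) : measurable_fun setT f -> measurable_fun setT g ->
  (forall x, `|f x| <= M) -> sqint mu g -> sqint mu (fun x => f x * g x).
Proof.
move=> mf mg fM sg; have sMg : sqint mu (fun x => M * `|g x|).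
  apply: integrable_sqint; have := integrableZl measurableT (M ^+ 2) (sqint_integrable mg sg).
  by apply: eq_integrable => // x _; rewrite -EFinM exprMn real_normK ?num_real.
apply: (sqint_le _ _ _ sMg); first exact: measurable_funM.
  by apply: measurable_funM => //; exact: measurableT_comp.
by move=> x; rewrite normrM ler_wpM2r.
Qed.

Let int1 (f g : space4 R -> R) : measurable_fun setT f -> measurable_fun setT g ->
  sqint leb4 f -> sqint leb4 g -> leb4.-integrable setT (EFin \o (fun x => f x * g x)).
Proof. exact: integrable_sqM. Qed.

Lemma weak_gradB v Dv w Dw :
  (forall i, measurable_fun setT (fun x => v x i ord0)) ->
  (forall i, sqint leb4 (fun x => v x i ord0)) ->
  (forall i j, measurable_fun setT (fun x => Dv x i j)) ->
  (forall i j, sqint leb4 (fun x => Dv x i j)) ->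
  (forall i, measurable_fun setT (fun x => w x i ord0)) ->
  (forall i, sqint leb4 (fun x => w x i ord0)) ->
  (forall i j, measurable_fun setT (fun x => Dw x i j)) ->
  (forall i j, sqint leb4 (fun x => Dw x i j)) ->
  weak_grad v Dv -> weak_grad w Dw ->
  weak_grad (fun x => v x - w x) (fun x => Dv x - Dw x).
Proof.
move=> mv sv mDv sDv mw sw mDw sDw Hv Hw eta teta i j.
have [mt st] := (measurable_test teta, sqint_test teta).
have [mdt sdt] := (measurable_derive_test (basis4 R j) teta, sqint_derive_test (basis4 R j) teta).
transitivity (\int[leb4]_x (v x i ord0 * 'D_(basis4 R j) eta x)
    - \int[leb4]_x (w x i ord0 * 'D_(basis4 R j) eta x)).
  rewrite -RintegralB//; [|exact: int1|exact: int1].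
  by apply: eq_Rintegral => x _; rewrite !mxE mulrBl.
rewrite Hv// Hw// opprK addrC -opprB; congr (- _).
rewrite -RintegralB//; [|exact: int1|exact: int1].
by apply: eq_Rintegral => x _; rewrite !mxE mulrBl.
Qed.

(** Testing v with psi eta, and taking the term where the derivative falls on psi to the other side,
    yields the product rule. *)
Lemma weak_gradM v Dv (psi : space4 R -> R) : test_function psi ->
  (forall i, measurable_fun setT (fun x => v x i ord0)) ->
  (forall i, sqint leb4 (fun x => v x i ord0)) ->
  (forall i j, measurable_fun setT (fun x => Dv x i j)) ->
  (forall i j, sqint leb4 (fun x => Dv x i j)) ->
  weak_grad v Dv ->
  weak_grad (fun x => psi x *: v x)
    (fun x => \matrix_(i, j) (psi x * Dv x i j + v x i ord0 * 'D_(basis4 R j) psi x)).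
Proof.
move=> tpsi mv sv mDv sDv Hv eta teta i j.
have tpe : test_function (fun x => psi x * eta x) by apply: test_functionM => //; case: tpsi.
set e := basis4 R j.
have [mpe spe] := (measurable_test tpe, sqint_test tpe).
have [mdpe sdpe] := (measurable_derive_test e tpe, sqint_derive_test e tpe).
have mdp := measurable_derive_test e tpsi; have me := measurable_test teta.
have [M eM] := test_function_bounded teta.
have mde : measurable_fun setT (fun x => eta x * 'D_e psi x) by exact: measurable_funM.
have sde : sqint leb4 (fun x => eta x * 'D_e psi x).
  exact: sqint_bounded_mul me mdp eM (sqint_derive_test e tpsi).
have Dpe x : 'D_e (fun x => psi x * eta x) x = psi x * 'D_e eta x + eta x * 'D_e psi x.
  have [/(_ 1%N)[dpsi _] _] := tpsi; have [/(_ 1%N)[deta _] _] := teta.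
  by rewrite (@deriveM _ _ psi eta)//; exact: diff_derivable.
transitivity (\int[leb4]_x (v x i ord0 * 'D_e (fun x => psi x * eta x) x)
    - \int[leb4]_x (v x i ord0 * (eta x * 'D_e psi x))).
  rewrite -RintegralB//; [|exact: int1|exact: int1].
  by apply: eq_Rintegral => x _; rewrite !mxE Dpe -/e; ring.
rewrite Hv// -opprD -RintegralD//; [|exact: int1|exact: int1].
by congr (- _); apply: eq_Rintegral => x _; rewrite !mxE -/e; ring.
Qed.

End weak_gradient_rules.

(** * Localized estimates *)

Lemma aeI d (T : measurableType d) (R : realType) (mu : {measure set T -> \bar R})
    (P Q : T -> Prop) : {ae mu, forall x, P x} -> {ae mu, forall x, Q x} ->
  {ae mu, forall x, P x /\ Q x}.
Proof. exact: filterI. Qed.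

Section H1_fields.
Variables (R : realType) (m : nat).
Local Notation l := (@lebesgue_measure R).
Implicit Types (phi : spacetime R -> R) (v w : spacetime R -> 'cV[R]_m) (Dv Dw : spacetime R -> 'M[R]_(m, 4)).

(** Fields on all of space-time, meant for the extensions by 0. Weak gradients are asked for on
    almost every time slice only, so jumps in t are allowed. *)
Definition H1field v Dv : Prop :=
  [/\ forall i j, measurable_fun setT (fun z => v z i j),
      forall i j, measurable_fun setT (fun z => Dv z i j),
      sqint leb5 (fun z => frob (v z)), sqint leb5 (fun z => frob (Dv z)) &
      {ae l, forall t, weak_grad (fun x => v (x, t)) (fun x => Dv (x, t))}].

Lemma measurable_slice d (T : measurableType d) (f : spacetime R -> T) (t : R) :
  measurable_fun setT f -> measurable_fun setT (fun x : space4 R => f (x, t)).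
Proof. by move=> mf; exact: measurableT_comp mf (pair2_measurable t). Qed.

Lemma ae_sqint_slice (f : spacetime R -> R) : measurable_fun setT f -> sqint leb5 f ->
  {ae l, forall t, sqint leb4 (fun x => f (x, t))}.
Proof.
move=> mf; have m2 : measurable_fun setT (fun z => (f z ^+ 2)%:E).
  by apply/measurable_EFinP; exact: measurable_funX.
have p2 z : (0 <= (f z ^+ 2)%:E)%E by rewrite lee_fin sqr_ge0.
rewrite /sqint tonelli5// => fi.
apply: (ae_lty_of_integral (measurable_tonelli5 m2 p2) _ fi) => t.
exact: integral_ge0.
Qed.

Lemma sqint_entry d (T : measurableType d) (mu : {measure set T -> \bar R}) p q
    (f : T -> 'M[R]_(p, q)) i j : (forall i j, measurable_fun setT (fun z => f z i j)) ->
  sqint mu (fun z => frob (f z)) -> sqint mu (fun z => f z i j).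
Proof.
move=> mf; apply: sqint_le => //; first exact: measurable_frob.
by move=> z; exact: le_entry_frob.
Qed.

(** The constant is generous: |f - g|^2 <= 2 |f|^2 + 2 |g|^2, and 2 a^2 + 2 b^2 <= (2 (a + b))^2.
    Writing it as a square keeps the bound in the form of the hypotheses. *)
Lemma sqint_frobB d (T : measurableType d) (mu : {measure set T -> \bar R}) p q
    (f g : T -> 'M[R]_(p, q)) (a b : R) :
  (forall i j, measurable_fun setT (fun z => f z i j)) ->
  (forall i j, measurable_fun setT (fun z => g z i j)) -> 0 <= a -> 0 <= b ->
  (\int[mu]_z (frob (f z) ^+ 2)%:E <= (a ^+ 2)%:E)%E ->
  (\int[mu]_z (frob (g z) ^+ 2)%:E <= (b ^+ 2)%:E)%E ->
  (\int[mu]_z (frob (f z - g z) ^+ 2)%:E <= ((2 * (a + b)) ^+ 2)%:E)%E.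
Proof.
move=> mf mg a0 b0 fa gb.
have m2 (h : T -> 'M[R]_(p, q)) : (forall i j, measurable_fun setT (fun z => h z i j)) ->
    measurable_fun setT (fun z => (frob (h z) ^+ 2)%:E).
  by move=> mh; apply/measurable_EFinP; apply: measurable_funX; exact: measurable_frob.
have p2 (h : T -> 'M[R]_(p, q)) z : (0 <= (frob (h z) ^+ 2)%:E)%E by rewrite lee_fin sqr_ge0.
have [mf2 mg2] := (m2 _ mf, m2 _ mg).
apply: (@le_trans _ _ (\int[mu]_z (2%:E * (frob (f z) ^+ 2)%:E + 2%:E * (frob (g z) ^+ 2)%:E))%E).
  apply: ge0_le_integral => //.
  - by move=> z _; rewrite lee_fin sqr_ge0.
  - apply: m2 => i j; rewrite (_ : (fun z => _) = (fun z => f z i j - g z i j)).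
      exact: measurable_funB.
    by apply/funext => z; rewrite !mxE.
  - by apply: emeasurable_funD; exact: emeasurable_funM.
  - move=> z _; rewrite -!EFinM -EFinD lee_fin.
    have := frob_triangle (f z) (- g z); rewrite frobN.
    have := frob_ge0 (f z); have := frob_ge0 (g z); have := frob_ge0 (f z - g z).
    by have := sqr_ge0 (frob (f z) - frob (g z)); nra.
rewrite ge0_integralD//; last 4 first.
- by move=> z _; rewrite mule_ge0.
- exact: emeasurable_funM.
- by move=> z _; rewrite mule_ge0.
- exact: emeasurable_funM.
rewrite !ge0_integralZl//.
apply: (@le_trans _ _ (2%:E * (a ^+ 2)%:E + 2%:E * (b ^+ 2)%:E)%E).
  by apply: leeD; exact: lee_wpmul2l.
by rewrite -!EFinM -EFinD lee_fin; nra.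
Qed.

Lemma H1fieldB v Dv w Dw : H1field v Dv -> H1field w Dw ->
  H1field (fun z => v z - w z) (fun z => Dv z - Dw z).
Proof.
move=> [mv mDv sv sDv wv] [mw mDw sw sDw ww].
have lt_sq d (T : measurableType d) (mu : {measure set T -> \bar R}) (f : T -> R) : sqint mu f ->
    exists2 a : R, 0 <= a & (\int[mu]_z (f z ^+ 2)%:E <= (a ^+ 2)%:E)%E.
  move=> sf; have I0 : (0 <= \int[mu]_z (f z ^+ 2)%:E)%E.
    by apply: integral_ge0 => z _; rewrite lee_fin sqr_ge0.
  exists (Num.sqrt (fine (\int[mu]_z (f z ^+ 2)%:E)%E)); first exact: sqrtr_ge0.
  by rewrite sqr_sqrtr ?fine_ge0// fineK// ge0_fin_numE.
split.
- move=> i j; rewrite (_ : (fun z => _) = (fun z => v z i j - w z i j)).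
    exact: measurable_funB.
  by apply/funext => z; rewrite !mxE.
- move=> i j; rewrite (_ : (fun z => _) = (fun z => Dv z i j - Dw z i j)).
    exact: measurable_funB.
  by apply/funext => z; rewrite !mxE.
- have [[a a0 va] [b b0 wb]] := (lt_sq _ _ _ _ sv, lt_sq _ _ _ _ sw).
  by apply: le_lt_trans (sqint_frobB mv mw a0 b0 va wb) (ltry _).
- have [[a a0 va] [b b0 wb]] := (lt_sq _ _ _ _ sDv, lt_sq _ _ _ _ sDw).
  by apply: le_lt_trans (sqint_frobB mDv mDw a0 b0 va wb) (ltry _).
have s1 := ae_sqint_slice (measurable_frob mv) sv.
have s2 := ae_sqint_slice (measurable_frob mDv) sDv.
have s3 := ae_sqint_slice (measurable_frob mw) sw.
have s4 := ae_sqint_slice (measurable_frob mDw) sDw.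
have s5 : {ae l, forall t, (sqint leb4 (fun x => frob (v (x, t))) /\
     sqint leb4 (fun x => frob (Dv (x, t)))) /\
    (sqint leb4 (fun x => frob (w (x, t))) /\ sqint leb4 (fun x => frob (Dw (x, t))))}.
  exact: aeI (aeI s1 s2) (aeI s3 s4).
have s6 : {ae l, forall t, weak_grad (fun x => v (x, t)) (fun x => Dv (x, t)) /\
    weak_grad (fun x => w (x, t)) (fun x => Dw (x, t))} by exact: aeI.
have s7 := aeI s5 s6; apply: (aeS s7) => t [[[a1 a2] [a3 a4]] [a5 a6]].
have ms p q (f : spacetime R -> 'M[R]_(p, q)) : (forall i j, measurable_fun setT (fun z => f z i j)) ->
    forall i j, measurable_fun setT (fun x => f (x, t) i j).
  by move=> mf i j; exact: measurable_slice t (mf i j).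
apply: weak_gradB => // [i|i|i j|i j|i|i|i j|i j].
- exact: ms.
- exact: sqint_entry (ms _ _ _ mv) a1.
- exact: ms.
- exact: sqint_entry (ms _ _ _ mDv) a2.
- exact: ms.
- exact: sqint_entry (ms _ _ _ mw) a3.
- exact: ms.
- exact: sqint_entry (ms _ _ _ mDw) a4.
Qed.

Lemma H1field_cube v Dv (N : R) : H1field v Dv -> 0 <= N ->
  {ae l, forall t, (\int[leb4]_x (frob (v (x, t)) ^+ 2)%:E <= (N ^+ 2)%:E)%E} ->
  (\int[leb5]_z (frob (v z) ^+ 3)%:E <= (9 * N)%:E * \int[leb5]_z (frob (Dv z) ^+ 2)%:E)%E.
Proof.
move=> [mv mDv sv sDv wv] N0 vN.
have m3 : measurable_fun setT (fun z => (frob (v z) ^+ 3)%:E).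
  by apply/measurable_EFinP; apply: measurable_funX; exact: measurable_frob.
have m2 : measurable_fun setT (fun z => (frob (Dv z) ^+ 2)%:E).
  by apply/measurable_EFinP; apply: measurable_funX; exact: measurable_frob.
have p3 z : (0 <= (frob (v z) ^+ 3)%:E)%E by rewrite lee_fin exprn_ge0// frob_ge0.
have p2 z : (0 <= (frob (Dv z) ^+ 2)%:E)%E by rewrite lee_fin sqr_ge0.
rewrite !tonelli5// -ge0_integralZl//; last 3 first.
- exact: (measurable_tonelli5 m2 p2).
- by move=> t _; exact: integral_ge0.
- by rewrite lee_fin mulr_ge0.
apply: ae_ge0_le_integral => //.
- by move=> t _; exact: integral_ge0.
- exact: (measurable_tonelli5 m3 p3).
- by move=> t _; rewrite mule_ge0 ?lee_fin ?mulr_ge0//; exact: integral_ge0.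
- by apply: emeasurable_funM => //; exact: (measurable_tonelli5 m2 p2).
have s1 := ae_sqint_slice (measurable_frob mv) sv.
have s2 := ae_sqint_slice (measurable_frob mDv) sDv.
have s3 := aeI (aeI s1 s2) (aeI wv vN).
apply: (aeS s3) => t [[a1 a2] [a3 a4]] _.
apply: (@gagliardo_nirenberg _ _ (fun x => v (x, t)) (fun x => Dv (x, t))) => //.
- by move=> i; exact: measurable_slice (mv i ord0).
- by move=> i j; exact: measurable_slice (mDv i j).
- by move=> a b n i j; apply: a3; exact: test_function_bump4.
Qed.

Definition cutoff_grad (phi : spacetime R -> R) v Dv (z : spacetime R) : 'M[R]_(m, 4) :=
  \matrix_(i, j) (phi z * Dv z i j + v z i ord0 * 'D_((basis4 R j, 0) : spacetime R) phi z).

Definition tsupp (phi : spacetime R -> R) : set (spacetime R) := closure [set z | phi z != 0].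

Lemma test_support_derive phi : test_function phi ->
  exists2 B : R, 0 <= B & forall (j : 'I_4) z,
    ('D_((basis4 R j, 0) : spacetime R) phi z) ^+ 2 <= B * \1_(tsupp phi) z.
Proof.
move=> tphi.
have /choice[M HM] : forall j : 'I_4, exists M : R, forall z,
    `|'D_((basis4 R j, 0) : spacetime R) phi z| <= M.
  by move=> j; exact: derive_test_bounded.
exists (\sum_j M j ^+ 2); first by apply: sumr_ge0 => j _; exact: sqr_ge0.
move=> j z; rewrite indicE; have [sz|nsz] := pselect (tsupp phi z).
  have xM (x N : R) : `|x| <= N -> x ^+ 2 <= N ^+ 2 by rewrite ler_norml => /andP[]; nra.
  rewrite mem_set// mulr1 (bigD1 j)//=; apply: le_trans (xM _ _ (HM j z)) _.
  by rewrite lerDl; apply: sumr_ge0 => k _; exact: sqr_ge0.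
by rewrite memNset// mulr0 derive_eq0_off_support// expr0n.
Qed.

(** The first 2 comes from splitting the square of a sum; the 8 is that 2 times the four directions,
    in each of which the squared derivative of phi is at most B on the support. *)
Lemma le_frob_cutoff_grad phi v Dv (B : R) z :
  (forall j : 'I_4, ('D_((basis4 R j, 0) : spacetime R) phi z) ^+ 2 <= B * \1_(tsupp phi) z) ->
  frob (cutoff_grad phi v Dv z) ^+ 2 <= 2 * (phi z ^+ 2 * frob (Dv z) ^+ 2)
    + 8 * B * (\1_(tsupp phi) z * frob (v z) ^+ 2).
Proof.
move=> HB; pose Z : 'M[R]_(m, 4) :=
  \matrix_(i, j) (v z i ord0 * 'D_((basis4 R j, 0) : spacetime R) phi z).
have -> : cutoff_grad phi v Dv z = phi z *: Dv z + Z by apply/matrixP => i j; rewrite !mxE.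
have Z2 : frob Z ^+ 2 <= 4 * (B * \1_(tsupp phi) z) * frob (v z) ^+ 2.
  rewrite !sqr_frob /frobdot mulr_sumr; apply: ler_sum => i _; rewrite big_ord1.
  apply: (@le_trans _ _ (\sum_(j < 4) (v z i ord0 * v z i ord0) * (B * \1_(tsupp phi) z))).
    apply: ler_sum => j _; rewrite !mxE mulrACA ler_wpM2l//; first by rewrite -expr2 sqr_ge0.
    by rewrite -expr2.
  by rewrite sumr_const card_ord -mulr_natl; lra.
have := frob_triangle (phi z *: Dv z) Z; have := frob_ge0 (phi z *: Dv z + Z).
have f1 : frob (phi z *: Dv z) ^+ 2 = phi z ^+ 2 * frob (Dv z) ^+ 2.
  by rewrite frobZ exprMn real_normK ?num_real.
have := frob_ge0 Z; have := frob_ge0 (phi z *: Dv z); have := sqr_ge0 (frob (phi z *: Dv z) - frob Z).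
by rewrite -f1; nra.
Qed.

Lemma H1fieldM phi v Dv : test_function phi -> (forall z, 0 <= phi z <= 1) -> H1field v Dv ->
  H1field (fun z => phi z *: v z) (cutoff_grad phi v Dv).
Proof.
move=> tphi phi01 [mv mDv sv sDv wv].
have [B B0 HB] := test_support_derive tphi.
have cphi : continuous phi by have [/(_ 0%N)] := tphi.
have mphi := continuous5_measurable cphi.
have mdphi (j : 'I_4) : measurable_fun (setT : set (spacetime R))
    (fun z => 'D_((basis4 R j, 0) : spacetime R) phi z : measurableTypeR R).
  by apply: continuous5_measurable; have [/(_ 1%N)[_ c] _] := tphi; exact: c.
have mg i j : measurable_fun setT (fun z => cutoff_grad phi v Dv z i j).
  rewrite (_ : (fun z => _) = (fun z => phi z * Dv z i j
      + v z i ord0 * 'D_((basis4 R j, 0) : spacetime R) phi z)); last by apply/funext => z; rewrite mxE.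
  have m1 : measurable_fun setT (fun z => phi z * Dv z i j) by apply: measurable_funM.
  have m2 : measurable_fun setT (fun z => v z i ord0 * 'D_((basis4 R j, 0) : spacetime R) phi z).
    apply: measurable_funM; first exact: mv.
    exact: mdphi.
  exact: measurable_funD m1 m2.
split=> //.
- move=> i j; rewrite (_ : (fun z => _) = (fun z => phi z * v z i j)); first exact: measurable_funM.
  by apply/funext => z; rewrite mxE.
- rewrite (_ : (fun z => _) = (fun z => phi z * frob (v z))); last first.
    by apply/funext => z; rewrite frobZ ger0_norm//; have /andP[] := phi01 z.
  apply: (sqint_bounded_mul (M := 1)) => //; first exact: measurable_frob.
  by move=> z; have /andP[p0 p1] := phi01 z; rewrite ger0_norm.
- have s2 : leb5.-integrable setT (fun z => (2%:E * (frob (Dv z) ^+ 2)%:E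
      + (8 * B)%:E * (frob (v z) ^+ 2)%:E)%E).
    by apply: integrableD => //; apply: integrableZl => //; apply: sqint_integrable => //; exact: measurable_frob.
  have /integrableP[ms2] := s2; apply: le_lt_trans; apply: ge0_le_integral => //.
  + by move=> z _; rewrite lee_fin sqr_ge0.
  + by apply/measurable_EFinP; apply: measurable_funX; exact: measurable_frob.
  + exact: measurableT_comp.
  + move=> z _; rewrite -!EFinM -EFinD abse_EFin lee_fin; apply: le_trans (ler_norm _).
    apply: le_trans (le_frob_cutoff_grad v Dv (fun j => HB j z)) _.
    have /andP[p0 p1] := phi01 z; have i1 : \1_(tsupp phi) z <= 1 :> R by rewrite indicE; case: (_ \in _).
    rewrite lerD// ler_wpM2l ?mulr_ge0// ler_piMl ?sqr_ge0// expr_le1//.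
have s1 := ae_sqint_slice (measurable_frob mv) sv.
have s2 := ae_sqint_slice (measurable_frob mDv) sDv.
have s3 := aeI (aeI s1 s2) wv; apply: (aeS s3) => t [[a1 a2] a3].
have tt := test_function_slice t tphi.
have ms p q (f : spacetime R -> 'M[R]_(p, q)) : (forall i j, measurable_fun setT (fun z => f z i j)) ->
    forall i j, measurable_fun setT (fun x => f (x, t) i j).
  by move=> mf i j; exact: measurable_slice t (mf i j).
have := weak_gradM tt (fun i => ms _ _ _ mv i ord0) (fun i => sqint_entry i ord0 (ms _ _ _ mv) a1)
  (ms _ _ _ mDv) (fun i j => sqint_entry i j (ms _ _ _ mDv) a2) a3.
congr weak_grad; apply/funext => x; apply/matrixP => i j; rewrite !mxE.
by rewrite derive_slice.
Qed.

(** Gagliardo-Nirenberg for phi v contributes 9 N, and the factor 2 of the gradient bound makes it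
    18 N; the remaining 8 / 2 = 4 goes into the constant in front of the lower-order term. That
    constant is chosen before v, so it stays fixed along a sequence of fields. *)
Lemma localized_cube phi : test_function phi -> (forall z, 0 <= phi z <= 1) ->
  exists2 B : R, 0 <= B & forall v Dv (N : R), H1field v Dv -> 0 <= N ->
  {ae l, forall t, (\int[leb4]_x ((phi (x, t) * frob (v (x, t))) ^+ 2)%:E <= (N ^+ 2)%:E)%E} ->
  \int[leb5]_z (phi z ^+ 3 * frob (v z) ^+ 3) <= 18 * N *
    (\int[leb5]_z (phi z ^+ 2 * frob (Dv z) ^+ 2)
     + B * \int[leb5]_z (\1_(tsupp phi) z * frob (v z) ^+ 2)).
Proof.
move=> tphi phi01; have [B B0 HB] := test_support_derive tphi.
exists (4 * B) => [|v Dv N Hv N0 vN]; first by rewrite mulr_ge0.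
have Hpv := H1fieldM tphi phi01 Hv; have [mv mDv sv sDv _] := Hv.
have mphi : measurable_fun setT phi by apply: continuous5_measurable; have [/(_ 0%N)] := tphi.
have mfv := measurable_frob mv; have mfDv := measurable_frob mDv.
have fpv z : frob (phi z *: v z) = phi z * frob (v z).
  by rewrite frobZ ger0_norm//; have /andP[] := phi01 z.
have := H1field_cube Hpv N0.
have /[swap] /[apply] : {ae l, forall t,
    (\int[leb4]_x (frob (phi (x, t) *: v (x, t)) ^+ 2)%:E <= (N ^+ 2)%:E)%E}.
  by apply: (aeS vN) => t; under [X in _ -> (X <= _)%E]eq_integral do rewrite fpv.
have -> : (\int[leb5]_z (frob (phi z *: v z) ^+ 3)%:E
    = \int[leb5]_z (phi z ^+ 3 * frob (v z) ^+ 3)%:E)%E.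
  by apply: eq_integral => z _; rewrite fpv exprMn.
set X := (\int[leb5]_z (phi z ^+ 3 * frob (v z) ^+ 3)%:E)%E => XN.
have ip : leb5.-integrable setT (fun z => (phi z ^+ 2 * frob (Dv z) ^+ 2)%:E).
  have sp : sqint leb5 (fun z => phi z * frob (Dv z)).
    apply: (sqint_bounded_mul (M := 1)) => // z.
    by have /andP[p0 p1] := phi01 z; rewrite ger0_norm.
  have := sqint_integrable (measurable_funM mphi mfDv) sp.
  by apply: eq_integrable => // z _; rewrite exprMn.
have mS : measurable_fun setT (\1_(tsupp phi) : spacetime R -> R).
  apply: measurable_indic; rewrite -[tsupp phi]setCK; apply: measurableC.
  by apply: open5_measurable; rewrite openC; exact: closed_closure.
have iS : leb5.-integrable setT (fun z => (\1_(tsupp phi) z * frob (v z) ^+ 2)%:E).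
  have sp : sqint leb5 (fun z => \1_(tsupp phi) z * frob (v z)).
    apply: (sqint_bounded_mul (M := 1)) => // z.
    by rewrite indicE; case: (_ \in _); rewrite ?normr1 ?normr0.
  have := sqint_integrable (measurable_funM mS mfv) sp.
  by apply: eq_integrable => // z _; rewrite exprMn expr2 indic_idem.
have Y : (\int[leb5]_z (frob (cutoff_grad phi v Dv z) ^+ 2)%:E <=
    (2 * \int[leb5]_z (phi z ^+ 2 * frob (Dv z) ^+ 2)
     + 8 * B * \int[leb5]_z (\1_(tsupp phi) z * frob (v z) ^+ 2))%:E)%E.
  rewrite EFinD !EFinM /Rintegral !fineK; [|exact: (integrable_fin_num _ iS)|exact: (integrable_fin_num _ ip)].
  rewrite -EFinM -!integralZl// -integralD//; [|exact: integrableZl|exact: integrableZl].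
  have [_ mg _ _ _] := Hpv; apply: ge0_le_integral => //.
  - by move=> z _; rewrite lee_fin sqr_ge0.
  - by apply/measurable_EFinP; apply: measurable_funX; exact: measurable_frob.
  - by apply: emeasurable_funD; apply: emeasurable_funM => //; [exact: measurable_int ip|exact: measurable_int iS].
  - by move=> z _; rewrite -!EFinM -EFinD lee_fin; exact: le_frob_cutoff_grad.
have X0 : (0 <= X)%E.
  apply: integral_ge0 => z _; rewrite lee_fin mulr_ge0// exprn_ge0 ?frob_ge0//.
  by have /andP[] := phi01 z.
have := le_trans XN (lee_wpmul2l _ Y); rewrite lee_fin mulr_ge0// => /(_ isT) => XY.
have Xf : X \is a fin_num by rewrite ge0_fin_numE// (le_lt_trans XY)// -EFinM ltry.
rewrite -lee_fin [X in (X <= _)%E]fineK//; apply: le_trans XY _; rewrite -EFinM lee_fin.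
by rewrite le_eqVlt; apply/orP; left; apply/eqP; ring.
Qed.

End H1_fields.

Section integration_tools.
Context d (T : measurableType d) (R : realType) (mu : {measure set T -> \bar R}).

Lemma integrable_boundedM (f g : T -> R) (M : R) :
  measurable_fun setT f -> (forall x, `|f x| <= M) -> mu.-integrable setT (fun x => (g x)%:E) ->
  mu.-integrable setT (fun x => (f x * g x)%:E).
Proof.
move=> mf fM ig.
have mg : measurable_fun setT g by have /measurable_int/measurable_EFinP := ig.
apply: (le_integrable measurableT _ _ (integrableZl measurableT M ig)).
  by apply/measurable_EFinP; exact: measurable_funM.
move=> x _; rewrite -EFinM !abse_EFin lee_fin !normrM ler_wpM2r//.
by rewrite (le_trans (fM x))// ler_norm.
Qed.

Lemma integrable_ge0 (f : T -> R) : measurable_fun setT f -> (forall x, 0 <= f x) ->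
  (\int[mu]_x (f x)%:E < +oo)%E -> mu.-integrable setT (fun x => (f x)%:E).
Proof.
move=> mf f0 fi; apply/integrableP; split; first exact/measurable_EFinP.
by under eq_integral do rewrite gee0_abs ?lee_fin//.
Qed.

Lemma Rintegral_squeeze (f h : nat -> T -> R) (C : R) : 0 <= C ->
  (forall k, mu.-integrable setT (fun x => (f k x)%:E)) ->
  (forall k, measurable_fun setT (h k)) -> (forall k x, 0 <= h k x) ->
  (forall k x, `|f k x| <= C * h k x) ->
  (forall e : R, 0 < e -> \forall k \near \oo, (\int[mu]_x (h k x)%:E <= e%:E)%E) ->
  (fun k => \int[mu]_x f k x) @ \oo --> (0 : R).
Proof.
move=> C0 fi mh h0 fh hi; apply/cvgrPdist_le => e e0.
have C1 : 0 < C + 1 by rewrite ltr_wpDl.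
have := hi _ (divr_gt0 e0 C1); apply: filterS => k hk.
rewrite sub0r normrN -lee_fin -abse_EFin /Rintegral fineK; last first.
  exact: (integrable_fin_num _ (fi k)).
have mf : measurable_fun setT (fun x => (f k x)%:E) by exact: measurable_int (fi k).
apply: (le_trans (le_abse_integral _ measurableT mf)).
apply: (@le_trans _ _ (\int[mu]_x (C%:E * (h k x)%:E))%E).
  apply: ge0_le_integral => //.
  - exact: measurableT_comp.
  - by apply: emeasurable_funM => //; exact/measurable_EFinP.
  - by move=> x _; rewrite -EFinM abse_EFin lee_fin.
rewrite ge0_integralZl//; [|exact/measurable_EFinP|by move=> x _; rewrite lee_fin].
apply: (le_trans (lee_wpmul2l _ hk)) => //.
rewrite -EFinM lee_fin mulrCA ger_pMr// ler_pdivrMr// mul1r; lra.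
Qed.

End integration_tools.

(** Both limits exist, so an inequality at infinitely many indices passes to the limit. This is what
    allows a lower limit of the norms in the final bound. *)
Lemma limit_le_frequently (R : realType) (x y : nat -> R) (X Y : R) :
  x @ \oo --> X -> y @ \oo --> Y -> (forall K, exists2 k, (K <= k)%N & x k <= y k) -> X <= Y.
Proof.
move=> cx cy xy; rewrite leNgt; apply/negP => YX.
have : (fun k => x k - y k) @ \oo --> X - Y by exact: cvgB.
move=> /cvgr_gt/(_ 0); rewrite subr_gt0 => /(_ YX)[K _ HK].
by have [k /HK/= + xyk] := xy K; rewrite subr_gt0 ltNge xyk.
Qed.

Lemma measurable_slice_integral (R : realType) (f : spacetime R -> \bar R) :
  measurable_fun setT f -> measurable_fun setT (fun t => \int[leb4]_x f (x, t))%E.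
Proof.
move=> mf; have E (t : R) : (\int[leb4]_x f (x, t) = (\int[leb4]_x (f^\+ (x, t)))
    - (\int[leb4]_x (f^\- (x, t))))%E.
  rewrite integralE; congr (_ - _)%E; apply: eq_integral => x _; by rewrite ?funeposE ?funenegE.
apply: (eq_measurable_fun _ (fun t _ => esym (E t))).
by apply: emeasurable_funB; apply: measurable_tonelli5 => //;
  [exact: measurable_funepos|exact: measurable_funeneg].
Qed.

(** On almost every slice this is the definition of the weak gradient, the time indicator being
    constant there. Square integrability of the two cutoff factors lets Fubini reduce the space-time
    integrals to slices. *)
Lemma H1field_by_parts (R : realType) (m : nat) (w : spacetime R -> 'cV[R]_m)
    (Dw : spacetime R -> 'M[R]_(m, 4)) (a b : spacetime R) n i j : H1field w Dw ->
  \int[leb5]_z (bump4 a.1 b.1 n z.1 * \1_(`]a.2, b.2[%classic) z.2 * Dw z i j)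
  = \int[leb5]_z (- \1_(`]a.2, b.2[%classic) z.2 * 'D_(basis4 R j) (bump4 a.1 b.1 n) z.1
                  * w z i ord0).
Proof.
move=> [mw mDw sw sDw ww]; pose J : set (measurableTypeR R) := `]a.2, b.2[%classic.
set eta := bump4 a.1 b.1 n; have teta : test_function eta by exact: test_function_bump4.
have [B etaB] := derive_test_bounded (basis4 R j) teta.
have meta : measurable_fun setT (fun z : spacetime R => eta z.1).
  exact: measurableT_comp (measurable_test teta) measurable_fst.
have mdeta : measurable_fun setT (fun z : spacetime R => 'D_(basis4 R j) eta z.1).
  exact: measurableT_comp (measurable_derive_test (basis4 R j) teta) measurable_fst.
have mJ : measurable_fun setT (fun z : spacetime R => \1_J z.2 : R).
  apply: measurableT_comp (measurable_snd : measurable_fun setT (snd : spacetime R -> measurableTypeR R)).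
  by apply: measurable_indic; exact: measurable_itv.
have [p Kp] := compact_sub_box5 (@compact_cbox5 R a b).
have J1 (t : R) : 0 <= (\1_J t : R) <= 1 by rewrite indicE; case: (_ \in _); rewrite ?lexx ler01.
have sf : sqint leb5 (fun z : spacetime R => eta z.1 * \1_J z.2).
  apply: (sqint_bounded (A := box5 (cst5 (- p%:R)) (cst5 p%:R)) (M := 1)).
  - exact: measurable_funM.
  - exact: measurable_box5.
  - exact: leb5_box5_lty.
  - move=> z; have /andP[u0 u1] := J1 z.2; have e0 := bump4_ge0 a.1 b.1 n z.1.
    by rewrite (ger0_norm (mulr_ge0 e0 u0)); apply: mulr_ile1 => //; exact: bump4_le1.
  - move=> z nz; have [z1|nz1] := pselect (cbox4 a.1 b.1 z.1); last first.
      by rewrite /eta bump4_eq0 ?mul0r// => /box4_sub_cbox4.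
    rewrite indicE memNset ?mulr0//= => z2; apply: nz; apply: Kp; split => //.
    exact: subset_itv_oo_cc.
have sF : sqint leb5 (fun z : spacetime R => - \1_J z.2 * 'D_(basis4 R j) eta z.1).
  apply: (sqint_bounded (A := box5 (cst5 (- p%:R)) (cst5 p%:R)) (M := B)).
  - by apply: measurable_funM => //; exact: measurableT_comp.
  - exact: measurable_box5.
  - exact: leb5_box5_lty.
  - move=> z; have /andP[u0 u1] := J1 z.2; rewrite normrM normrN (ger0_norm u0).
    by rewrite (le_trans (ler_wpM2r _ u1))// mul1r.
  - move=> z nz; have [z2|nz2] := pselect (J z.2); last by rewrite indicE memNset// oppr0 mul0r.
    rewrite (derive_eq0_off_support (f := eta)) ?mulr0// => z1.
    apply: nz; apply: Kp; split; last exact: subset_itv_oo_cc.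
    rewrite (closure_id (cbox4 a.1 b.1)).1; last exact: closed_cbox4.
    move: z1; apply: closure_subset => x /=; apply: contra_neqP.
    by move=> nx; apply: bump4_eq0 => /box4_sub_cbox4.
have sw' := sqint_entry i ord0 mw sw; have sDw' := sqint_entry i j mDw sDw.
rewrite /Rintegral !fubini5; last 2 first.
- by apply: integrable_sqM => //; apply: measurable_funM => //; exact: measurableT_comp.
- by apply: integrable_sqM => //; exact: measurable_funM.
congr fine.
have iF : leb5.-integrable setT (fun z : spacetime R =>
    (- \1_J z.2 * 'D_(basis4 R j) eta z.1 * w z i ord0)%:E).
  by apply: integrable_sqM => //; apply: measurable_funM => //; exact: measurableT_comp.
have iDf : leb5.-integrable setT (fun z : spacetime R => (eta z.1 * \1_J z.2 * Dw z i j)%:E).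
  by apply: integrable_sqM => //; exact: measurable_funM.
have s1 := ae_sqint_slice (mw i ord0) sw'; have s2 := ae_sqint_slice (mDw i j) sDw'.
have E : {ae @lebesgue_measure R, forall t,
    (\int[leb4]_x (eta x * \1_J t * Dw (x, t) i j)%:E
     = \int[leb4]_x (- \1_J t * 'D_(basis4 R j) eta x * w (x, t) i ord0)%:E)%E}.
  apply: (aeS (aeI (aeI s1 s2) ww)) => t [[a1 a2] a3].
  have m1 := measurable_slice t (mw i ord0); have m2 := measurable_slice t (mDw i j).
  have i1 : leb4.-integrable setT (fun x => (w (x, t) i ord0 * 'D_(basis4 R j) eta x)%:E).
    by apply: integrable_sqM => //; [exact: measurable_derive_test|exact: sqint_derive_test].
  have i2 : leb4.-integrable setT (fun x => (Dw (x, t) i j * eta x)%:E).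
    by apply: integrable_sqM => //; [exact: measurable_test|exact: sqint_test].
  have -> : (\int[leb4]_x (eta x * \1_J t * Dw (x, t) i j)%:E
      = (\1_J t)%:E * \int[leb4]_x (Dw (x, t) i j * eta x)%:E)%E.
    rewrite -integralZl//; apply: eq_integral => x _; rewrite -EFinM; congr EFin; ring.
  have -> : (\int[leb4]_x (- \1_J t * 'D_(basis4 R j) eta x * w (x, t) i ord0)%:E
      = (- \1_J t)%:E * \int[leb4]_x (w (x, t) i ord0 * 'D_(basis4 R j) eta x)%:E)%E.
    rewrite -integralZl//; apply: eq_integral => x _; rewrite -EFinM; congr EFin; ring.
  rewrite -[X in (_ * X)%E = _]fineK; last exact: (integrable_fin_num _ i2).
  rewrite -[X in _ = (_ * X)%E]fineK; last exact: (integrable_fin_num _ i1).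
  have := a3 eta teta i j; rewrite /Rintegral => ->.
  by rewrite -!EFinM mulrNN.
apply: ae_eq_integral => //.
- exact: (measurable_slice_integral (measurable_int _ iDf)).
- exact: (measurable_slice_integral (measurable_int _ iF)).
- by apply: (aeS E).
Qed.

(** * Limits of the localized estimates *)

Lemma cvg_bigsum (R : realType) (I : Type) (r : seq I) (F : I -> nat -> R) (L : I -> R) :
  (forall i, F i @ \oo --> L i) -> (fun k => \sum_(i <- r) F i k) @ \oo --> \sum_(i <- r) L i.
Proof.
move=> FL; elim: r => [|i r IHr].
  rewrite big_nil (_ : (fun k => _) = fun=> 0); first exact: cvg_cst.
  by apply/funext => k; rewrite big_nil.
rewrite big_cons (_ : (fun k => _) = (fun k => F i k + \sum_(j <- r) F j k)); first exact: cvgD.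
by apply/funext => k; rewrite big_cons.
Qed.

Section sequences.
Variables (R : realType) (m : nat).
Local Notation l := (@lebesgue_measure R).
Variables (U : spacetime R -> 'cV[R]_m) (DU : spacetime R -> 'M[R]_(m, 4)).
Variables (Uk : nat -> spacetime R -> 'cV[R]_m) (DUk : nat -> spacetime R -> 'M[R]_(m, 4)).
Variables (mu nu : {finite_measure set (spacetime R) -> \bar R}) (M : R).
Hypotheses (M0 : 0 <= M) (hU : H1field U DU) (hUk : forall k, H1field (Uk k) (DUk k)).
Hypothesis DU2 : (\int[leb5]_z (frob (DU z) ^+ 2)%:E <= (M ^+ 2)%:E)%E.
Hypothesis DUk2 : forall k, (\int[leb5]_z (frob (DUk k z) ^+ 2)%:E <= (M ^+ 2)%:E)%E.
Hypothesis U2 :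
  {ae l, forall t, (\int[leb4]_x (frob (U (x, t)) ^+ 2)%:E <= (M ^+ 2)%:E)%E}.
Hypothesis Uk2 : forall k,
  {ae l, forall t, (\int[leb4]_x (frob (Uk k (x, t)) ^+ 2)%:E <= (M ^+ 2)%:E)%E}.
Hypothesis strong : forall K, compact K ->
  (fun k => \int[leb5]_z (\1_K z * frob (Uk k z - U z))%:E)%E @ \oo --> 0%E.
Hypothesis weak_mu : forall f : spacetime R -> R, continuous f ->
  (exists B, forall z, `|f z| <= B) ->
  (fun k => \int[leb5]_z (f z * frob (DUk k z) ^+ 2)) @ \oo --> \int[mu]_z f z.
Hypothesis weak_nu : forall f : spacetime R -> R, continuous f ->
  (exists B, forall z, `|f z| <= B) ->
  (fun k => \int[leb5]_z (f z * frob (Uk k z) ^+ 3)) @ \oo --> \int[nu]_z f z.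

Implicit Types (w : spacetime R -> 'cV[R]_m) (Dw : spacetime R -> 'M[R]_(m, 4)).
Let v k z := Uk k z - U z.
Let Dv k z := DUk k z - DU z.
(** The constant of [sqint_frobB] for differences, serving both the slices of v and the
    gradients. *)
Let S := 2 * (M + M).

Let S0 : 0 <= S. Proof. by rewrite mulr_ge0// addr_ge0. Qed.

Let hv k : H1field (v k) (Dv k). Proof. exact: H1fieldB. Qed.

Lemma difference_slices k :
  {ae l, forall t, (\int[leb4]_x (frob (Uk k (x, t) - U (x, t)) ^+ 2)%:E <= (S ^+ 2)%:E)%E}.
Proof.
apply: (aeS (aeI (Uk2 k) U2)) => t [a1 a2].
have [mUk _ _ _ _] := hUk k; have [mU _ _ _ _] := hU.
apply: (sqint_frobB _ _ M0 M0 a1 a2).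
  by move=> i j; exact: measurable_slice t (mUk i j).
by move=> i j; exact: measurable_slice t (mU i j).
Qed.

Let Dv2 k : (\int[leb5]_z (frob (Dv k z) ^+ 2)%:E <= (S ^+ 2)%:E)%E.
Proof.
have [_ mDUk _ _ _] := hUk k; have [_ mDU _ _ _] := hU.
exact: (sqint_frobB mDUk mDU M0 M0 (DUk2 k) DU2).
Qed.

Let cube_bound w Dw N B : H1field w Dw -> 0 <= N ->
  {ae l, forall t, (\int[leb4]_x (frob (w (x, t)) ^+ 2)%:E <= (N ^+ 2)%:E)%E} ->
  (\int[leb5]_z (frob (Dw z) ^+ 2)%:E <= B%:E)%E ->
  (\int[leb5]_z (frob (w z) ^+ 3)%:E <= (9 * N * B)%:E)%E.
Proof.
move=> hw N0 wN DwB; apply: (le_trans (H1field_cube hw N0 wN)).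
by rewrite [X in (_ <= X)%E]EFinM; apply: lee_wpmul2l => //; rewrite lee_fin mulr_ge0.
Qed.

Let v3 k : (\int[leb5]_z (frob (v k z) ^+ 3)%:E <= (9 * S * S ^+ 2)%:E)%E.
Proof. exact: cube_bound (hv k) S0 (difference_slices k) (Dv2 k). Qed.

Let mfrob w Dw : H1field w Dw -> measurable_fun setT (fun z => frob (w z)) /\
  measurable_fun setT (fun z => frob (Dw z)).
Proof. by move=> [mw mDw _ _ _]; split; exact: measurable_frob. Qed.

Let i3 (w : spacetime R -> 'cV[R]_m) Dw (B : R) : H1field w Dw ->
  (\int[leb5]_z (frob (w z) ^+ 3)%:E <= B%:E)%E ->
  leb5.-integrable setT (fun z => (frob (w z) ^+ 3)%:E).
Proof.
move=> hw wB; apply: integrable_ge0.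
- by apply: measurable_funX; have [] := mfrob hw.
- by move=> z; rewrite exprn_ge0// frob_ge0.
- exact: le_lt_trans wB (ltry _).
Qed.

Let i2 w Dw : H1field w Dw -> leb5.-integrable setT (fun z => (frob (Dw z) ^+ 2)%:E).
Proof. by move=> hw; have [_ mDw] := mfrob hw; apply: sqint_integrable => //; case: hw. Qed.

Lemma limit_cube_integrable : leb5.-integrable setT (fun z => (frob (U z) ^+ 3)%:E).
Proof. exact: i3 hU (cube_bound hU M0 U2 DU2). Qed.

Lemma limit_grad_integrable : leb5.-integrable setT (fun z => (frob (DU z) ^+ 2)%:E).
Proof. exact: i2 hU. Qed.

Section cutoff.
Variable phi : spacetime R -> R.
Hypotheses (tphi : test_function phi) (phi01 : forall z, 0 <= phi z <= 1).

Let phi0 z : 0 <= phi z. Proof. by have /andP[] := phi01 z. Qed.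

Let cphi n : continuous (fun z => phi z ^+ n : R).
Proof.
have c : continuous phi by have [/(_ 0%N)] := tphi.
by move=> z; exact: (continuous_comp (c z) (@exprn_continuous R n (phi z))).
Qed.

Let mphi n : measurable_fun setT (fun z => phi z ^+ n).
Proof.
have c : continuous phi by have [/(_ 0%N)] := tphi.
exact: measurable_funX (continuous5_measurable c).
Qed.

Let phi1 n z : `|phi z ^+ n| <= 1.
Proof. by rewrite ger0_norm ?exprn_ge0// exprn_ile1//; have /andP[] := phi01 z. Qed.

Let supp_phi (z : spacetime R) : phi z ^+ 3 <= (\1_(tsupp phi) z : R).
Proof.
rewrite indicE; have [sz|nz] := pselect (tsupp phi z).
  by rewrite mem_set//; apply: le_trans (ler_norm _) (phi1 3 z).
have -> : phi z = 0.
  by apply/eqP; apply: contrapT => /negP fz; apply: nz; exact: subset_closure.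
by rewrite expr0n/=.
Qed.

Let mS : measurable_fun setT (\1_(tsupp phi) : spacetime R -> R).
Proof.
apply: measurable_indic; rewrite -[tsupp phi]setCK; apply: measurableC.
by apply: open5_measurable; rewrite openC; exact: closed_closure.
Qed.

Let S01 z : 0 <= (\1_(tsupp phi) z : R) <= 1.
Proof. by rewrite indicE; case: (_ \in _); rewrite ?lexx ler01. Qed.

Let frobv0 k z : 0 <= frob (v k z). Proof. exact: frob_ge0. Qed.

Let strong_phi : (fun k => \int[leb5]_z (\1_(tsupp phi) z * frob (v k z))%:E)%E @ \oo --> 0%E.
Proof. by apply: strong; case: tphi. Qed.

Let mv k : measurable_fun setT (fun z => frob (v k z)).
Proof. by have [] := mfrob (hv k). Qed.

Lemma cvg_difference_cube :
  (fun k => \int[leb5]_z (phi z ^+ 3 * frob (v k z) ^+ 3)) @ \oo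
  --> \int[nu]_z (phi z ^+ 3) - \int[leb5]_z (phi z ^+ 3 * frob (U z) ^+ 3).
Proof.
have [mU _] := mfrob hU.
have iU := limit_cube_integrable.
have iUk k : leb5.-integrable setT (fun z => (frob (Uk k z) ^+ 3)%:E).
  exact: i3 (hUk k) (cube_bound (hUk k) M0 (Uk2 k) (DUk2 k)).
have iv k : leb5.-integrable setT (fun z => (frob (v k z) ^+ 3)%:E) by exact: i3 (hv k) (v3 k).
have ip (w : spacetime R -> R) : leb5.-integrable setT (fun z => (w z)%:E) ->
    leb5.-integrable setT (fun z => (phi z ^+ 3 * w z)%:E).
  exact: integrable_boundedM (mphi 3) (phi1 3).
pose d k z := frob (Uk k z) ^+ 3 - frob (v k z) ^+ 3 - frob (U z) ^+ 3.
have id k : leb5.-integrable setT (fun z => (d k z)%:E).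
  have := integrableB measurableT (integrableB measurableT (iUk k) (iv k)) iU.
  by apply: eq_integrable.
(* Brezis-Lieb: the mixed terms of the cube vanish in the limit. *)
have bl : (fun k => \int[leb5]_z (phi z ^+ 3 * d k z)) @ \oo --> (0 : R).
  pose h k z := \1_(tsupp phi) z *
    (frob (v k z) ^+ 2 * frob (U z) + frob (v k z) * frob (U z) ^+ 2).
  apply: (@Rintegral_squeeze _ _ _ _ _ h 3) => //.
  - by move=> k; exact: ip.
  - move=> k; apply: measurable_funM => //; apply: measurable_funD; apply: measurable_funM => //.
      exact: measurable_funX.
    exact: measurable_funX.
  - move=> k z; apply: mulr_ge0; first by have /andP[] := S01 z.
    by apply: addr_ge0; apply: mulr_ge0; rewrite ?sqr_ge0 ?frob_ge0.
  - move=> k z; rewrite normrM ger0_norm ?exprn_ge0// /h mulrCA.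
    apply: ler_pM => //; first exact: exprn_ge0.
    rewrite /d; apply: cubic_difference; [exact: frob_ge0|exact: frob_ge0| |].
      have := ler_frob_dist (v k z) (- U z); rewrite frobN opprK /v subrK; exact.
    by have := frob_triangle (v k z) (U z); rewrite /v subrK.
  - move=> e e0; apply: (vanishing_products mS mU mv S01 _ frobv0 v3 _ strong_phi e0) => //.
      by move=> z; exact: frob_ge0.
    exact: le_lt_trans (cube_bound hU M0 U2 DU2) (ltry _).
have E : (fun k => \int[leb5]_z (phi z ^+ 3 * frob (v k z) ^+ 3)) =
    (fun k => \int[leb5]_z (phi z ^+ 3 * frob (Uk k z) ^+ 3)
      - \int[leb5]_z (phi z ^+ 3 * frob (U z) ^+ 3) - \int[leb5]_z (phi z ^+ 3 * d k z)).
  apply/funext => k; have [j1 j2 j3] := And3 (ip _ (iUk k)) (ip _ iU) (ip _ (id k)).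
  have j12 : leb5.-integrable setT
      (fun z => (phi z ^+ 3 * frob (Uk k z) ^+ 3 - phi z ^+ 3 * frob (U z) ^+ 3)%:E).
    by have := integrableB measurableT j1 j2; apply: eq_integrable.
  rewrite -!RintegralB//; try exact: j1; try exact: j2; try exact: j3; try exact: j12.
  by apply: eq_Rintegral => z _; rewrite /d; ring.
rewrite E -[X in _ --> X]subr0; apply: cvgB; last exact: bl.
apply: cvgB; last exact: cvg_cst.
by apply: weak_nu; [exact: cphi|exists 1].
Qed.

Lemma difference_square_vanishes (e : R) : 0 < e -> \forall k \near \oo,
  (\int[leb5]_z (\1_(tsupp phi) z * frob (v k z) ^+ 2)%:E <= e%:E)%E.
Proof. exact: (vanishing_squares mS mv S01 frobv0 v3 strong_phi). Qed.

(** On the base class the derivative is moved onto the bump, and what remains is at most B times the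
    integral of |v_k| over a compact box, which tends to 0. The uniform L^2 bound on the gradients
    extends this to every square integrable f. *)
Let Dv_weakly_null i j (f : spacetime R -> R) : measurable_fun setT f -> sqint leb5 f ->
  (fun k => \int[leb5]_z (f z * Dv k z i j)) @ \oo --> (0 : R).
Proof.
move=> mf sf.
have mDv k : measurable_fun setT (fun z => Dv k z i j) by have [_ h _ _ _] := hv k; exact: h.
have sDv k : (\int[leb5]_z (Dv k z i j ^+ 2)%:E <= (S ^+ 2)%:E)%E.
  apply: le_trans (Dv2 k); apply: ge0_le_integral => //.
  - by move=> z _; rewrite lee_fin sqr_ge0.
  - by apply/measurable_EFinP; exact: measurable_funX.
  - by apply/measurable_EFinP; apply: measurable_funX; have [_ ] := mfrob (hv k).
  - move=> z _; rewrite lee_fin -[X in X <= _]real_normK ?num_real// lerXn2r ?nnegrE ?frob_ge0//.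
    exact: le_entry_frob.
suff base : forall (a b : spacetime R) n, weakly_null leb5 (fun k z => Dv k z i j)
    (fun z => bump4 a.1 b.1 n z.1 * \1_(`]a.2, b.2[%classic) z.2).
  by have [] := weakly_null_all mDv sDv base mf sf.
move=> a b n.
pose J : set (measurableTypeR R) := `]a.2, b.2[%classic.
have teta := test_function_bump4 a.1 b.1 n.
have [B etaB] := derive_test_bounded (basis4 R j) teta.
have meta : measurable_fun setT (fun z : spacetime R => bump4 a.1 b.1 n z.1).
  exact: measurableT_comp (measurable_test teta) measurable_fst.
have mdeta : measurable_fun setT (fun z : spacetime R => 'D_(basis4 R j) (bump4 a.1 b.1 n) z.1).
  exact: measurableT_comp (measurable_derive_test (basis4 R j) teta) measurable_fst.
have mJ : measurable_fun setT (fun z : spacetime R => \1_J z.2 : R).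
  apply: measurableT_comp (measurable_snd : measurable_fun setT (snd : spacetime R -> measurableTypeR R)).
  by apply: measurable_indic; exact: measurable_itv.
have J01 (t : R) : 0 <= (\1_J t : R) <= 1 by rewrite indicE; case: (_ \in _); rewrite ?lexx ler01.
have bnd z : `|- \1_J z.2 * 'D_(basis4 R j) (bump4 a.1 b.1 n) z.1| <= B * \1_(cbox5 a b) z.
  have B0 : 0 <= B := le_trans (normr_ge0 _) (etaB z.1).
  rewrite normrM normrN [\1_(cbox5 a b) z]indicE.
  have [z2|nz2] := pselect (J z.2); last first.
    by rewrite [\1_J _]indicE memNset// normr0 mul0r mulr_ge0.
  have [z1|nz1] := pselect (cbox4 a.1 b.1 z.1).
    rewrite mem_set; last by split => //; exact: subset_itv_oo_cc.
    have /andP[u0 u1] := J01 z.2; rewrite (ger0_norm u0) mulr1.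
    by rewrite (le_trans (ler_wpM2r _ u1))// mul1r.
  rewrite (derive_eq0_off_support (f := bump4 a.1 b.1 n)) ?normr0 ?mulr0 ?mulr_ge0// => z1; apply: nz1.
  rewrite (closure_id (cbox4 a.1 b.1)).1; last exact: closed_cbox4.
  move: z1; apply: closure_subset => x /=; apply: contra_neqP.
  by move=> nx; apply: bump4_eq0 => /box4_sub_cbox4.
have bndf (z : spacetime R) : `|bump4 a.1 b.1 n z.1 * \1_J z.2| <= \1_(cbox5 a b) z.
  have /andP[u0 u1] := J01 z.2; have e0 := bump4_ge0 a.1 b.1 n z.1.
  rewrite (ger0_norm (mulr_ge0 e0 u0)) [\1_(cbox5 a b) z]indicE.
  have [z1|nz1] := pselect (cbox5 a b z).
    by rewrite mem_set//; apply: mulr_ile1 => //; exact: bump4_le1.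
  rewrite memNset//=.
  have [z1|nz] := pselect (box4 a.1 b.1 z.1); last by rewrite bump4_eq0// mul0r.
  rewrite indicE memNset ?mulr0// => z2; apply: nz1; split; first exact: box4_sub_cbox4.
  exact: subset_itv_oo_cc.
have [p Kp] := compact_sub_box5 (@compact_cbox5 R a b).
have cbox_out z : ~ box5 (cst5 (- p%:R)) (cst5 p%:R) z -> \1_(cbox5 a b) z = 0 :> R.
  by move=> nz; rewrite indicE memNset// => /Kp.
have cbox1 z : (\1_(cbox5 a b) z : R) <= 1 by rewrite indicE; case: (_ \in _).
have mC : measurable_fun setT (\1_(cbox5 a b) : spacetime R -> R).
  apply: measurable_indic; rewrite -[cbox5 a b]setCK; apply: measurableC; apply: open5_measurable.
  by rewrite openC; apply: compact_closed; [exact: norm_hausdorff|exact: compact_cbox5].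
split.
- exact: measurable_funM.
- apply: (sqint_bounded (A := box5 (cst5 (- p%:R)) (cst5 p%:R)) (M := 1)).
  + exact: measurable_funM.
  + exact: measurable_box5.
  + exact: leb5_box5_lty.
  + by move=> z; apply: le_trans (bndf z) _.
  + by move=> z /cbox_out z0; apply/eqP; rewrite -normr_le0 -z0.
- have E : (fun k => \int[leb5]_z (bump4 a.1 b.1 n z.1 * \1_J z.2 * Dv k z i j))
      = (fun k => \int[leb5]_z (- \1_J z.2 * 'D_(basis4 R j) (bump4 a.1 b.1 n) z.1
                  * v k z i ord0)) by apply/funext => k; exact: H1field_by_parts (hv k).
  rewrite E; apply: (@Rintegral_squeeze _ _ _ _ _ (fun k z => \1_(cbox5 a b) z * frob (v k z)) B).
  + exact: le_trans (normr_ge0 _) (etaB 0).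
  + move=> k; have [mvk _ svk _ _] := hv k; apply: integrable_sqM.
    * by apply: measurable_funM => //; exact: measurableT_comp.
    * exact: mvk.
    * apply: (sqint_bounded (A := box5 (cst5 (- p%:R)) (cst5 p%:R)) (M := B)).
      -- by apply: measurable_funM => //; exact: measurableT_comp.
      -- exact: measurable_box5.
      -- exact: leb5_box5_lty.
      -- move=> z; apply: le_trans (bnd z) _; rewrite ler_piMr//.
         exact: le_trans (normr_ge0 _) (etaB 0).
      -- by move=> z /cbox_out z0; apply/eqP; rewrite -normr_le0 (le_trans (bnd z))// z0 mulr0.
    * exact: sqint_entry mvk svk.
  + by move=> k; exact: measurable_funM.
  + by move=> k z; apply: mulr_ge0; rewrite ?frob_ge0// indicE.
  + move=> k z; rewrite normrM mulrA; apply: ler_pM => //; exact: le_entry_frob.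
  + move=> e e0; have c := strong (@compact_cbox5 R a b).
    have e0' : (0%:E < e%:E)%E by rewrite lte_fin.
    by have := cvge_lt c e0'; apply: filterS => k /ltW.
Qed.

(** Expanding the square gives |Dv_k|^2 = |DU_k|^2 - |DU|^2 - 2 DU . Dv_k. The cross term is a
    finite sum over entries, in each of which phi^2 times an entry of DU is a fixed square
    integrable function paired with an entry of Dv_k. *)
Lemma cvg_difference_grad :
  (fun k => \int[leb5]_z (phi z ^+ 2 * frob (Dv k z) ^+ 2)) @ \oo
  --> \int[mu]_z (phi z ^+ 2) - \int[leb5]_z (phi z ^+ 2 * frob (DU z) ^+ 2).
Proof.
have [_ mDU _ sDU _] := hU.
have ip (w : spacetime R -> R) : leb5.-integrable setT (fun z => (w z)%:E) ->
    leb5.-integrable setT (fun z => (phi z ^+ 2 * w z)%:E).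
  exact: integrable_boundedM (mphi 2) (phi1 2).
have iij k i j : leb5.-integrable setT (fun z => (phi z ^+ 2 * DU z i j * Dv k z i j)%:E).
  have [_ mDv _ sDv _] := hv k.
  have := ip _ (integrable_sqM (mDU i j) (mDv i j) (sqint_entry i j mDU sDU) (sqint_entry i j mDv sDv)).
  by apply: eq_integrable => // z _; rewrite mulrA.
have isum k i : leb5.-integrable setT (fun z => (\sum_j phi z ^+ 2 * DU z i j * Dv k z i j)%:E).
  have := integrable_sum measurableT (index_enum 'I_4) (P := xpredT) (fun j _ => iij k i j).
  by apply: eq_integrable => // z _; rewrite -sumEFin.
have idot k : leb5.-integrable setT (fun z => (\sum_i \sum_j phi z ^+ 2 * DU z i j * Dv k z i j)%:E).
  have := integrable_sum measurableT (index_enum 'I_m) (P := xpredT) (fun i _ => isum k i).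
  by apply: eq_integrable => // z _; rewrite -sumEFin.
have dotE k z : \sum_i \sum_j phi z ^+ 2 * DU z i j * Dv k z i j
    = phi z ^+ 2 * frobdot (DU z) (Dv k z).
  rewrite /frobdot mulr_sumr; apply: eq_bigr => i _; rewrite mulr_sumr; apply: eq_bigr => j _.
  by rewrite mulrA.
have cross : (fun k => \int[leb5]_z (phi z ^+ 2 * frobdot (DU z) (Dv k z))) @ \oo --> (0 : R).
  rewrite (_ : (fun k => _) = (fun k => \sum_i \sum_j \int[leb5]_z (phi z ^+ 2 * DU z i j * Dv k z i j))).
    have mp i j : measurable_fun setT (fun z => phi z ^+ 2 * DU z i j) by exact: measurable_funM.
    have sp i j : sqint leb5 (fun z => phi z ^+ 2 * DU z i j).
      by apply: (sqint_bounded_mul (M := 1)) => //; exact: sqint_entry mDU sDU.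
    have := cvg_bigsum (r := index_enum 'I_m) (fun i => cvg_bigsum (r := index_enum 'I_4)
      (fun j => @Dv_weakly_null i j _ (mp i j) (sp i j))).
    by rewrite [X in _ --> X]big1// => i _; rewrite big1.
  apply/funext => k; under eq_Rintegral do rewrite -dotE.
  rewrite Rintegral_sum//; apply: eq_bigr => i _; rewrite Rintegral_sum//.
have E : (fun k => \int[leb5]_z (phi z ^+ 2 * frob (Dv k z) ^+ 2)) =
    (fun k => \int[leb5]_z (phi z ^+ 2 * frob (DUk k z) ^+ 2)
      - \int[leb5]_z (phi z ^+ 2 * frob (DU z) ^+ 2)
      - 2 * \int[leb5]_z (phi z ^+ 2 * frobdot (DU z) (Dv k z))).
  apply/funext => k.
  have id : leb5.-integrable setT (fun z => (phi z ^+ 2 * frobdot (DU z) (Dv k z))%:E).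
    by have := idot k; apply: eq_integrable => // z _; rewrite dotE.
  have [j1 j2] := conj (ip _ (i2 (hUk k))) (ip _ (i2 hU)).
  have j12 : leb5.-integrable setT
      (fun z => (phi z ^+ 2 * frob (DUk k z) ^+ 2 - phi z ^+ 2 * frob (DU z) ^+ 2)%:E).
    by have := integrableB measurableT j1 j2; apply: eq_integrable.
  have j3 : leb5.-integrable setT (fun z => (2 * (phi z ^+ 2 * frobdot (DU z) (Dv k z)))%:E).
    by have := integrableZl measurableT 2 id; apply: eq_integrable.
  rewrite -RintegralZl// -!RintegralB//; try exact: j1; try exact: j2; try exact: j3; try exact: j12.
  apply: eq_Rintegral => z _; have -> : DUk k z = Dv k z + DU z by rewrite /Dv subrK.
  have e (A B : 'M[R]_(m, 4)) : frobdot (A + B) (A + B) = frobdot A A + 2 * frobdot B A + frobdot B B.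
    rewrite frobdotDl (frobdotC A) (frobdotC B (A + B)) !frobdotDl (frobdotC A B); ring.
  by rewrite !sqr_frob e; ring.
rewrite E -[X in _ --> X]subr0; apply: cvgB.
  apply: cvgB; last exact: cvg_cst.
  by apply: weak_mu; [exact: cphi|exists 1].
rewrite -[X in _ --> X](mulr0 2); apply: cvgM; [exact: cvg_cst|exact: cross].
Qed.

Lemma defect_bounds :
  0 <= \int[nu]_z (phi z ^+ 3) - \int[leb5]_z (phi z ^+ 3 * frob (U z) ^+ 3) /\
  0 <= \int[mu]_z (phi z ^+ 2) - \int[leb5]_z (phi z ^+ 2 * frob (DU z) ^+ 2).
Proof.
split.
  apply: (limit_le_frequently (cvg_cst 0) cvg_difference_cube) => K; exists K => //.
  by apply: Rintegral_ge0 => z _; rewrite mulr_ge0// exprn_ge0// frob_ge0.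
apply: (limit_le_frequently (cvg_cst 0) cvg_difference_grad) => K; exists K => //.
by apply: Rintegral_ge0 => z _; rewrite mulr_ge0// exprn_ge0// frob_ge0.
Qed.

(** The lower-order term, with its constant depending on phi, carries |v_k|^2 on the support of phi
    and vanishes as k grows. It is therefore gone before phi is varied, and only the absolute factor
    18 q remains. *)
Lemma defect_comparison (q : R) : 0 <= q ->
  (forall K, exists2 k, (K <= k)%N & {ae l, forall t,
    (\int[leb4]_x ((phi (x, t) * frob (v k (x, t))) ^+ 2)%:E <= (q ^+ 2)%:E)%E}) ->
  \int[nu]_z (phi z ^+ 3) - \int[leb5]_z (phi z ^+ 3 * frob (U z) ^+ 3)
  <= 18 * q * (\int[mu]_z (phi z ^+ 2) - \int[leb5]_z (phi z ^+ 2 * frob (DU z) ^+ 2)).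
Proof.
move=> q0 often; have [B B0 HB] := localized_cube m tphi phi01.
set Y := (X in _ <= _ * X).
have cY : (fun k => 18 * q * (\int[leb5]_z (phi z ^+ 2 * frob (Dv k z) ^+ 2)
     + B * \int[leb5]_z (\1_(tsupp phi) z * frob (v k z) ^+ 2))) @ \oo --> 18 * q * Y.
  rewrite -[Y]addr0; apply: cvgM; first exact: cvg_cst.
  apply: cvgD; first exact: cvg_difference_grad.
  rewrite -[X in _ --> X](mulr0 B); apply: cvgM; first exact: cvg_cst.
  apply: (@Rintegral_squeeze _ _ _ _ _ (fun k z => \1_(tsupp phi) z * frob (v k z) ^+ 2) 1) => //.
  - move=> k; apply: (integrable_boundedM (M := 1) mS).
      by move=> z; have /andP[u0 u1] := S01 z; rewrite ger0_norm.
    by apply: sqint_integrable => //; case: (hv k).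
  - by move=> k; apply: measurable_funM => //; exact: measurable_funX.
  - by move=> k z; apply: mulr_ge0; rewrite ?sqr_ge0//; have /andP[] := S01 z.
  - by move=> k z; rewrite mul1r ger0_norm//; apply: mulr_ge0; rewrite ?sqr_ge0//; have /andP[] := S01 z.
  - exact: difference_square_vanishes.
apply: (limit_le_frequently cvg_difference_cube cY) => K; have [k Kk vq] := often K.
by exists k => //; exact: HB (hv k) q0 vq.
Qed.

End cutoff.
End sequences.

(** * Defect measures *)

Section measure_of_nonneg_charge.
Context d (T : measurableType d) (R : realType).
Variable nu : {charge set T -> \bar R}.
Hypothesis nu0 : forall A, measurable A -> (0 <= nu A)%E.

(** Measures cannot be subtracted, but charges can. The restriction gives the value 0 to sets that
    are not measurable, so that nonnegativity holds for every set, as [measure_of_charge]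
    demands. *)
Let nu' : {charge set T -> \bar R} := crestr0 nu (@measurableT _ T).

Let nu'_ge0 E : (0 <= nu' E)%E.
Proof.
rewrite /nu'/= /crestr0/=; case: ifPn => // /[1!inE] mE.
by rewrite /crestr setIT; exact: nu0.
Qed.

Definition measure_of_nonneg_charge := measure_of_charge _ nu'_ge0.

HB.instance Definition _ := Measure.on measure_of_nonneg_charge.

Let fin : fin_num_fun measure_of_nonneg_charge.
Proof. by move=> U mU; rewrite fin_num_measure. Qed.

HB.instance Definition _ := @Measure_isFinite.Build _ _ _ measure_of_nonneg_charge fin.

Lemma measure_of_nonneg_chargeE A : measurable A -> measure_of_nonneg_charge A = nu A.
Proof.
move=> mA; rewrite /measure_of_nonneg_charge /measure_of_charge /nu'/= /crestr0 mem_set//.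
by rewrite /crestr setIT.
Qed.

End measure_of_nonneg_charge.

Section finite_measure_operations.
Context d (T : measurableType d) (R : realType).
Implicit Types m : {finite_measure set T -> \bar R}.

Lemma measure_with_density (mu : {measure set T -> \bar R}) (f : T -> R) :
  mu.-integrable setT (EFin \o f) -> (forall x, 0 <= f x) ->
  exists m, forall A, measurable A -> m A = (\int[mu]_(x in A) (f x)%:E)%E.
Proof.
move=> fi f0.
have nu0 A : measurable A -> (0 <= induced_charge fi A)%E.
  by move=> mA; apply: integral_ge0 => x _; rewrite lee_fin.
exists (measure_of_nonneg_charge nu0) => A mA.
exact: (measure_of_nonneg_chargeE nu0 mA).
Qed.

Lemma measure_difference m1 m2 : (forall A, measurable A -> (m2 A <= m1 A)%E) ->
  exists m, forall A, measurable A -> (m1 A = m A + m2 A)%E.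
Proof.
move=> m21.
pose nu : {charge set T -> \bar R} :=
  cadd (charge_of_finite_measure m1) (cscale (-1) (charge_of_finite_measure m2)).
have nuE A : (nu A = m1 A - m2 A)%E by rewrite /nu/= /cadd/= /cscale mulN1e.
have nu0 A : measurable A -> (0 <= nu A)%E.
  by move=> mA; rewrite nuE sube_ge0 ?m21// fin_num_measure.
exists (measure_of_nonneg_charge nu0) => A mA.
transitivity (nu A + m2 A)%E; first by rewrite nuE subeK// fin_num_measure.
by congr (_ + _)%E; exact: (esym (measure_of_nonneg_chargeE nu0 mA)).
Qed.

Lemma measure_multiple m1 (K : R) : 0 <= K ->
  exists m, forall A, measurable A -> (m A = K%:E * m1 A)%E.
Proof.
move=> K0; pose nu : {charge set T -> \bar R} := cscale K (charge_of_finite_measure m1).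
have nu0 A : measurable A -> (0 <= nu A)%E by move=> mA; rewrite /nu/= /cscale mule_ge0.
exists (measure_of_nonneg_charge nu0) => A mA.
exact: (measure_of_nonneg_chargeE nu0 mA).
Qed.

(** f is identified with the Radon-Nikodym derivative of m by equality of integrals over all
    measurable sets, after which the change-of-variables formula applies. *)
Lemma integral_with_density (mu : {sigma_finite_measure set T -> \bar R}) m (f : T -> R) g :
  mu.-integrable setT (EFin \o f) ->
  (forall A, measurable A -> m A = (\int[mu]_(x in A) (f x)%:E)%E) ->
  m.-integrable setT g -> (\int[m]_x g x = \int[mu]_x (g x * (f x)%:E))%E.
Proof.
move=> fi mE gi; have mf : measurable_fun setT (EFin \o f) := measurable_int _ fi.
have mg : measurable_fun setT g := measurable_int _ gi.
have mmu : m `<< mu.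
  apply/null_content_dominatesP => A mA A0; have -> := mE _ mA.
  by apply: null_set_integral => //; exact: measurable_funTS.
rewrite -(Radon_Nikodym_change_of_variables mmu)//.
have h : ae_eq mu setT ('d (charge_of_finite_measure m) '/d mu) (EFin \o f).
  apply: integral_ae_eq => //; first exact: Radon_Nikodym_integrable.
  move=> E _ mEE; rewrite -Radon_Nikodym_integral//.
  exact: mE.
apply: ae_eq_integral => //.
- apply: emeasurable_funM => //; apply: measurable_int; exact: Radon_Nikodym_integrable.
- exact: emeasurable_funM.
- by apply: (aeS h) => x /= hx _; rewrite hx.
Qed.

(** On the part E of V where the density exceeds K, the integral of the positive function density
    minus K equals omega E - K lambda E, which is at most 0; hence E is null for lambda. *)
Lemma Radon_Nikodym_le (omega lambda : {finite_measure set T -> \bar R}) V (K : R) :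
  omega `<< lambda -> measurable V ->
  (forall A, measurable A -> A `<=` V -> (omega A <= K%:E * lambda A)%E) ->
  {ae lambda, forall x, V x -> (('d (charge_of_finite_measure omega) '/d lambda) x <= K%:E)%E}.
Proof.
move=> ol mV oK; set h := 'd _ '/d lambda.
have ih : lambda.-integrable setT h by exact: Radon_Nikodym_integrable.
have mh : measurable_fun setT h := measurable_int _ ih.
pose E := V `&` [set x | (K%:E < h x)%E].
have mE : measurable E.
  apply: measurableI => //.
  by rewrite -[X in measurable X]setTI; exact: emeasurable_fun_o_infty.
have ihE : lambda.-integrable E h by apply: (integrableS measurableT).
have iK : lambda.-integrable E (EFin \o cst K) by exact: finite_measure_integrable_cst.
have I0 : (\int[lambda]_(x in E) `|h x - K%:E| = 0)%E.
  apply/eqP; rewrite eq_le integral_ge0// andbT.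
  have -> : (\int[lambda]_(x in E) `|h x - K%:E| = \int[lambda]_(x in E) (h x - K%:E))%E.
    apply: eq_integral => x /[!inE] -[_ /= Kh].
    have h0 : (0 <= h x - K%:E)%E by rewrite sube_ge0// ltW.
    by rewrite gee0_abs.
  rewrite integralB// -Radon_Nikodym_integral// integral_cst//.
  have KE : (K%:E * lambda E)%E \is a fin_num by rewrite fin_numM// fin_num_measure.
  by rewrite sube_le0 ?KE ?orbT//; apply: oK => // x [].
have mhK : measurable_fun E (fun x => h x - K%:E)%E.
  by apply: emeasurable_funB => //; exact: measurable_funTS.
have /(ae_eq_integral_abs lambda mE mhK) hE := I0.
apply: (aeS hE) => x /= hx Vx; rewrite leNgt; apply/negP => Kh.
have h0 : (0 < h x - K%:E)%E by rewrite sube_gt0.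
have e : (h x - K%:E)%E = 0%E := hx (conj Vx Kh).
by rewrite e ltxx in h0.
Qed.

Lemma Rintegral_carried m D (f : T -> R) : measurable D -> m (~` D) = 0%E ->
  m.-integrable setT (EFin \o f) -> \int[m]_(x in D) f x = \int[m]_x f x.
Proof.
move=> mD D0 fi; rewrite /Rintegral; congr fine; apply/esym.
rewrite (negligible_integral (measurableC mD) measurableT fi D0).
by rewrite setDE setTI setCK.
Qed.

End finite_measure_operations.

Section limit_inferior.
Variable R : realType.
Implicit Types u v : (\bar R)^nat.

Lemma limn_einfE u : limn_einf u = ereal_sup (range (einfs u)).
Proof. by rewrite limn_einf_lim; apply/cvg_lim => //; exact: cvg_einfs_sup. Qed.

Lemma limn_einf_lt_frequently u (q : \bar R) : (limn_einf u < q)%E ->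
  forall K, exists2 k, (K <= k)%N & (u k < q)%E.
Proof.
rewrite limn_einfE => uq K.
have : (einfs u K < q)%E by apply: le_lt_trans uq; apply: ereal_sup_ubound; exists K.
by move=> /ereal_inf_lt[_ [k Kk <-] ukq]; exists k.
Qed.

Lemma limn_einf_le u v : (forall k, (u k <= v k)%E) -> (limn_einf u <= limn_einf v)%E.
Proof.
move=> uv; rewrite !limn_einfE; apply: ge_ereal_sup => _ [K _ <-].
apply: (@le_trans _ _ (einfs v K)); last by apply: ereal_sup_ubound; exists K.
apply: le_ereal_inf_tmp => _ [k Kk <-]; apply: le_trans (uv k).
by apply: ereal_inf_lbound; exists k.
Qed.

Lemma limn_einf_bounds u (M : \bar R) : (forall k, (0 <= u k <= M)%E) ->
  (0 <= limn_einf u <= M)%E.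
Proof.
move=> uM; rewrite limn_einfE; apply/andP; split.
  apply: (@le_trans _ _ (einfs u 0)); last by apply: ereal_sup_ubound; exists 0%N.
  by apply: le_ereal_inf_tmp => _ [k _ <-]; have /andP[] := uM k.
apply: ge_ereal_sup => _ [K _ <-]; have /andP[_] := uM K; apply: le_trans.
by apply: ereal_inf_lbound; exists K => /=.
Qed.

End limit_inferior.

Section open_sets.
Variable R : realType.

Let ccomp (X Y Z : topologicalType) (f : X -> Y) (g : Y -> Z) :
  continuous f -> continuous g -> continuous (g \o f).
Proof. by move=> cf cg x; apply: continuous_comp; [exact: cf|exact: cg]. Qed.

Lemma open_box5 (a b : spacetime R) : open (box5 a b).
Proof.
have [c1 c2 c3 c4 c5] := (continuous_coord5 R).
have o (f : spacetime R -> R) (s t : R) : continuous f -> open (f @^-1` `]s, t[).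
  by move=> /continuousP; apply; exact: itv_open.
have -> : box5 a b = (fun z => z.1.1.1.1) @^-1` `]a.1.1.1.1, b.1.1.1.1[
    `&` (fun z => z.1.1.1.2) @^-1` `]a.1.1.1.2, b.1.1.1.2[
    `&` (fun z => z.1.1.2) @^-1` `]a.1.1.2, b.1.1.2[
    `&` (fun z => z.1.2) @^-1` `]a.1.2, b.1.2[
    `&` (fun z => z.2) @^-1` `]a.2, b.2[.
  by apply/seteqP; split => [z [[[[]]]]//|z [[[[]]]]].
by do 4 (apply: openI; last exact: o); exact: o.
Qed.

Lemma open_cylinder (r : R) (z0 : spacetime R) : open (cylinder r z0).
Proof.
have [c1 c2 c3 c4 c5] := (continuous_coord5 R).
have sq (f : spacetime R -> R) (c : R) : continuous f -> continuous (fun z => (f z - c) ^+ 2).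
  move=> cf z; have d : (fun z => f z - c) @ z --> f z - c by apply: cvgB; [exact: cf|exact: cvg_cst].
  exact: (cvgM d d).
have cn : continuous (fun z : spacetime R => norm4 (z.1 - z0.1)).
  have cs : continuous (fun z : spacetime R => (z.1.1.1.1 - z0.1.1.1.1) ^+ 2
      + (z.1.1.1.2 - z0.1.1.1.2) ^+ 2 + (z.1.1.2 - z0.1.1.2) ^+ 2 + (z.1.2 - z0.1.2) ^+ 2 : R).
    move=> z; apply: cvgD; last exact: sq c4 z.
    apply: cvgD; last exact: sq c3 z.
    by apply: cvgD; [exact: sq c1 z|exact: sq c2 z].
  exact: ccomp cs (@sqrt_continuous R).
have -> : cylinder r z0 = (fun z => norm4 (z.1 - z0.1)) @^-1` [set x | x < r]
    `&` (fun z => z.2) @^-1` `]z0.2 - r ^+ 2 / 2, z0.2 + r ^+ 2 / 2[.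
  by apply/seteqP; split => z []/=; rewrite in_itv.
apply: openI.
  by move/continuousP: cn; apply; exact: open_lt.
by move/continuousP: c5; apply; exact: itv_open.
Qed.

Lemma cylinder_center (r : R) (z0 : spacetime R) : 0 < r -> cylinder r z0 z0.
Proof.
move=> r0; split; last first.
  have q : 0 < r ^+ 2 / 2 by rewrite divr_gt0// exprn_gt0.
  by rewrite ltrBlDr andbb ltrDl.
by rewrite /norm4 /= !subrr !expr0n/= !addr0 sqrtr0.
Qed.

Lemma cylinder_mono (r s : R) (z0 : spacetime R) : 0 < r -> r <= s ->
  cylinder r z0 `<=` cylinder s z0.
Proof.
move=> r0 rs z [zr /andP[h1 h2]].
have : r ^+ 2 <= s ^+ 2 by rewrite lerXn2r// nnegrE ltW// (lt_le_trans r0).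
by split; [exact: lt_le_trans rs|apply/andP; split; lra].
Qed.

Lemma countable_open_base : exists2 B : nat -> set (spacetime R), forall n, open (B n) &
  forall (O : set (spacetime R)) z, open O -> O z -> exists2 n, B n z & B n `<=` O.
Proof.
pose P := ((rat * rat * rat * rat * rat) * (rat * rat * rat * rat * rat))%type.
exists (fun n => if (unpickle n : option P) is Some p
  then box5 (ratr5 R p.1) (ratr5 R p.2) else set0).
  by move=> n; case: unpickle => [p|]; [exact: open_box5|exact: open0].
move=> O z oO Oz; have /nbhs_ballP[e /= e0 eO] : nbhs z O by exact: open_nbhs_nbhs.
have [p pz pe] := ball5_box z e0.
exists (pickle (p : P)); rewrite pickleK//.
by move=> y /pe; exact: eO.
Qed.

End open_sets.

Section defect_measures.
Variable R : realType.
Implicit Types (m mu nu lambda omega : {finite_measure set (spacetime R) -> \bar R}).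

(** The exponent is a successor so that a vanishing cutoff has vanishing power. Every such power
    tends to the indicator of O, which is why cubes and squares of the same cutoffs can be
    compared. *)
Lemma cvg_cutoff_integral (m : {measure set (spacetime R) -> \bar R}) (O : set (spacetime R))
    (phi : nat -> spacetime R -> R) (g : spacetime R -> R) p : open O ->
  (forall n, test_function (phi n)) -> (forall n z, 0 <= phi n z <= 1) ->
  (forall n z, ~ O z -> phi n z = 0) -> (forall z, O z -> (fun n => phi n z) @ \oo --> (1 : R)) ->
  m.-integrable setT (EFin \o g) ->
  (fun n => \int[m]_z (phi n z ^+ p.+1 * g z)) @ \oo --> fine (\int[m]_(z in O) (g z)%:E)%E.
Proof.
move=> oO tphi phi01 phi0 phi1 gi; have mO := open5_measurable oO.
have mg : measurable_fun setT g by have /measurable_int/measurable_EFinP := gi.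
have mphi n : measurable_fun setT (phi n).
  by apply: continuous5_measurable; have [/(_ 0%N)] := tphi n.
have mf n : measurable_fun setT (fun z => (phi n z ^+ p.+1 * g z)%:E).
  by apply/measurable_EFinP; apply: measurable_funM => //; exact: measurable_funX.
have mOg : measurable_fun setT (fun z => (\1_O z * g z)%:E).
  by apply/measurable_EFinP; apply: measurable_funM => //; exact: measurable_indic.
have cv z : (fun n => (phi n z ^+ p.+1 * g z)%:E) @ \oo --> (\1_O z * g z)%:E.
  apply/cvg_EFin; first exact: nearW.
  apply: cvgM; last exact: cvg_cst.
  rewrite indicE; have [Oz|nOz] := pselect (O z).
    rewrite mem_set// -[X in _ --> X](expr1n _ p.+1).
    exact: (cvg_comp _ _ (phi1 z Oz) (@exprn_continuous R p.+1 1)).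
  rewrite memNset// (_ : (fun n => _) = fun=> 0); first exact: cvg_cst.
  by apply/funext => n; rewrite phi0// expr0n.
have dom z n : (`|(phi n z ^+ p.+1 * g z)%:E| <= `|(g z)%:E|)%E.
  have /andP[a b] := phi01 n z; rewrite lee_fin normrM ler_piMl// ger0_norm ?exprn_ge0//.
  exact: exprn_ile1.
have [iO _ c] := dominated_convergence measurableT mf mOg (aeW _ (fun z _ => cv z))
  (integrable_abse gi) (aeW _ (fun z n _ => dom z n)).
have E : (\int[m]_z (\1_O z * g z)%:E = \int[m]_(z in O) (g z)%:E)%E.
  rewrite [RHS]integral_mkcond; apply: eq_integral => z _.
  by rewrite patchE indicE; case: (z \in O); rewrite ?mul1r ?mul0r.
apply: fine_cvg; rewrite -E fineK; first exact: c.
exact: integrable_fin_num iO.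
Qed.

Lemma cvg_cutoff_measure m (O : set (spacetime R)) (phi : nat -> spacetime R -> R) p : open O ->
  (forall n, test_function (phi n)) -> (forall n z, 0 <= phi n z <= 1) ->
  (forall n z, ~ O z -> phi n z = 0) -> (forall z, O z -> (fun n => phi n z) @ \oo --> (1 : R)) ->
  (fun n => \int[m]_z (phi n z ^+ p.+1)) @ \oo --> fine (m O).
Proof.
move=> oO tphi phi01 phi0 phi1; have mO := open5_measurable oO.
have i1 : m.-integrable setT (EFin \o (cst 1 : spacetime R -> R)).
  exact: finite_measure_integrable_cst.
have := cvg_cutoff_integral (m := m) p oO tphi phi01 phi0 phi1 i1.
have -> : (\int[m]_(z in O) (cst 1 z)%:E = m O)%E.
  by transitivity (\int[m]_(z in O) cst 1 z)%E; [by []|rewrite integral_cst// mul1e].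
suff -> : (fun n => \int[m]_z (phi n z ^+ p.+1 * cst 1 z)) =
  (fun n => \int[m]_z (phi n z ^+ p.+1)) by [].
by apply/funext => n; apply: eq_Rintegral => z _; rewrite mulr1.
Qed.

Lemma measure_le_of_opens omega lambda V (K : R) : open V -> 0 <= K ->
  (forall O, open O -> O `<=` V -> (omega O <= K%:E * lambda O)%E) ->
  forall A, measurable A -> A `<=` V -> (omega A <= K%:E * lambda A)%E.
Proof.
move=> oV K0 H A mA AV; have [m mE] := measure_multiple lambda K0.
rewrite -mE//; apply: (le_measure_on_opens oV) => // O oO OV.
by rewrite mE; [exact: H|exact: open5_measurable].
Qed.

Variables (mu nu : {finite_measure set (spacetime R) -> \bar R}) (f g : spacetime R -> R).
Hypotheses (fi : leb5.-integrable setT (EFin \o f)) (f0 : forall z, 0 <= f z)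
  (gi : leb5.-integrable setT (EFin \o g)) (g0 : forall z, 0 <= g z).

(** The measure with density h is dominated by m: on open sets by letting cutoffs tend to the
    indicator, on Borel sets by outer regularity of m. The defect is their difference. The power p +
    1 is the one in which the limits are known: 2 for gradients, 3 for the fields. *)
Lemma defect_measure m p (h : spacetime R -> R) : leb5.-integrable setT (EFin \o h) ->
  (forall z, 0 <= h z) ->
  (forall phi, test_function phi -> (forall z, 0 <= phi z <= 1) ->
    0 <= \int[m]_z (phi z ^+ p.+1) - \int[leb5]_z (phi z ^+ p.+1 * h z)) ->
  exists2 lambda : {finite_measure set (spacetime R) -> \bar R}, forall A, measurable A ->
     (m A = lambda A + \int[leb5]_(z in A) (h z)%:E)%E &
  forall phi : spacetime R -> R, measurable_fun setT phi -> (exists B, forall z, `|phi z| <= B) ->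
    \int[m]_z phi z = \int[leb5]_z (phi z * h z) + \int[lambda]_z phi z.
Proof.
move=> hi h0 H; have [alpha alphaE] := measure_with_density hi h0.
have am A : measurable A -> (alpha A <= m A)%E.
  move=> mA; apply: (@le_measure_on_opens _ alpha m setT openT _ A mA) => // O oO _.
  have mO := open5_measurable oO.
  have [phi [tphi phi01 phi0 phi1]] := open_cutoffs oO.
  have c1 := cvg_cutoff_measure (m := m) p oO tphi phi01 phi0 phi1.
  have c2 := cvg_cutoff_integral p oO tphi phi01 phi0 phi1 hi.
  have : fine (alpha O) <= fine (m O).
    rewrite alphaE//; apply: (limit_le_frequently c2 c1) => K; exists K => //.
    by rewrite -subr_ge0; exact: H.
  by rewrite -lee_fin !fineK ?fin_num_measure.
have [lambda lambdaE] := measure_difference am.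
exists lambda => [A mA|phi mphi [B phiB]]; first by rewrite lambdaE// alphaE.
have ifin m' : m'.-integrable setT (EFin \o phi).
  apply: (le_integrable measurableT _ _ (finite_measure_integrable_cst m' B measurableT)).
    exact/measurable_EFinP.
  by move=> z _ /=; rewrite lee_fin (le_trans (phiB z))// ler_norm.
have E1 : (\int[m]_z (phi z)%:E = \int[lambda]_z (phi z)%:E + \int[alpha]_z (phi z)%:E)%E.
  rewrite -(integral_measure_add measurableT (ifin lambda) (ifin alpha)).
  apply: eq_measure_integral => A mA _.
  by transitivity (lambda A + alpha A)%E; [exact: lambdaE|exact: (esym (measure_addE lambda alpha A))].
have E2 : (\int[alpha]_z (phi z)%:E = \int[leb5]_z (phi z * h z)%:E)%E.
  rewrite leb5E; rewrite leb5E in alphaE hi.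
  exact: (integral_with_density hi alphaE (ifin alpha)).
rewrite /Rintegral E1 fineD; [|exact: (integrable_fin_num _ (ifin lambda))|exact: (integrable_fin_num _ (ifin alpha))].
by rewrite E2 addrC.
Qed.

(** Both powers of the cutoffs tend to the indicator of O, so the mismatch of exponents disappears.
    Only cutoffs vanishing off O are tested, hence K may depend on O. *)
Lemma defect_le omega lambda (K : R) (O : set (spacetime R)) : 0 <= K -> open O ->
  (forall A, measurable A -> (nu A = omega A + \int[leb5]_(z in A) (g z)%:E)%E) ->
  (forall A, measurable A -> (mu A = lambda A + \int[leb5]_(z in A) (f z)%:E)%E) ->
  (forall phi, test_function phi -> (forall z, 0 <= phi z <= 1) -> (forall z, ~ O z -> phi z = 0) ->
    \int[nu]_z (phi z ^+ 3) - \int[leb5]_z (phi z ^+ 3 * g z)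
    <= K * (\int[mu]_z (phi z ^+ 2) - \int[leb5]_z (phi z ^+ 2 * f z))) ->
  (omega O <= K%:E * lambda O)%E.
Proof.
move=> K0 oO omegaE lambdaE H; have mO := open5_measurable oO.
have [phi [tphi phi01 phi0 phi1]] := open_cutoffs oO.
have c1 := cvg_cutoff_measure (m := nu) 2 oO tphi phi01 phi0 phi1.
have c2 := cvg_cutoff_integral 2 oO tphi phi01 phi0 phi1 gi.
have c3 := cvg_cutoff_measure (m := mu) 1 oO tphi phi01 phi0 phi1.
have c4 := cvg_cutoff_integral 1 oO tphi phi01 phi0 phi1 fi.
have sub m m' h : leb5.-integrable setT (EFin \o h) ->
    (m O = m' O + \int[leb5]_(z in O) (h z)%:E)%E ->
    fine (m' O) = fine (m O) - fine (\int[leb5]_(z in O) (h z)%:E)%E.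
  move=> hi ->; rewrite fineD ?fin_num_measure ?addrK//.
  by apply: integrable_fin_num => //; exact: integrableS hi.
have : fine (omega O) <= K * fine (lambda O).
  rewrite (sub _ _ _ gi (omegaE _ mO)) (sub _ _ _ fi (lambdaE _ mO)).
  apply: (limit_le_frequently (cvgB c1 c2) (cvgM (cvg_cst K) (cvgB c3 c4))) => N.
  by exists N => //; apply: H => // z; exact: phi0.
by rewrite -lee_fin EFinM !fineK ?fin_num_measure.
Qed.

(** F stands for the lower limit of the norms, of which only monotonicity and finiteness on open
    sets matter. On each base set the density is almost everywhere at most C times F of that set,
    and countability leaves a single null set. Off it, every cylinder around z0 contains a base set
    through z0, so the density is at most C times F of the cylinder; the limit as r tends to 0 is
    the infimum over r. *)
Lemma Radon_Nikodym_le_cylinders omega lambda (F : set (spacetime R) -> \bar R) (C : R) : 0 < C ->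
  omega `<< lambda ->
  (forall O, open O -> (0 <= F O < +oo)%E) ->
  (forall O O', open O -> open O' -> O `<=` O' -> (F O <= F O')%E) ->
  (forall O, open O -> (omega O <= C%:E * F O * lambda O)%E) ->
  {ae lambda, forall z0, exists2 l : \bar R,
    F (cylinder r z0) @[r --> 0^'+] --> l &
    (('d (charge_of_finite_measure omega) '/d lambda) z0 <= C%:E * l)%E}.
Proof.
move=> C0 ol F0 Fmono oF; have [B oB HB] := countable_open_base R.
have : {ae lambda, forall z0, forall n, B n z0 ->
    (('d (charge_of_finite_measure omega) '/d lambda) z0 <= (C * fine (F (B n)))%:E)%E}.
  apply: ae_foralln => n; have /andP[Fn0 Fnoo] := F0 _ (oB n).
  have Fn : F (B n) \is a fin_num by rewrite ge0_fin_numE.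
  have K0 : 0 <= C * fine (F (B n)) by rewrite mulr_ge0 ?fine_ge0// ltW.
  apply: Radon_Nikodym_le => //; first exact: open5_measurable.
  apply: (measure_le_of_opens (oB n) K0) => O oO On.
  apply: (le_trans (oF _ oO)); rewrite EFinM fineK//; apply: lee_wpmul2r => //.
  by apply: lee_wpmul2l; [rewrite lee_fin ltW|exact: Fmono].
move=> H; apply: (aeS H) => z0 hz.
exists (ereal_inf [set F (cylinder r z0) | r in [set` `]0, +oo[]]).
  apply: (@nondecreasing_at_right_cvge _ (fun r => F (cylinder r z0)) 0 +oo%O) => // r s.
  rewrite !in_itv/= !andbT => r0 s0 rs.
  by apply: Fmono; [exact: open_cylinder|exact: open_cylinder|exact: cylinder_mono].
rewrite -lee_pdivrMl//; apply: le_ereal_inf_tmp => y [r /=]; rewrite in_itv/= andbT => r0 <-{y}.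
have oc : open (cylinder r z0) by exact: open_cylinder.
rewrite lee_pdivrMl//.
have [n nz nc] := HB _ _ oc (cylinder_center z0 r0).
have /andP[Fn0 Fnoo] := F0 _ (oB n).
apply: (le_trans (hz n nz)); rewrite EFinM fineK ?ge0_fin_numE//.
by apply: lee_wpmul2l; [rewrite lee_fin ltW|exact: Fmono].
Qed.

End defect_measures.

(** * Fields on the slab *)

Section slab.
Variables (R : realType) (T : R).
Local Notation D := (slab T).

Lemma closed_slab : closed D.
Proof.
have [_ _ _ _ c5] := continuous_coord5 R.
rewrite -openC (_ : ~` D = (fun z => z.2) @^-1` (~` `[0, T])).
  by move/continuousP: c5; apply; rewrite openC; exact: itv_closed.
by apply/seteqP; split => z /=; rewrite in_itv.
Qed.

Lemma measurable_slab : measurable D.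
Proof.
rewrite -[D]setCK; apply: measurableC; apply: open5_measurable.
by rewrite openC; exact: closed_slab.
Qed.

(** Multiplication by the indicator makes the extension by 0 linear, so it commutes with
    differences. *)
Definition cut p q (f : spacetime R -> 'M[R]_(p, q)) (z : spacetime R) : 'M[R]_(p, q) :=
  \1_D z *: f z.

Lemma frob_cut p q (f : spacetime R -> 'M[R]_(p, q)) z : frob (cut f z) = frob (f z) * \1_D z.
Proof. by rewrite frobZ mulrC indicE; case: (_ \in _); rewrite ?normr1 ?normr0. Qed.

Lemma frob_cutB p q (f g : spacetime R -> 'M[R]_(p, q)) z :
  frob (cut f z - cut g z) = frob (f z - g z) * \1_D z.
Proof. by rewrite -(frob_cut (fun z => f z - g z)) /cut scalerBr. Qed.

Lemma measurable_cut p q (f : spacetime R -> 'M[R]_(p, q)) : mx_measurable D f ->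
  forall i j, measurable_fun setT (fun z => cut f z i j).
Proof.
move=> mf i j; have /(measurable_restrictT _ measurable_slab) := mf i j.
apply: eq_measurable_fun => z _; rewrite patchE mxE indicE.
by case: ifP => _; rewrite ?mul1r ?mul0r.
Qed.

Lemma cut_square_le p q (f : spacetime R -> 'M[R]_(p, q)) (M : R) : mx_measurable D f ->
  0 <= M -> (mixed_norm 2%:E 2%:E D f <= M%:E)%E ->
  (\int[leb5]_z (frob (cut f z) ^+ 2)%:E <= (M ^+ 2)%:E)%E.
Proof.
move=> mf M0 fM; have mD : measurable_fun setT (fun z => frob (f z) * \1_D z).
  rewrite (_ : (fun z => _) = (fun z => frob (cut f z))); last first.
    by apply/funext => z; rewrite frob_cut.
  exact: measurable_frob (measurable_cut mf).
have := mixed_norm22_le mD M0 fM; congr (_ <= _)%E.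
by apply: eq_integral => z _; rewrite frob_cut.
Qed.

Lemma cut_slices_le p q (f : spacetime R -> 'M[R]_(p, q)) (M : R) :
  0 <= M -> (mixed_norm +oo 2%:E D f <= M%:E)%E ->
  {ae @lebesgue_measure R, forall t,
    (\int[leb4]_x (frob (cut f (x, t)) ^+ 2)%:E <= (M ^+ 2)%:E)%E}.
Proof.
move=> M0 /(mixed_norm_oo2_le _ _ M0) H; apply: (aeS H) => t.
by congr (_ <= _)%E; apply: eq_integral => x _; rewrite frob_cut.
Qed.

Lemma mixed_norm_ge0 p q (f : spacetime R -> 'M[R]_(p, q)) r s (Q : set (spacetime R)) :
  (0 <= mixed_norm r s Q f)%E.
Proof. exact: Lnorm_ge0. Qed.

(** Slices with t in [0, T] are unchanged and all others are identically 0, so slicewise weak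
    gradients survive the extension. *)
Lemma H1field_cut m (u : spacetime R -> 'cV[R]_m) Du : L2H1 T u Du -> H1field (cut u) (cut Du).
Proof.
move=> [mu mDu su sDu wu].
have fin p q (f : spacetime R -> 'M[R]_(p, q)) : mx_measurable D f ->
    (mixed_norm 2%:E 2%:E D f < +oo)%E -> sqint leb5 (fun z => frob (cut f z)).
  move=> mf sf; have f0 := mixed_norm_ge0 f 2%:E 2%:E D.
  have fM : (mixed_norm 2%:E 2%:E D f <= (fine (mixed_norm 2%:E 2%:E D f))%:E)%E.
    by rewrite fineK// ge0_fin_numE.
  exact: le_lt_trans (cut_square_le mf (fine_ge0 f0) fM) (ltry _).
split; [exact: measurable_cut|exact: measurable_cut|exact: fin|exact: fin|].
apply: (aeS wu) => t wt; have [tT|ntT] := boolP (0 <= t <= T).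
  have E p q (f : spacetime R -> 'M[R]_(p, q)) : (fun x => cut f (x, t)) = (fun x => f (x, t)).
    by apply/funext => x; rewrite /cut indicE mem_set// scale1r.
  by rewrite !E; exact: wt.
have E p q (f : spacetime R -> 'M[R]_(p, q)) x : cut f (x, t) = 0.
  by rewrite /cut indicE memNset ?scale0r// => /= h; move: ntT; rewrite h.
have Z (h : space4 R -> R) : (forall x, h x = 0) -> \int[leb4]_x h x = 0.
  move=> h0; transitivity (\int[@leb4 R]_x (0 : R)); first by apply: eq_Rintegral => x _.
  by rewrite /Rintegral integral0.
by move=> phi tphi i j; rewrite !Z ?oppr0// => x; rewrite E mxE mul0r.
Qed.

Lemma Rintegral_cut p q (w : spacetime R -> 'M[R]_(p, q)) (f : spacetime R -> R) n :
  \int[leb5]_(z in D) (f z * frob (w z) ^+ n.+1) = \int[leb5]_z (f z * frob (cut w z) ^+ n.+1).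
Proof.
rewrite Rintegral_mkcond; apply: eq_Rintegral => z _.
rewrite patchE frob_cut indicE; case: ifP => _; first by rewrite mulr1.
by rewrite mulr0 expr0n/= mulr0.
Qed.

Lemma continuous_bounded_integrable (m : {finite_measure set (spacetime R) -> \bar R})
    (f : spacetime R -> R) : continuous f -> (exists B, forall z, `|f z| <= B) ->
  m.-integrable setT (EFin \o f).
Proof.
move=> cf [B fB]; have mf := continuous5_measurable cf.
apply: (le_integrable measurableT _ _ (finite_measure_integrable_cst m B measurableT)).
  exact/measurable_EFinP.
by move=> z _ /=; rewrite lee_fin (le_trans (fB z))// ler_norm.
Qed.

Lemma Rintegral_slab (m : {finite_measure set (spacetime R) -> \bar R}) (f : spacetime R -> R) :
  carried_by D m -> continuous f -> (exists B, forall z, `|f z| <= B) ->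
  \int[m]_(z in D) f z = \int[m]_z f z.
Proof.
move=> mD cf fB; apply: Rintegral_carried measurable_slab mD _.
exact: continuous_bounded_integrable.
Qed.

Lemma weak_cvg_cut p q (wk : nat -> spacetime R -> 'M[R]_(p, q)) n
    (m : {finite_measure set (spacetime R) -> \bar R}) (f : spacetime R -> R) :
  carried_by D m -> weak_cvg_measure D (fun k z => frob (wk k z) ^+ n.+1) m ->
  continuous f -> (exists B, forall z, `|f z| <= B) ->
  (fun k => \int[leb5]_z (f z * frob (cut (wk k) z) ^+ n.+1)) @ \oo --> \int[m]_z f z.
Proof.
move=> mD wk_m cf fB; rewrite -(Rintegral_slab mD cf fB).
have -> : (fun k => \int[leb5]_z (f z * frob (cut (wk k) z) ^+ n.+1)) =
    (fun k => \int[leb5]_(z in D) (f z * frob (wk k z) ^+ n.+1)).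
  by apply/funext => k; rewrite Rintegral_cut.
by apply: wk_m; [exact: continuous_subspaceT|have [B fM] := fB; exists B].
Qed.

(** The slab is closed, so a compact K meets it in a compact subset, to which the local convergence
    applies. *)
Lemma cvg_L1loc_cut m (uk : nat -> spacetime R -> 'cV[R]_m) (u : spacetime R -> 'cV[R]_m) K :
  cvg_L1loc D uk u -> compact K ->
  (fun k => \int[leb5]_z (\1_K z * frob (cut (uk k) z - cut u z))%:E)%E @ \oo --> 0%E.
Proof.
move=> H cK; have KD : compact (K `&` D) := compact_closedI cK closed_slab.
have -> : (fun k => \int[leb5]_z (\1_K z * frob (cut (uk k) z - cut u z))%:E)%E
    = (fun k => \int[leb5]_(z in K `&` D) (frob (uk k z - u z))%:E)%E.
  apply/funext => k; rewrite [RHS]integral_mkcond; apply: eq_integral => z _.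
  rewrite frob_cutB patchE in_setI !indicE.
  by case: (z \in K); case: (z \in D); rewrite /= ?mul1r ?mulr1 ?mul0r ?mulr0.
by apply: H => // z [].
Qed.

End slab.

(** * Mixed norms of differences on traces of open sets *)

Section differences.
Variables (R : realType) (T : R) (m : nat) (u w : spacetime R -> 'cV[R]_m).
Hypotheses (mu : mx_measurable (slab T) u) (mw : mx_measurable (slab T) w).
Local Notation N O := (mixed_norm +oo 2%:E (O `&` slab T) (fun z => u z - w z)).

Let h (O : set (spacetime R)) z : R := frob (u z - w z) * \1_(O `&` slab T) z.

Let hE O z : h O z = frob (cut T u z - cut T w z) * \1_O z.
Proof. by rewrite frob_cutB /h -mulrA indicI/= [\1_O z * _]mulrC. Qed.

Let h0 O z : 0 <= h O z.
Proof. by rewrite /h mulr_ge0 ?frob_ge0// indicE. Qed.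

Let mh O : open O -> measurable_fun setT (h O).
Proof.
move=> oO; rewrite (_ : h O = (fun z => frob (cut T u z - cut T w z) * \1_O z)); last first.
  by apply/funext => z; exact: hE.
apply: measurable_funM; last by apply: measurable_indic; exact: open5_measurable.
apply: measurable_frob => i j.
rewrite (_ : (fun z => _) = (fun z => cut T u z i j - cut T w z i j)).
  by apply: measurable_funB; exact: measurable_cut.
by apply/funext => z; rewrite !mxE.
Qed.

Let slice_le (f g : spacetime R -> R) t : measurable_fun setT f -> measurable_fun setT g ->
  (forall z, 0 <= f z <= g z) ->
  (\int[leb4]_x (f (x, t) ^+ 2)%:E <= \int[leb4]_x (g (x, t) ^+ 2)%:E)%E.
Proof.
move=> mf mg fg; apply: ge0_le_integral => //.
- by move=> x _; rewrite lee_fin sqr_ge0.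
- by apply/measurable_EFinP; apply: measurable_funX; exact: measurable_slice.
- by apply/measurable_EFinP; apply: measurable_funX; exact: measurable_slice.
- move=> x _; have /andP[f0 fgx] := fg (x, t).
  by rewrite lee_fin lerXn2r ?nnegrE// (le_trans f0).
Qed.

Lemma mixed_norm_slab_mono O O' : open O -> open O' -> O `<=` O' -> (N O <= N O')%E.
Proof.
move=> oO oO' OO'; have [->|Nfin] := eqVneq (N O') +oo%E; first by rewrite leey.
have N0 := mixed_norm_ge0 (fun z => u z - w z) +oo%E 2%:E (O' `&` slab T).
have NF : N O' \is a fin_num by rewrite ge0_fin_numE// ltey.
have F0 := fine_ge0 N0; rewrite -(fineK NF); apply/(mixed_norm_oo2_le _ _ F0).
have : (N O' <= (fine (N O'))%:E)%E by rewrite fineK.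
move=> /(mixed_norm_oo2_le _ _ F0) H; apply: (aeS H) => t; apply: le_trans.
apply: (slice_le t (mh oO) (mh oO')) => z; rewrite h0/= /h ler_wpM2l ?frob_ge0//.
rewrite !indicE; have [[Oz Dz]|nz] := pselect ((O `&` slab T) z).
  by rewrite !mem_set//; split => //; exact: OO'.
by rewrite (memNset nz) ler0n.
Qed.

Lemma mixed_norm_slab_le O (S : R) : open O -> 0 <= S ->
  {ae @lebesgue_measure R, forall t,
    (\int[leb4]_x (frob (cut T u (x, t) - cut T w (x, t)) ^+ 2)%:E <= (S ^+ 2)%:E)%E} ->
  (N O <= S%:E)%E.
Proof.
move=> oO S0 H; apply/(mixed_norm_oo2_le _ _ S0); apply: (aeS H) => t; apply: le_trans.
have E z : h setT z = frob (cut T u z - cut T w z) by rewrite hE indicT mulr1.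
under [X in (_ <= X)%E]eq_integral do rewrite -E.
apply: (slice_le t (mh oO) (mh openT)) => z; rewrite h0/= /h ler_wpM2l ?frob_ge0//.
rewrite setTI !indicE; have [[Oz Dz]|nz] := pselect ((O `&` slab T) z).
  by rewrite !mem_set.
by rewrite (memNset nz) ler0n.
Qed.

(** Off O the cutoff vanishes and on O it is at most 1, so phi times the difference is bounded by
    the difference restricted to O. This is how the norm over O alone enters the localized
    estimate. *)
Lemma cutoff_slices_le O (q : R) phi : open O -> 0 <= q -> (N O <= q%:E)%E ->
  test_function phi -> (forall z, 0 <= phi z <= 1) -> (forall z, ~ O z -> phi z = 0) ->
  {ae @lebesgue_measure R, forall t, (\int[leb4]_x
    ((phi (x, t) * frob (cut T u (x, t) - cut T w (x, t))) ^+ 2)%:E <= (q ^+ 2)%:E)%E}.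
Proof.
move=> oO q0 /(mixed_norm_oo2_le _ _ q0) H tphi phi01 phi0.
apply: (aeS H) => t; apply: le_trans.
have E z : phi z * frob (cut T u z - cut T w z) = phi z * h setT z.
  by rewrite hE indicT mulr1.
under [X in (X <= _)%E]eq_integral do rewrite E.
have mphi : measurable_fun setT phi by apply: continuous5_measurable; have [/(_ 0%N)] := tphi.
apply: (slice_le t (measurable_funM mphi (mh openT)) (mh oO)) => z.
have /andP[p0 p1] := phi01 z; rewrite mulr_ge0//=.
have [Oz|nOz] := pselect (O z); last by rewrite phi0// mul0r.
apply: (le_trans (ler_wpM2r (h0 setT z) p1)); rewrite mul1r !hE indicT.
by rewrite ler_wpM2l ?frob_ge0// indicE mem_set.
Qed.

End differences.

Lemma le_each_of_sum3 (R : realType) (a b c M : \bar R) : (0 <= a)%E -> (0 <= b)%E -> (0 <= c)%E ->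
  (a + b + c <= M)%E -> [/\ (a <= M)%E, (b <= M)%E & (c <= M)%E].
Proof.
move=> a0 b0 c0 H; split; apply: le_trans H.
- by rewrite -addeA leeDl// adde_ge0.
- by rewrite -addeA addeCA leeDl// adde_ge0.
- by rewrite leeDr// adde_ge0.
Qed.

Theorem lemma2p8 (R : realType) :
  exists2 C : R, 0 < C &
  forall (T : R) (m : nat)
    (uk : nat -> spacetime R -> 'cV[R]_m)
    (Duk : nat -> spacetime R -> 'M[R]_(m, 4))
    (u : spacetime R -> 'cV[R]_m) (Du : spacetime R -> 'M[R]_(m, 4))
    (mu nu : {finite_measure set (spacetime R) -> \bar R}),
  0 < T ->
  (forall k, LinfL2 T (uk k) /\ L2H1 T (uk k) (Duk k)) ->
  (exists M : R, forall k,
     (mixed_norm +oo 2%:E (slab T) (uk k)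
      + mixed_norm 2%:E 2%:E (slab T) (uk k)
      + mixed_norm 2%:E 2%:E (slab T) (Duk k) <= M%:E)%E) ->
  LinfL2 T u -> L2H1 T u Du ->
  weak_cvg_L2H1 T uk Duk u Du ->
  weak_star_cvg_LinfL2 T uk u ->
  cvg_L1loc (slab T) uk u ->
  carried_by (slab T) mu -> carried_by (slab T) nu ->
  weak_cvg_measure (slab T) (fun k z => frob (Duk k z) ^+ 2) mu ->
  weak_cvg_measure (slab T) (fun k z => frob (uk k z) ^+ 3) nu ->
  exists omega lambda : {finite_measure set (spacetime R) -> \bar R},
  [/\ carried_by (slab T) omega /\ carried_by (slab T) lambda,
      forall phi : spacetime R -> R, test_function phi ->
        \int[mu]_(z in slab T) phi z
        = \int[leb5]_(z in slab T) (phi z * frob (Du z) ^+ 2)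
          + \int[lambda]_(z in slab T) phi z
        /\
        \int[nu]_(z in slab T) phi z
        = \int[leb5]_(z in slab T) (phi z * frob (u z) ^+ 3)
          + \int[omega]_(z in slab T) phi z,
      omega `<< lambda,
      forall Q : set (spacetime R), open_in (slab T) Q ->
        (omega Q <=
         C%:E
         * limn_einf (fun k => mixed_norm +oo 2%:E Q (fun z => uk k z - u z)%R)
         * lambda Q)%E &
      {ae lambda, forall z0 : spacetime R,
        exists2 l : \bar R,
          limn_einf (fun k =>
            mixed_norm +oo 2%:E (cylinder r z0 `&` slab T)
              (fun z => uk k z - u z)) @[r --> 0^'+] --> l &
          (('d (charge_of_finite_measure omega) '/d lambda) z0
           <= C%:E * l)%E}].
Proof.
exists 18; first by [].
move=> T m uk Duk u Du mu nu T0 huk [M hM] [mu_ uoo] uH _ _ uL1 muD nuD wmu wnu.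
have [_ mDu _ Du22 _] := uH.
pose N1 := fine (mixed_norm +oo 2%:E (slab T) u).
pose N2 := fine (mixed_norm 2%:E 2%:E (slab T) Du).
(* One nonnegative bound for the sequence and for the limit. *)
pose P := Num.max `|M| (Num.max N1 N2).
have MP : M <= P by rewrite le_max ler_norm.
have P0 : 0 <= P by rewrite le_max normr_ge0.
have N1P : (mixed_norm +oo 2%:E (slab T) u <= P%:E)%E.
  rewrite -[X in (X <= _)%E]fineK ?ge0_fin_numE ?mixed_norm_ge0//.
  by rewrite lee_fin !le_max lexx orbT.
have N2P : (mixed_norm 2%:E 2%:E (slab T) Du <= P%:E)%E.
  rewrite -[X in (X <= _)%E]fineK ?ge0_fin_numE ?mixed_norm_ge0//.
  by rewrite lee_fin !le_max lexx !orbT.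
have hukP k : (mixed_norm +oo 2%:E (slab T) (uk k) <= P%:E)%E /\
    (mixed_norm 2%:E 2%:E (slab T) (Duk k) <= P%:E)%E.
  have [h1 _ h3] := le_each_of_sum3 (mixed_norm_ge0 _ _ _ _) (mixed_norm_ge0 _ _ _ _)
    (mixed_norm_ge0 _ _ _ _) (hM k).
  by split; [apply: le_trans h1 _|apply: le_trans h3 _]; rewrite lee_fin.
have hU := H1field_cut uH; have hUk k := H1field_cut (huk k).2.
have muk k : mx_measurable (slab T) (uk k) by have [[]] := huk k.
have mDuk k : mx_measurable (slab T) (Duk k) by have [_ []] := huk k.
have DU2 := cut_square_le mDu P0 N2P.
have DUk2 k := cut_square_le (mDuk k) P0 (hukP k).2.
have U2 := cut_slices_le P0 N1P; have Uk2 k := cut_slices_le P0 (hukP k).1.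
have strong K := @cvg_L1loc_cut R T m uk u K uL1.
have weak_mu f := @weak_cvg_cut R T _ _ Duk 1 mu f muD wmu.
have weak_nu f := @weak_cvg_cut R T _ _ uk 2 nu f nuD wnu.
have bounds phi := @defect_bounds R m _ _ _ _ mu nu P P0 hU hUk DU2 DUk2 U2 Uk2 strong
  weak_mu weak_nu phi.
have comparison phi := @defect_comparison R m _ _ _ _ mu nu P P0 hU hUk DU2 DUk2 U2 Uk2 strong
  weak_mu weak_nu phi.
pose f (z : spacetime R) := frob (cut T Du z) ^+ 2.
pose g (z : spacetime R) := frob (cut T u z) ^+ 3.
have fi : leb5.-integrable setT (EFin \o f) := limit_grad_integrable hU.
have gi : leb5.-integrable setT (EFin \o g) := limit_cube_integrable P0 hU DU2 U2.
have f0 z : 0 <= f z by exact: sqr_ge0.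
have g0 z : 0 <= g z by rewrite exprn_ge0// frob_ge0.
have [lambda lambdaE lambdaI] := defect_measure (m := mu) (p := 1) fi f0
  (fun phi tphi phi01 => (bounds phi tphi phi01).2).
have [omega omegaE omegaI] := defect_measure (m := nu) (p := 2) gi g0
  (fun phi tphi phi01 => (bounds phi tphi phi01).1).
have mD : measurable (slab T) by exact: measurable_slab.
have carried (m1 m2 : {finite_measure set (spacetime R) -> \bar R}) (h : spacetime R -> R) :
    (forall z, 0 <= h z) -> carried_by (slab T) m1 ->
    (forall A, measurable A -> (m1 A = m2 A + \int[leb5]_(z in A) (h z)%:E)%E) ->
    carried_by (slab T) m2.
  move=> h0 c1 mE; apply/eqP; rewrite eq_le measure_ge0 andbT -c1 mE; last exact: measurableC.
  by rewrite leeDl// integral_ge0// => z _; rewrite lee_fin.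
have lambdaD := carried _ _ _ f0 muD lambdaE; have omegaD := carried _ _ _ g0 nuD omegaE.
pose N O k := mixed_norm +oo 2%:E (O `&` slab T) (fun z => uk k z - u z).
pose F O := limn_einf (N O).
pose S := 2 * (P + P); have S0 : 0 <= S by rewrite mulr_ge0// addr_ge0.
have N0S O : open O -> forall k, (0 <= N O k <= S%:E)%E.
  move=> oO k; rewrite mixed_norm_ge0/=.
  apply: (mixed_norm_slab_le (muk k) mu_ oO S0).
  exact: (difference_slices P0 hU hUk U2 Uk2 k).
have F0S O : open O -> (0 <= F O <= S%:E)%E.
  by move=> oO; apply: limn_einf_bounds; exact: N0S.
have key O : open O -> (omega O <= 18%:E * F O * lambda O)%E.
  move=> oO; have /andP[FO0 FOS] := F0S O oO; have mO := open5_measurable oO.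
  have FO : F O \is a fin_num by rewrite ge0_fin_numE// (le_lt_trans FOS) ?ltry.
  have q0 := fine_ge0 FO0.
  (* Norms below F O + e occur for infinitely many k, whereas F O itself need not be undercut; the
     excess e is removed afterwards. *)
  have step (e : R) : 0 < e -> (omega O <= (18 * (fine (F O) + e))%:E * lambda O)%E.
    move=> e0; have qe : 0 <= fine (F O) + e by rewrite addr_ge0// ltW.
    apply: (defect_le fi gi _ oO omegaE lambdaE); first by rewrite mulr_ge0.
    move=> phi tphi phi01 phi0; apply: comparison => // K.
    have : (F O < (fine (F O) + e)%:E)%E by rewrite EFinD fineK// lteDl// lte_fin.
    move=> /limn_einf_lt_frequently/(_ K)[k Kk Nk]; exists k => //.
    exact: (cutoff_slices_le (muk k) mu_ oO qe (ltW Nk) tphi phi01 phi0).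
  rewrite -(fineK FO) -EFinM; move: (fine (F O)) q0 step => q q0 step.
  have oF : omega O \is a fin_num by exact: fin_num_measure.
  have lF : lambda O \is a fin_num by exact: fin_num_measure.
  have lO : 0 <= fine (lambda O) by rewrite fine_ge0.
  rewrite -(fineK oF) -(fineK lF) -EFinM lee_fin; apply/ler_addgt0Pr => e e0.
  (* With e / d0 as the excess, the error 18 (e / d0) lambda O is at most e; the added 1 covers the
     case lambda O = 0. *)
  have d0 : 0 < 18 * fine (lambda O) + 1 by rewrite ltr_wpDl// mulr_ge0.
  have := step _ (divr_gt0 e0 d0); rewrite -(fineK oF) -(fineK lF) -EFinM lee_fin.
  move=> H; apply: (le_trans H); rewrite mulrDr mulrDl lerD2l.
  rewrite mulrAC mulrA ler_pdivrMr// mulrC ler_wpM2l ?(ltW e0)//; lra.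
(* The uniform bound S on the norms gives one constant for all Borel sets, which yields absolute
   continuity. *)
have opens_le A : measurable A -> (omega A <= (18 * S)%:E * lambda A)%E.
  move=> mA; have S18 : 0 <= 18 * S by rewrite mulr_ge0.
  apply: (measure_le_of_opens openT S18 _ mA) => // O oO _.
  apply: (le_trans (key O oO)); apply: lee_wpmul2r => //; rewrite EFinM.
  by apply: lee_wpmul2l => //; have /andP[] := F0S O oO.
have ac : omega `<< lambda.
  apply/null_content_dominatesP => A mA A0; apply/eqP; rewrite eq_le measure_ge0 andbT.
  by have := opens_le A mA; rewrite A0 mule0.
exists omega, lambda; split => //.
- move=> phi tphi; have [B phiB] := test_function_bounded tphi.
  have cphi : continuous phi by have [/(_ 0%N)] := tphi.
  have mphi := continuous5_measurable cphi.
  have phiB' : exists B, forall z, `|phi z| <= B by exists B.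
  rewrite !Rintegral_slab// !Rintegral_cut.
  by rewrite (lambdaI _ mphi phiB') (omegaI _ mphi phiB').
(* Q is the trace of an open W. The norms in F see only the trace, and lambda has the same mass on W
   and on Q because it does not charge the complement of the slab. *)
- move=> Q [W oW QW]; rewrite QW.
  have mW : measurable W by exact: open5_measurable.
  have mWD : measurable (W `&` slab T) by exact: measurableI.
  have lW : (lambda W <= lambda (W `&` slab T))%E.
    apply: (@le_trans _ _ (lambda ((W `&` slab T) `|` ~` slab T))).
      apply: le_measure; rewrite ?inE//; first by apply: measurableU => //; exact: measurableC.
      by move=> z Wz; have [Dz|nDz] := pselect (slab T z); [left|right].
    apply: (@le_trans _ _ (lambda (W `&` slab T) + lambda (~` slab T))%E).
      by apply: measureU2 => //; exact: measurableC.
    by rewrite (lambdaD : lambda (~` slab T) = 0%E) adde0.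
  apply: (@le_trans _ _ (omega W)); first by apply: le_measure; rewrite ?inE.
  apply: (le_trans (key W oW)); apply: lee_wpmul2l => //.
  by apply: mule_ge0 => //; have /andP[] := F0S W oW.
- apply: (@Radon_Nikodym_le_cylinders R omega lambda F 18) => //.
    by move=> O oO; have /andP[-> h] := F0S O oO; rewrite (le_lt_trans h) ?ltry.
  by move=> O O' oO oO' OO'; apply: limn_einf_le => k; exact: mixed_norm_slab_mono.
Qed.
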